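(* Let $\dot H$ be a closed, symmetric, densely defined linear operator with deficiency indices $(1,1)$ in a complex separable Hilbert space $\mathcal{H}$, let $V=V^*\in\mathcal{B}(\mathcal{H})$, and let $\dot H^{(0)}=\dot H-V$, $\operatorname{dom}(\dot H^{(0)})=\operatorname{dom}(\dot H)$. Suppose $\dot H^{(0)}$ is bounded from below. Let $H_{\alpha_F}$ and $H^{(0)}_{\alpha^{(0)}_F}$ be the Friedrichs extensions of $\dot H$ and $\dot H^{(0)}$, and let $\beta,\beta^{(0)}\in[0,\pi)$, $\beta\ne\alpha_F$, be such that $\operatorname{dom}(H_\beta)=\operatorname{dom}(H^{(0)}_{\beta^{(0)}})$. Let $\eta_{\alpha_F}=\eta_{\alpha_F,\beta}$ and $\eta^{(0)}_{\alpha_F^{(0)}}=\eta^{(0)}_{\alpha_F^{(0)},\beta^{(0)}}$ be the functions in the exponential Herglotz representations of $m_{\alpha_F}(z)+\cot(\beta-\alpha_F)$ and $m^{(0)}_{\alpha_F^{(0)}}(z)+\cot(\beta^{(0)}-\alpha^{(0)}_F)$, respectively. Then $$\int_{\mathbb{R}}d\lambda\,(\lambda-z)^{-2}\big(\eta_{\alpha_F}(\lambda)-\eta^{(0)}_{\alpha_F^{(0)}}(\lambda)\big)=-\frac{d}{dz}\left(\frac{\big(u^{(0)}_+(z),Vu^{(0)}_+(z)\big)_{\mathcal{H}}}{m^{(0)}_{\alpha^{(0)}_F}(z)+\cot(\beta^{(0)}-\alpha_F^{(0)})}\right)+o(|z|^{-2})\quad\text{as }z\downarrow-\infty,$$ and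 $$\limsup_{z\downarrow-\infty}\int_{\mathbb{R}}d\lambda\,z^2(\lambda-z)^{-2}\big(\eta_{\alpha_F}(\lambda)-\eta^{(0)}_{\alpha_F^{(0)}}(\lambda)\big)\quad\text{exists (as a finite real number).}$$
   Context: Scalar products are linear in the second factor. Self-adjoint extensions: fix unit vectors $u_\pm\in\operatorname{dom}(\dot H^* )$ with $\dot H^*u_\pm=\pm iu_\pm$. The self-adjoint extensions $H_\alpha$, $\alpha\in[0,\pi)$, of $\dot H$ are $$\operatorname{dom}(H_\alpha)=\{f+c'(u_++e^{2i\alpha}u_-)\,:\,f\in\operatorname{dom}(\dot H),\,c'\in\mathbb{C}\},\qquad H_\alpha\big(f+c'(u_++e^{2i\alpha}u_-)\big)=\dot Hf+c'(iu_+-ie^{2i\alpha}u_-).$$ The parameter $\alpha_F\in[0,\pi)$ is the one for which $H_{\alpha_F}$ is the Friedrichs extension of $\dot H$. Donoghue $m$-function: $m_\alpha(z)=z+(1+z^2)(u_+,(H_\alpha-z)^{-1}u_+)_{\mathcal{H}}$, for $z$ in the resolvent set of $H_\alpha$ (in particular for $z<0$, $|z|$ large, when $\alpha=\alpha_F$). The operator $\dot H^{(0)}$ is also closed, symmetric, densely defined with deficiency indices $(1,1)$; the objects $u^{(0)}_\pm$, $H^{(0)}_{\alpha^{(0)}}$, $\alpha^{(0)}_F$, $m^{(0)}_{\alpha^{(0)}}(z)$ are defined in the same way with $\dot H$ replaced by $\dot H^{(0)}$. Since $V$ is bounded, $\operatorname{dom}(H_{\alpha_F})=\operatorname{dom}(H^{(0)}_{\alpha_F^{(0)}})$.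 Put $$u^{(0)}_+(z)=(H^{(0)}_{\alpha^{(0)}_F}-i)(H^{(0)}_{\alpha^{(0)}_F}-z)^{-1}u^{(0)}_+ .$$ Exponential Herglotz representations: $\eta_{\alpha_F,\beta}$ and $\eta^{(0)}_{\alpha_F^{(0)},\beta^{(0)}}$ are the (a.e. unique) measurable functions with values in $[0,1]$ such that, for $\operatorname{Im}z>0$ and some real constants $c_{\alpha_F,\beta}$, $c_{\alpha_F^{(0)},\beta^{(0)}}$, $$\ln\big(m_{\alpha_F}(z)+\cot(\beta-\alpha_F)\big)=c_{\alpha_F,\beta}+\int_{\mathbb{R}}d\lambda\,\Big(\frac{1}{\lambda-z}-\frac{\lambda}{\lambda^2+1}\Big)\eta_{\alpha_F,\beta}(\lambda),$$ $$\ln\big(m^{(0)}_{\alpha_F^{(0)}}(z)+\cot(\beta^{(0)}-\alpha_F^{(0)})\big)=c_{\alpha_F^{(0)},\beta^{(0)}}+\int_{\mathbb{R}}d\lambda\,\Big(\frac{1}{\lambda-z}-\frac{\lambda}{\lambda^2+1}\Big)\eta^{(0)}_{\alpha_F^{(0)},\beta^{(0)}}(\lambda),$$ where $\ln$ is the branch with $0<\operatorname{Im}\ln<\pi$ on the open upper half-plane. *)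

(* Defs.v *)
From HB Require Import structures.
From mathcomp Require Import all_boot all_order all_algebra.
From mathcomp Require Import complex ring.
From mathcomp Require Import all_classical all_reals all_analysis.

Set Implicit Arguments.
Unset Strict Implicit.
Unset Printing Implicit Defensive.

Import Order.TTheory GRing.Theory Num.Theory.
Import numFieldNormedType.Exports.

Local Open Scope classical_set_scope.
Local Open Scope complex_scope.
Local Open Scope ring_scope.

(* The library's [{dot U for theta}] is linear in its first argument; [inner]
   below swaps the arguments, so that it is linear in the second one. *)
HB.mixin Record isHilbert (R : realType) H of CompleteNormedModule R[i] H := {
  hdot : {dot H for @conjc R} ;
  hdot_norm : forall u : H, hdot u u = `|u| ^+ 2
}.

#[short(type="hilbertType")]
HB.structure Definition Hilbert (R : realType) :=
  {H of isHilbert R H & CompleteNormedModule R[i] H}.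

Definition inner (R : realType) (H : hilbertType R) (u v : H) : R[i] :=
  hdot v u.

Notation "⟨ u , v ⟩" := (inner u v) (at level 0, format "⟨ u ,  v ⟩").

Definition separable (T : topologicalType) :=
  exists D : set T, countable D /\ dense D.

Canonical ninfty_filter_on (R : numFieldType) :=
  FilterType (ninfty_nbhs R) _.

(* An unbounded operator is represented by its graph. *)
Section operators.
Variables (R : realType) (H : hilbertType R).
Implicit Types (A : set (H * H)) (V : H -> H) (z : R[i]).

Definition linear_operator A :=
  [/\ A (0, 0),
      (forall (c : R[i]) f g f' g',
         A (f, g) -> A (f', g') -> A (c *: f + f', c *: g + g')) &
      (forall f g g', A (f, g) -> A (f, g') -> g = g')].

Definition op_dom A : set H := [set f | exists g, A (f, g)].

Definition op_app A (f : H) : H := xget 0 [set g | A (f, g)].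

Definition op_graph V : set (H * H) := [set p | p.2 = V p.1].

Definition op_sub A V : set (H * H) := [set (p.1, p.2 - V p.1) | p in A].

Definition op_shift A z : set (H * H) := op_sub A (fun f => z *: f).

Definition op_inverse A : set (H * H) := [set (p.2, p.1) | p in A].

Definition op_resolvent A z (u : H) : H := op_app (op_inverse (op_shift A z)) u.

Definition op_adjoint A : set (H * H) :=
  [set p | forall f g, A (f, g) -> ⟨p.2, f⟩ = ⟨p.1, g⟩].

Definition symmetric_op A := A `<=` op_adjoint A.

Definition deficiency_space A z : set H := [set u | op_adjoint A (u, z *: u)].

Definition one_dimensional (E : set H) :=
  exists2 u, u != 0 & E = [set c *: u | c in [set: R[i]]].

Definition deficiency_indices_11 A :=
  one_dimensional (deficiency_space A 'i%C) /\
  one_dimensional (deficiency_space A (- 'i%C)).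

(* The order of [R[i]] relates numbers with equal imaginary parts. *)
Definition bounded_below A :=
  exists c : R, forall f g, A (f, g) -> c%:C * `|f| ^+ 2 <= ⟨f, g⟩.

(* Domain of the closure of the quadratic form f |-> ⟨f, A f⟩. *)
Definition form_domain A : set H :=
  [set h | exists f g : nat -> H,
    [/\ forall n, A (f n, g n),
        f n @[n --> \oo] --> h &
        (⟨f nm.1 - f nm.2, g nm.1 - g nm.2⟩ : R[i]^o)
          @[nm --> filter_prod \oo \oo] --> (0 : R[i]^o)]].

Definition friedrichs A : set (H * H) :=
  [set p | op_adjoint A p /\ form_domain A p.1].

Definition expi (t : R) : R[i] := cos t +i* sin t.

Definition sa_extension A (up um : H) (alpha : R) : set (H * H) :=
  [set p | exists f g (c : R[i]), A (f, g) /\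
     p = (f + c *: (up + expi (2 * alpha) *: um),
          g + c *: ('i%C *: up - ('i%C * expi (2 * alpha)) *: um))].

Definition donoghue_m A (up um : H) (alpha : R) z : R[i] :=
  z + (1 + z ^+ 2) * ⟨up, op_resolvent (sa_extension A up um alpha) z up⟩.

End operators.

Section herglotz.
Variable R : realType.

Definition cot (x : R) : R := cos x / sin x.

Definition cexp (w : R[i]) : R[i] :=
  (expR (complex.Re w))%:C * expi (complex.Im w).

(* Meant on the open upper half-plane only; see [cexp_cln] and [Im_cln]. *)
Definition cln (w : R[i]) : R[i] :=
  let r := complex.Re `|w| in ln r +i* acos (complex.Re w / r).

Lemma cexp_cln (w : R[i]) : 0 < complex.Im w -> cexp (cln w) = w.
Proof.
case: w => a b /= b0; rewrite /cexp /cln normc_def /=.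
set r := Num.sqrt _.
have ab0 : 0 < a ^+ 2 + b ^+ 2 by rewrite ltr_wpDl ?sqr_ge0// exprn_gt0.
have r0 : 0 < r by rewrite sqrtr_gt0.
have r2 : r ^+ 2 = a ^+ 2 + b ^+ 2 by rewrite sqr_sqrtr ?ltW.
have ar : `|a / r| < 1.
  rewrite normrM normfV (gtr0_norm r0) ltr_pdivrMr// mul1r.
  by rewrite -(@ltr_pXn2r _ 2) ?nnegrE ?(ltW r0)// r2 real_normK ?num_real//
    ltrDl exprn_gt0.
have /andP[ar1 ar2] : (-1 < a / r < 1) by rewrite -ltr_norml.
rewrite /expi lnK ?posrE// acosK ?in_itv/= ?ltW// sin_acos ?ltW//.
have -> : 1 - (a / r) ^+ 2 = (b / r) ^+ 2.
  by rewrite !expr_div_n r2; field; rewrite ?gt_eqF.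
rewrite sqrtr_sqr ger0_norm ?divr_ge0 ?ltW//.
have r_neq0 : r != 0 by rewrite gt_eqF.
by apply/eqP; rewrite eq_complex /=; apply/andP; split; apply/eqP; field.
Qed.

Lemma Im_cln (w : R[i]) : 0 < complex.Im w -> 0 < complex.Im (cln w) < pi.
Proof.
case: w => a b b0; rewrite /cln normc_def /=; rewrite /= in b0.
set r := Num.sqrt _.
have ab0 : 0 < a ^+ 2 + b ^+ 2 by rewrite ltr_wpDl ?sqr_ge0// exprn_gt0.
have r0 : 0 < r by rewrite sqrtr_gt0.
have r2 : r ^+ 2 = a ^+ 2 + b ^+ 2 by rewrite sqr_sqrtr ?ltW.
have ar : `|a / r| < 1.
  rewrite normrM normfV (gtr0_norm r0) ltr_pdivrMr// mul1r.
  by rewrite -(@ltr_pXn2r _ 2) ?nnegrE ?(ltW r0)// r2 real_normK ?num_real//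
    ltrDl exprn_gt0.
have /andP[ar1 ar2] : (-1 < a / r < 1) by rewrite -ltr_norml.
by rewrite acos_gt0 ?acos_ltpi ?ar1 ?ar2 ?(ltW ar1) ?(ltW ar2).
Qed.

Definition cintegral (f : R -> R[i]) : R[i] :=
  (\int[lebesgue_measure]_x complex.Re (f x))
  +i* (\int[lebesgue_measure]_x complex.Im (f x)).

Definition exp_herglotz (M : R[i] -> R[i]) (eta : R -> R) :=
  [/\ measurable_fun [set: R] eta,
      (forall l, 0 <= eta l <= 1) &
      exists c : R, forall z : R[i], 0 < complex.Im z ->
        cln (M z) = c%:C +
          cintegral (fun l => ((l%:C - z)^-1 - (l / (l ^+ 2 + 1))%:C)
                              * (eta l)%:C)].

Definition cderivable (F : R -> R[i]) (x : R) :=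
  derivable (@complex.Re R \o F) x 1 /\ derivable (@complex.Im R \o F) x 1.

Definition cderive1 (F : R -> R[i]) (x : R) : R[i] :=
  derive1 (@complex.Re R \o F) x +i* derive1 (@complex.Im R \o F) x.

End herglotz.

(* Main.v *)
Require Import Defs.
From mathcomp Require Import all_boot all_order all_algebra.
From mathcomp Require Import complex ring lra.
From mathcomp Require Import all_classical all_reals all_analysis.
From mathcomp Require Import measurable_realfun.

(** Put [M = m + cot] and [M0 = m0 + cot] for the two functions of the theorem,
    [u(x)] and [u0(x)] for the defect vectors (H - i)(H - x)^-1 u_+ of the two
    Friedrichs extensions, [R] and [R0] for their resolvents at a real [x] below
    both spectra, [q = (u0, V u0)] and [e = (V u0, R V u0)].

    The operators enter through one algebraic relation.  Up to a sign, [M(x)] is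
    the value of the boundary form of the maximal operator on [u(x)] and on the
    vector of the extension for beta that is congruent to u_+ modulo the
    Friedrichs domain ([bdry_defect]).  Adding V changes neither the boundary
    form nor these domains, and a constant multiple of [u(x)] equals
    [u0(x) - R V u0(x)].  Comparing boundary forms gives, for a constant
    kappa > 0,
    [kappa M = M0 - q + e] and [kappa |u|^2 = |u0 - R V u0|^2]
    ([krein_relation]).

    The exponents enter only through imaginary parts: arg M(x + i y) is the
    Poisson integral of [eta].  Near the negative axis M is negative and
    [M(x + i y) = M(x) + i y |u(x)|^2 + O(y^2)], so pi - arg M is O(y), which
    forces [eta = 1] almost everywhere near -oo ([ae0_of_poisson_le]).  The
    difference of the exponents is then supported in a half-line, and letting
    [y] tend to 0 in the difference of the arguments divided by [y] gives
    [|u|^2 / M - |u0|^2 / M0] for the integral of the theorem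
    ([herglotz_difference]).

    It remains to expand this quantity, and here the Friedrichs extension is
    essential: its m-function tends to -oo ([mreal_unbounded_below]), because
    otherwise the defect vector would lie in the form domain.  Together with the
    monotonicity of the m-function this gives [|u0|^2 / |M0| = O(1/|x|)]; every
    resolvent contributes a further factor [1/|x|].  Since
    [Q = q / M0], the terms of order [1/|x|^2] add up to [- Q'] and the others
    are [O(1/|x|^3)] ([log_derivative_expansion]). *)

Set Implicit Arguments.
Unset Strict Implicit.
Unset Printing Implicit Defensive.

Import Order.TTheory GRing.Theory Num.Theory.
Import numFieldNormedType.Exports.

Local Open Scope classical_set_scope.
Local Open Scope complex_scope.
Local Open Scope ring_scope.

Local Notation Re := complex.Re.
Local Notation Im := complex.Im.
Local Notation normc := ComplexField.Normc.normc.
Local Notation "z ^*" := (conjc z) : ring_scope.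

(** * Real and imaginary parts *)

Section complex_facts.
Variable R : realType.
Implicit Types z w : R[i].

Lemma cReD z w : Re (z + w) = Re z + Re w. Proof. by case: z; case: w. Qed.
Lemma cImD z w : Im (z + w) = Im z + Im w. Proof. by case: z; case: w. Qed.
Lemma cReN z : Re (- z) = - Re z. Proof. by case: z. Qed.
Lemma cImN z : Im (- z) = - Im z. Proof. by case: z. Qed.
Lemma cReB z w : Re (z - w) = Re z - Re w. Proof. by rewrite cReD cReN. Qed.
Lemma cImB z w : Im (z - w) = Im z - Im w. Proof. by rewrite cImD cImN. Qed.
Lemma cReM z w : Re (z * w) = Re z * Re w - Im z * Im w.
Proof. by case: z; case: w. Qed.
Lemma cImM z w : Im (z * w) = Re z * Im w + Im z * Re w.
Proof. by case: z; case: w. Qed.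
Lemma cReZ (a : R) z : Re (a%:C * z) = a * Re z.
Proof. by rewrite cReM /= mul0r subr0. Qed.
Lemma cImZ (a : R) z : Im (a%:C * z) = a * Im z.
Proof. by rewrite cImM /= mul0r addr0. Qed.
Lemma cReJ z : Re z^* = Re z. Proof. by case: z. Qed.
Lemma cImJ z : Im z^* = - Im z. Proof. by case: z. Qed.
Lemma complex_ext z w : Re z = Re w -> Im z = Im w -> z = w.
Proof. by case: z => a b; case: w => a' b' /= -> ->. Qed.
Lemma Im0_real z : Im z = 0 -> z = (Re z)%:C.
Proof. by case: z => a b /= ->. Qed.
Lemma conjcM z w : (z * w)^* = z^* * w^*. Proof. exact: rmorphM. Qed.
Lemma conjcN z : (- z)^* = - z^*. Proof. exact: rmorphN. Qed.
Lemma conjc_i : ('i%C : R[i])^* = - 'i%C.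
Proof. by apply: complex_ext => //=; rewrite oppr0. Qed.
Lemma gt0_realC (e : R[i]) : 0 < e -> 0 < Re e /\ e = (Re e)%:C.
Proof. by rewrite ltcE /= => /andP[/eqP i0 r0]; split => //; apply: Im0_real. Qed.
Lemma normcC z : `|z| = (normc z)%:C. Proof. by []. Qed.
Lemma normc_ge0 z : 0 <= normc z. Proof. by case: z => a b; apply: sqrtr_ge0. Qed.
Lemma sqr_normc_ReIm z : normc z ^+ 2 = Re z ^+ 2 + Im z ^+ 2.
Proof. by case: z => a b; rewrite sqr_sqrtr // addr_ge0 // sqr_ge0. Qed.
Lemma normcR (a : R) : normc a%:C = `|a|.
Proof. by rewrite /= expr0n /= addr0 sqrtr_sqr. Qed.
Lemma Re_le_normc z : `|Re z| <= normc z.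
Proof.
rewrite -(@ler_pXn2r _ 2) ?nnegrE ?normc_ge0 ?normr_ge0 // sqr_normc_ReIm.
by rewrite real_normK ?num_real // lerDl sqr_ge0.
Qed.
Lemma normc_le z (e : R) : 0 <= e -> `|Re z| <= e -> Im z = 0 -> normc z <= e.
Proof. by move=> e0 h i0; rewrite (Im0_real i0) normcR. Qed.
End complex_facts.

(** * The real-valued norm of a complex Hilbert space *)

Section hilbert.
Variables (R : realType) (H : hilbertType R).
Implicit Types (u v w : H) (c z : R[i]).

Lemma innerDr u v w : ⟨u, v + w⟩ = ⟨u, v⟩ + ⟨u, w⟩.
Proof. exact: linearDl. Qed.
Lemma innerDl u v w : ⟨u + v, w⟩ = ⟨u, w⟩ + ⟨v, w⟩.
Proof. exact: linearDr. Qed.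
Lemma innerC u v : ⟨v, u⟩ = ⟨u, v⟩^*.
Proof. by rewrite /inner (@hermC _ false (@conjc R)) /= mul1r. Qed.
Lemma innerZr c u v : ⟨u, c *: v⟩ = c * ⟨u, v⟩.
Proof. exact: linearZl_LR. Qed.
Lemma innerZl c u v : ⟨c *: u, v⟩ = c^* * ⟨u, v⟩.
Proof. by rewrite innerC innerZr conjcM -innerC. Qed.
Lemma innerNr u v : ⟨u, - v⟩ = - ⟨u, v⟩.
Proof. by rewrite -scaleN1r innerZr mulN1r. Qed.
Lemma innerNl u v : ⟨- u, v⟩ = - ⟨u, v⟩.
Proof. by rewrite innerC innerNr conjcN -innerC. Qed.
Lemma innerBr u v w : ⟨u, v - w⟩ = ⟨u, v⟩ - ⟨u, w⟩.
Proof. by rewrite innerDr innerNr. Qed.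
Lemma innerBl u v w : ⟨u - v, w⟩ = ⟨u, w⟩ - ⟨v, w⟩.
Proof. by rewrite innerDl innerNl. Qed.
Lemma inner0r u : ⟨u, 0⟩ = 0.
Proof. by rewrite -(subrr u) innerBr subrr. Qed.
Lemma inner0l u : ⟨0, u⟩ = 0.
Proof. by rewrite -(subrr u) innerBl subrr. Qed.

Definition innerE :=
  (innerDr, innerDl, innerZr, innerZl, innerNr, innerNl, inner0r, inner0l).

Definition nrm u : R := Re `|u|.

Lemma nrmE u : `|u| = (nrm u)%:C.
Proof. by apply: Im0_real; apply: ger0_Im. Qed.
Lemma nrm_ge0 u : 0 <= nrm u.
Proof. by have := normr_ge0 u; rewrite nrmE ler0c. Qed.
Lemma inner_self u : ⟨u, u⟩ = (nrm u ^+ 2)%:C.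
Proof. by rewrite /inner hdot_norm nrmE rmorphXn. Qed.
Lemma nrm0 : nrm 0 = 0. Proof. by rewrite /nrm normr0. Qed.
Lemma nrm_eq0 u : nrm u = 0 -> u = 0.
Proof. by move=> h; apply/eqP; rewrite -normr_eq0 nrmE h. Qed.
Lemma nrmN u : nrm (- u) = nrm u. Proof. by rewrite /nrm normrN. Qed.
Lemma nrmD u v : nrm (u + v) <= nrm u + nrm v.
Proof. by have := ler_normD u v; rewrite !nrmE -rmorphD lecR. Qed.
Lemma nrmB u v : nrm (u - v) <= nrm u + nrm v.
Proof. by rewrite -(nrmN v) nrmD. Qed.
Lemma nrmBC u v : nrm (u - v) = nrm (v - u).
Proof. by rewrite -nrmN opprB. Qed.
Lemma nrmZ c u : nrm (c *: u) = normc c * nrm u.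
Proof. by rewrite /nrm normrZ normcC cReZ. Qed.
Lemma nrm1 u : `|u| = 1 -> nrm u = 1.
Proof. by rewrite /nrm => ->. Qed.

Lemma nrm2 u : Re ⟨u, u⟩ = nrm u ^+ 2. Proof. by rewrite inner_self. Qed.
Lemma Re_innerC u v : Re ⟨u, v⟩ = Re ⟨v, u⟩.
Proof. by rewrite innerC cReJ. Qed.

Lemma nrm2D u v : nrm (u + v) ^+ 2 = nrm u ^+ 2 + 2 * Re ⟨u, v⟩ + nrm v ^+ 2.
Proof. by rewrite -!nrm2 !innerE !cReD (Re_innerC v u); ring. Qed.
Lemma nrm2B u v : nrm (u - v) ^+ 2 = nrm u ^+ 2 - 2 * Re ⟨u, v⟩ + nrm v ^+ 2.
Proof. by rewrite nrm2D nrmN innerNr cReN; ring. Qed.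

(** The triangle inequality suffices: 2 Re (u, v) is the excess of |u + v|^2
    over |u|^2 + |v|^2. *)
Lemma Re_inner_le u v : Re ⟨u, v⟩ <= nrm u * nrm v.
Proof.
have : nrm (u + v) ^+ 2 <= (nrm u + nrm v) ^+ 2.
  by rewrite ler_sqr ?nnegrE ?nrmD // ?addr_ge0 // ?nrm_ge0.
by rewrite nrm2D; lra.
Qed.

Lemma Re_inner_norm u v : `|Re ⟨u, v⟩| <= nrm u * nrm v.
Proof.
rewrite ler_norml Re_inner_le andbT lerNl -cReN -innerNr -(nrmN v).
exact: Re_inner_le.
Qed.

(** Rotating [v] by the conjugate phase makes the inner product nonnegative,
    which reduces the claim to real parts. *)
Lemma cauchy_schwarz u v : normc ⟨u, v⟩ <= nrm u * nrm v.
Proof.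
set w := ⟨u, v⟩.
have [->|w0] := eqVneq (normc w) 0; first by rewrite mulr_ge0 ?nrm_ge0.
have wp : 0 < normc w by rewrite lt_neqAle eq_sym w0 normc_ge0.
have := Re_inner_le u (w^* *: v); rewrite innerZr -/w nrmZ.
have -> : Re (w^* * w) = normc w ^+ 2.
  by rewrite sqr_normc_ReIm cReM cReJ cImJ; ring.
have -> : normc w^* = normc w.
  by apply: complexI; rewrite -!normcC normcJ.
by rewrite mulrCA => h; rewrite -(ler_pM2l wp) -expr2.
Qed.

Lemma ortho_all0 u : (forall v, ⟨u, v⟩ = 0) -> u = 0.
Proof.
move=> /(_ u); rewrite inner_self => /complexI /eqP.
by rewrite sqrf_eq0 => /eqP /nrm_eq0.
Qed.

(** Turns an identity between vectors into one between complex numbers, where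
    the ring tactic applies; see [vring]. *)
Lemma inner_ext u v : (forall w, ⟨w, u⟩ = ⟨w, v⟩) -> u = v.
Proof.
move=> h; apply/eqP; rewrite -subr_eq0; apply/eqP; apply: ortho_all0 => w.
by rewrite innerBl !(innerC w) h subrr.
Qed.

Lemma parallelogram u v :
  nrm (u + v) ^+ 2 + nrm (u - v) ^+ 2 = 2 * nrm u ^+ 2 + 2 * nrm v ^+ 2.
Proof. by rewrite nrm2D nrm2B; ring. Qed.

Lemma cvg_nrmP (I : Type) (F : set_system I) {FF : Filter F} (f : I -> H) l :
  f @ F --> l <-> forall e : R, 0 < e -> \forall n \near F, nrm (l - f n) < e.
Proof.
split => [/cvgrPdist_lt h e e0|h].
  have := h e%:C; rewrite ltcR => /(_ e0).
  by apply: filterS => n; rewrite nrmE ltcR.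
apply/cvgrPdist_lt => e /gt0_realC[e0 ->]; have := h _ e0.
by apply: filterS => n; rewrite nrmE ltcR.
Qed.

Lemma cvg_seqP (f : nat -> H) l :
  f n @[n --> \oo] --> l <->
  forall e : R, 0 < e -> exists N, forall n, (N <= n)%N -> nrm (l - f n) < e.
Proof.
split => [/cvg_nrmP h e /h[N _ hN]|h]; first by exists N => n /hN.
by apply/cvg_nrmP => e /h[N hN]; exists N.
Qed.

Lemma cauchy_seq_cvg (f : nat -> H) :
  (forall e : R, 0 < e -> exists N, forall n m, (N <= n)%N -> (N <= m)%N ->
     nrm (f n - f m) < e) ->
  exists l : H, f n @[n --> \oo] --> l.
Proof.
move=> h; apply/cvg_ex.
apply: cauchy_cvg; apply: cauchy_exP => e.
move=> /gt0_realC[e0 ->]; have [N hN] := h _ e0.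
exists (f N); exists N => //= n Nn.
by rewrite -ball_normE /ball_ /= nrmE ltcR hN //=.
Qed.

(** The form of closedness that passes from the graph of an operator to its
    range, where one is given convergent sequences of values. *)
Definition seq_closed (T : topologicalType) (M : set T) :=
  forall (f : nat -> T) l, (forall n, M (f n)) -> f n @[n --> \oo] --> l -> M l.

Lemma closed_seq_closed (T : topologicalType) (M : set T) :
  closed M -> seq_closed M.
Proof.
move=> cM f l Mf fl; apply: (closed_cvg _ cM _ _ fl).
by apply: nearW => n; apply: Mf.
Qed.

End hilbert.

(** Decides linear identities between vectors by taking inner products with an
    arbitrary vector. *)
Ltac vring := apply: inner_ext => ?; rewrite ?innerE; ring.

(** * Orthogonal projection *)

Section projection.
Variables (R : realType) (H : hilbertType R).
Implicit Types (u v w : H) (c z : R[i]).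

Definition subspace (M : set H) :=
  M 0 /\ forall c f g, M f -> M g -> M (c *: f + g).

(** Moving from the minimizer by [s (m, y) m] changes the squared distance by
    [- 2 s |(m, y)|^2 + O(s^2)]. *)
Lemma minimizer_ortho (M : set H) y : subspace M ->
  (forall m, M m -> nrm y ^+ 2 <= nrm (y - m) ^+ 2) ->
  forall m, M m -> ⟨m, y⟩ = 0.
Proof.
move=> [M0 Ml] hy m Mm; set b := ⟨m, y⟩.
suff : normc b ^+ 2 = 0 by move/eqP; rewrite sqrf_eq0 => /eqP/ComplexField.Normc.eq0_normc.
apply/eqP/negPn/negP => b0.
have bp : 0 < normc b ^+ 2 by rewrite lt_neqAle eq_sym b0 sqr_ge0.
have key (s : R) : 2 * s * normc b ^+ 2 <= s ^+ 2 * normc b ^+ 2 * nrm m ^+ 2.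
  have := hy (s%:C * b *: m); rewrite nrm2B innerZr nrmZ.
  have /[swap] /[apply] : M (s%:C * b *: m).
    by rewrite -[X in M X]addr0; apply: (Ml).
  rewrite (innerC m y) -/b ComplexField.Normc.normcM normcR.
  have -> : Re (s%:C * b * b^*) = s * normc b ^+ 2.
    by rewrite sqr_normc_ReIm -mulrA cReZ cReM cReJ cImJ; ring.
  by rewrite !exprMn real_normK ?num_real //; lra.
have m0 : 0 < nrm m ^+ 2 + 1 by rewrite ltr_wpDl ?sqr_ge0.
have s0 : 0 < (nrm m ^+ 2 + 1)^-1 by rewrite invr_gt0.
have := key (nrm m ^+ 2 + 1)^-1; apply/negP; rewrite -ltNge.
set s := _^-1 in s0 *.
have sE : s * (nrm m ^+ 2 + 1) = 1 by rewrite mulVf // gt_eqF.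
rewrite [ltLHS](_ : _ = s * (s * nrm m ^+ 2) * normc b ^+ 2); last by ring.
rewrite ltr_pM2r // [ltRHS]mulrC ltr_pM2l //; lra.
Qed.

(** Stands for 1/(n+1); abstracting the values makes them atoms for linear
    arithmetic. *)
Lemma positive_null_sequence : exists iv : nat -> R, (forall n, 0 < iv n) /\
  forall e, 0 < e -> exists N, forall n, (N <= n)%N -> iv n < e.
Proof.
exists (fun n => n.+1%:R^-1); split=> [n|e e0]; first by rewrite invr_gt0.
have [N _ hN] := @near_infty_natSinv_lt R (PosNum e0).
by exists N => n Nn; apply: hN.
Qed.

(** A minimizing sequence for the distance is Cauchy by the parallelogram law. *)
Lemma projection (M : set H) x : subspace M -> seq_closed M ->
  exists p, M p /\ forall m, M m -> ⟨m, x - p⟩ = 0.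
Proof.
move=> sM cM; have [M0 Ml] := sM.
pose S : set R := [set nrm (x - m) ^+ 2 | m in M].
have Sne : has_inf S.
  split; first by exists (nrm (x - 0) ^+ 2); exists 0.
  by exists 0 => _ [m _ <-]; apply: sqr_ge0.
pose d := inf S.
have dle m : M m -> d <= nrm (x - m) ^+ 2.
  by move=> Mm; apply: ge_inf; [case: Sne|exists m].
have d0 : 0 <= d by apply: lb_le_inf; [case: Sne|move=> _ [m _ <-]; apply: sqr_ge0].
have infS (e : R) : 0 < e -> exists2 y, S y & y < d + e.
  by move=> e0; exact: inf_adherent.
clearbody d.
have [iv [iv0 half]] := positive_null_sequence.
have appr (n : nat) : exists m, M m /\ nrm (x - m) ^+ 2 < d + iv n.
  have [_ [m Mm <-] h] := infS _ (iv0 n).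
  by exists m.
have [f hf] := choice appr.
have fd n k : nrm (f n - f k) ^+ 2 <= 2 * iv n + 2 * iv k.
  have := parallelogram (x - f n) (x - f k).
  have -> : x - f n - (x - f k) = f k - f n by rewrite opprB addrC addrA subrK.
  have -> : x - f n + (x - f k) = 2 *: (x - 2^-1 *: (f n + f k)).
    rewrite scalerBr scalerA divff ?pnatr_eq0 // scale1r scaler_nat mulr2n.
    by rewrite addrACA opprD.
  have Mh : M (2^-1 *: (f n + f k)).
    rewrite scalerDr; apply: (Ml); first by case: (hf n).
    by rewrite -[X in M X]addr0; apply: (Ml) => //; case: (hf k).
  have -> (v : H) : nrm (2 *: v) = 2 * nrm v.
    by rewrite nrmZ -[2]/(2%:R) -(rmorph_nat (real_complex R)) normcR normr_nat.
  have := dle _ Mh; have [_] := hf n; have [_] := hf k.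
  rewrite (nrmBC (f k)) exprMn; set y := nrm (x - _ *: _) ^+ 2; lra.
have [p fp] : exists l : H, f n @[n --> \oo] --> l.
  apply: cauchy_seq_cvg => e e0.
  have e2 : 0 < e ^+ 2 / 4 by rewrite divr_gt0 ?exprn_gt0.
  have [N hN] := half _ e2.
  exists N => n m /hN hn /hN hm.
  rewrite -(@ltr_pXn2r _ 2) ?nnegrE ?nrm_ge0 ?(ltW e0) //.
  apply: (le_lt_trans (fd n m)); lra.
have Mp : M p by apply: cM fp => n; case: (hf n).
exists p; split=> //; apply: minimizer_ortho => // m Mm.
rewrite (_ : x - p - m = x - (p + m)); last by rewrite opprD addrA.
apply: le_trans (dle _ _); last by rewrite -[p]scale1r; apply: (Ml).
apply/ler_addgt0Pr => e e0.
(* |x - p|^2 <= (d + e') + 2 (d + 2) e' + e'^2 <= d + e *)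
pose e' := Num.min 1 (e / (2 * d + 6)).
have dp : 0 < 2 * d + 6 by lra.
have e'0 : 0 < e' by rewrite lt_min ltr01 divr_gt0.
have e'1 : e' <= 1 by rewrite ge_min lexx.
have e'e : e' * (2 * d + 6) <= e.
  by rewrite -ler_pdivlMr // ge_min lexx orbT.
have [N hN] := half _ e'0.
have [N' hN'] := (cvg_seqP _ _).1 fp _ e'0.
pose n := maxn N N'.
have {}hN := hN n (leq_maxl _ _); have {}hN' := hN' n (leq_maxr _ _).
have -> : x - p = (x - f n) - (p - f n) by rewrite opprB addrA subrK.
rewrite nrm2B; have [_ h2] := hf n.
have h3 := Re_inner_norm (x - f n) (p - f n).
set a := nrm (x - f n) in h2 h3 *; set b := nrm (p - f n) in hN' h3 *.
have a0 : 0 <= a by apply: nrm_ge0.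
have b0 : 0 <= b by apply: nrm_ge0.
move: h3; set t := Re _; rewrite ler_norml => /andP[h3 _].
have a1 : a <= d + 2 by nra.
have ab : a * b <= (d + 2) * e' by apply: ler_pM => //; lra.
have bb : b ^+ 2 <= e' by nra.
nra.
Qed.

End projection.

(** * Ranges of unbounded operators *)

Section operators.
Variables (R : realType) (H : hilbertType R).
Implicit Types (A T B : set (H * H)) (f g h u v w : H) (c z : R[i]) (p q : H * H).

Lemma op_subP A V f g : op_sub A V (f, g) <-> A (f, g + V f).
Proof.
split=> [[[f' g'] /= h [<- <-]]|h]; first by rewrite subrK.
by exists (f, g + V f) => //=; rewrite addrK.
Qed.

Section linear.
Variables (A : set (H * H)) (lA : linear_operator A).

Lemma lin0 : A (0, 0). Proof. by case: lA. Qed.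
Lemma linP c f g f' g' : A (f, g) -> A (f', g') -> A (c *: f + f', c *: g + g').
Proof. by case: lA => _ h _; apply: h. Qed.
Lemma linZ c f g : A (f, g) -> A (c *: f, c *: g).
Proof. by move=> h; have := linP c h lin0; rewrite !addr0. Qed.
Lemma linD f g f' g' : A (f, g) -> A (f', g') -> A (f + f', g + g').
Proof. by move=> h h'; have := linP 1 h h'; rewrite !scale1r. Qed.
Lemma linN f g : A (f, g) -> A (- f, - g).
Proof. by move=> h; have := linZ (-1) h; rewrite !scaleN1r. Qed.
Lemma linB f g f' g' : A (f, g) -> A (f', g') -> A (f - f', g - g').
Proof. by move=> h /linN; apply: linD. Qed.
Lemma lin_inj f g g' : A (f, g) -> A (f, g') -> g = g'.
Proof. by case: lA => _ _ h; apply: h. Qed.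
End linear.

Lemma dense_ortho (D : set H) u : dense D -> (forall v, D v -> ⟨u, v⟩ = 0) -> u = 0.
Proof.
move=> dD hu; apply: contrapT => u0.
have un : 0 < nrm u.
  by rewrite lt_neqAle nrm_ge0 andbT eq_sym; apply/eqP => /nrm_eq0.
have op : open (ball u (nrm u)%:C) by apply: ball_open; rewrite ltcR.
have [|v [uv Dv]] := dD (ball u (nrm u)%:C) _ op.
  by exists u; apply: ballxx; rewrite ltcR.
move: uv; rewrite -ball_normE /ball_ /= nrmE ltcR.
apply/negP; rewrite -leNgt -(@ler_pXn2r _ 2) ?nnegrE ?nrm_ge0 //.
by rewrite nrm2B hu //= mulr0 subr0 lerDl sqr_ge0.
Qed.

Lemma adj_linear A : dense (op_dom A) -> linear_operator (op_adjoint A).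
Proof.
move=> dA; split=> [f g _|c f g f' g' h h' k l Akl|f g g' h h'] /=.
- by rewrite !inner0l.
- by rewrite !innerE -(h _ _ Akl) -(h' _ _ Akl).
- apply/eqP; rewrite -subr_eq0; apply/eqP.
  apply: dense_ortho dA _ => k [l Akl].
  by rewrite innerBl (h _ _ Akl) (h' _ _ Akl) subrr.
Qed.

(** The lower bound makes the range of [A - z] closed: preimages of a Cauchy
    sequence of values are Cauchy.  What is orthogonal to the range is an
    eigenvector of the adjoint for the conjugate of [z]. *)
Lemma range_decomp A z (d : R) : linear_operator A -> seq_closed A -> 0 < d ->
  (forall f g, A (f, g) -> d * nrm f <= nrm (g - z *: f)) ->
  forall h, exists f g n,
    [/\ A (f, g), h = (g - z *: f) + n & op_adjoint A (n, z^* *: n)].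
Proof.
move=> lA cA d0 hd h.
pose M : set H := [set k | exists f g, A (f, g) /\ k = g - z *: f].
have sM : subspace M.
  split; first by exists 0, 0; split; [exact: lin0|rewrite scaler0 subr0].
  move=> c _ _ [f [g [Afg ->]]] [f' [g' [Afg' ->]]].
  exists (c *: f + f'), (c *: g + g'); split; first exact: linP.
  by rewrite scalerBr scalerDr opprD !scalerA [z * c]mulrC addrACA.
have cM : seq_closed M.
  move=> k l Mk kl.
  have [fg hfg] : exists fg : nat -> H * H,
      forall n, A (fg n) /\ k n = (fg n).2 - z *: (fg n).1.
    have [n|fg hfg] := @choice _ _ (fun n (p : H * H) => A p /\ k n = p.2 - z *: p.1).
      by have [f [g [? ?]]] := Mk n; exists (f, g).
    by exists fg.
  have [a fa] : exists a : H, (fg n).1 @[n --> \oo] --> a.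
    apply: cauchy_seq_cvg => e e0.
    have e1 : 0 < d * e / 2 by rewrite divr_gt0 ?mulr_gt0.
    have [N hN] := (cvg_seqP _ _).1 kl _ e1.
    exists N => n m /hN hn /hN hm; rewrite -(ltr_pM2l d0).
    have [An kn] := hfg n; have [Am km] := hfg m.
    have Anm : A ((fg n).1 - (fg m).1, (fg n).2 - (fg m).2).
      by apply: linB => //; rewrite -surjective_pairing.
    apply: (le_lt_trans (hd _ _ Anm)).
    rewrite (_ : _ - _ = (l - k m) - (l - k n)).
      by apply: (le_lt_trans (nrmB _ _)); lra.
    by rewrite kn km; vring.
  have gb : (fg n).2 @[n --> \oo] --> l + z *: a.
    have -> : (fun n => (fg n).2) = (fun n => k n + z *: (fg n).1).
      by apply: funext => n; have [_ ->] := hfg n; rewrite subrK.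
    by apply: cvgD => //; apply: cvgZr.
  exists a, (l + z *: a); split; last by rewrite addrK.
  apply: (cA fg) => [n|]; first by case: (hfg n).
  have -> : fg = (fun n => ((fg n).1, (fg n).2)).
    by apply: funext => n; rewrite -surjective_pairing.
  exact: cvg_pair.
have [k [[f [g [Afg ->]]] ho]] := projection h sM cM.
exists f, g, (h - (g - z *: f)); split=> //; first by rewrite addrC subrK.
move=> f' g' Afg'.
have := ho (g' - z *: f') (ex_intro _ f' (ex_intro _ g' (conj Afg' erefl))).
set n := _ - (_ - _) => hn.
rewrite /= innerZl conjcK.
have : ⟨n, g' - z *: f'⟩ = 0 by rewrite innerC hn rmorph0.
by rewrite innerDr innerNr innerZr => /eqP; rewrite subr_eq0 => /eqP.
Qed.

End operators.

(** * Von Neumann extensions *)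

Section extensions.
Variables (R : realType) (H : hilbertType R).
Implicit Types (A T B : set (H * H)) (f g h u v w : H) (c z : R[i]) (p q : H * H).
Local Notation i := ('i%C : R[i]).

Lemma mulii : i * i = -1. Proof. by rewrite -expr2 sqr_i. Qed.

(** The boundary form of Green's formula.  It vanishes on pairs taken from the
    graph of one symmetric operator, so it only sees classes of vectors modulo
    the domain of such an operator. *)
Definition bdry p q : R[i] := ⟨p.2, q.1⟩ - ⟨p.1, q.2⟩.

Lemma adjE A f g f' g' : op_adjoint A (f, g) -> A (f', g') -> ⟨g, f'⟩ = ⟨f, g'⟩.
Proof. by move=> h /h. Qed.

Lemma adjE' A f g f' g' : op_adjoint A (f, g) -> A (f', g') -> ⟨f', g⟩ = ⟨g', f⟩.
Proof. by move=> h /h /= e; rewrite innerC e -innerC. Qed.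

Lemma symE A f g f' g' : symmetric_op A -> A (f, g) -> A (f', g') -> ⟨g, f'⟩ = ⟨f, g'⟩.
Proof. by move=> sA /sA; apply: adjE. Qed.

Lemma bdry_sym A p q : symmetric_op A -> A p -> A q -> bdry p q = 0.
Proof.
case: p => f g; case: q => f' g' sA hp hq.
by rewrite /bdry /= (symE sA hp hq) subrr.
Qed.

(** The graph of an adjoint is an intersection of kernels of continuous
    functionals. *)
Lemma adj_seq_closed A : seq_closed (op_adjoint A).
Proof.
move=> k [a b] Ak kab f g Afg /=.
have c1 : (k n).1 @[n --> \oo] --> a.
  by apply: (cvg_comp _ _ kab); apply: cvg_fst.
have c2 : (k n).2 @[n --> \oo] --> b.
  by apply: (cvg_comp _ _ kab); apply: cvg_snd.
have [-> //|ne] := pselect (⟨b, f⟩ = ⟨a, g⟩).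
have dp : 0 < normc (⟨b, f⟩ - ⟨a, g⟩).
  rewrite lt_neqAle normc_ge0 andbT eq_sym; apply/eqP.
  by move/ComplexField.Normc.eq0_normc/eqP; rewrite subr_eq0 => /eqP.
set d := normc _ in dp.
have e0 : 0 < d / (nrm f + nrm g + 1).
  by rewrite divr_gt0 // ltr_wpDl // addr_ge0 // nrm_ge0.
have [N hN] := (cvg_seqP _ _).1 c1 _ e0; have [N' hN'] := (cvg_seqP _ _).1 c2 _ e0.
have {}hN := hN _ (leq_maxl N N'); have {}hN' := hN' _ (leq_maxr N N').
set n := maxn N N' in hN hN'.
have : d <= nrm (b - (k n).2) * nrm f + nrm (a - (k n).1) * nrm g.
  have -> : d = normc (⟨b - (k n).2, f⟩ - ⟨a - (k n).1, g⟩).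
    congr normc; have := Ak n _ _ Afg => h; rewrite !innerBl h; ring.
  apply: (le_trans (le_normcD _ _)); rewrite normcN.
  by apply: lerD; apply: cauchy_schwarz.
have f0 := nrm_ge0 f; have g0 := nrm_ge0 g.
have hf : nrm (b - (k n).2) * nrm f <= d / (nrm f + nrm g + 1) * nrm f.
  by rewrite ler_wpM2r // ltW.
have hg : nrm (a - (k n).1) * nrm g <= d / (nrm f + nrm g + 1) * nrm g.
  by rewrite ler_wpM2r // ltW.
have s0 : 0 < nrm f + nrm g + 1 by lra.
have de : d = d / (nrm f + nrm g + 1) * (nrm f + nrm g + 1) by rewrite divfK // gt_eqF.
move=> h; suff : d < d by rewrite ltxx.
clear ne; lra.
Qed.

(** (f, A f) is real, so |(A - i) f|^2 = |A f|^2 + |f|^2, and likewise for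
    - i. *)
Lemma sym_nrm_shift A f g : symmetric_op A -> A (f, g) ->
  nrm f <= nrm (g - i *: f) /\ nrm f <= nrm (g - (- i) *: f).
Proof.
move=> sA Afg; have := symE sA Afg Afg => e.
have e' : Im ⟨f, g⟩ = 0.
  by have := congr1 (@complex.Im R) e; rewrite (innerC f g) cImJ; lra.
have key (s : R) : s ^+ 2 = 1 -> nrm f <= nrm (g - (s%:C * i) *: f).
  move=> s1; rewrite -(@ler_pXn2r _ 2) ?nnegrE ?nrm_ge0 // nrm2B innerZr.
  rewrite e -mulrA cReZ cReM e' /= nrmZ exprMn.
  have -> : normc (s%:C * i) ^+ 2 = 1.
    by rewrite sqr_normc_ReIm cReZ cImZ /= mulr0 mulr1 s1 expr0n add0r.
  by rewrite mul0r mulr0 subr0 mulr0 mulr0 subr0 mul1r lerDr sqr_ge0.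
split; first by have := key 1; rewrite mul1r; apply; rewrite expr1n.
by have := key (-1); rewrite rmorphN mulN1r; apply; rewrite sqrrN expr1n.
Qed.

(** If A + i is onto, any [f] in the domain of the adjoint differs from some
    [f1] in the domain of A by a vector of the kernel of the adjoint of A plus
    i, which is orthogonal to the range of A - i, that is, zero. *)
Lemma selfadjoint_of_range A : linear_operator A -> symmetric_op A ->
  (forall h, exists f g, A (f, g) /\ h = g + i *: f) ->
  (forall h, exists f g, A (f, g) /\ h = g - i *: f) ->
  op_adjoint A = A.
Proof.
move=> lA sA rp rm; apply/seteqP; split => // -[f g] Bfg.
have [f1 [g1 [A1 e1]]] := rp (g + i *: f).
have [f2 [g2 [A2 e2]]] := rm (f - f1).
(* f - f1 is an eigenvector of the adjoint for - i *)
have gE : g - g1 = - i *: (f - f1).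
  have -> : g - g1 = (g + i *: f) - g1 - i *: f by vring.
  by rewrite e1; vring.
have d0 : f - f1 = 0.
  apply: nrm_eq0; apply/eqP; rewrite -sqrf_eq0; apply/eqP; apply: complexI.
  rewrite -inner_self {2}e2 innerDr innerNr innerZr.
  have -> : ⟨f - f1, g2⟩ = ⟨g - g1, f2⟩.
    by rewrite !innerBl (adjE Bfg A2) (symE sA A1 A2).
  by rewrite gE innerZl conjcN conjc_i opprK subrr.
move: gE; rewrite d0 scaler0 => /eqP; rewrite subr_eq0 => /eqP ->.
by move/eqP: d0; rewrite subr_eq0 => /eqP ->.
Qed.

Lemma one_dimensional_span (E : set H) u v : one_dimensional E -> E u -> u != 0 -> E v ->
  exists c, v = c *: u.
Proof.
move=> [w w0 ->] [a _ <-] aw [b _ <-].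
have a0 : a != 0 by apply: contraNneq aw => ->; rewrite scale0r.
by exists (b / a); rewrite scalerA divfK.
Qed.

Lemma expiJ (t : R) : (expi t)^* * expi t = 1.
Proof.
apply: complex_ext; rewrite ?cReM ?cImM cReJ cImJ /=; last by ring.
by rewrite mulNr opprK -!expr2 cos2Dsin2.
Qed.

Section sa.
Variables (T : set (H * H)) (up um : H).
Hypotheses (lT : linear_operator T) (sT : symmetric_op T) (dT : dense (op_dom T)).
Hypotheses (hp : op_adjoint T (up, i *: up)) (hm : op_adjoint T (um, - i *: um)).
Hypotheses (np : nrm up = 1) (nm : nrm um = 1).
Variable alpha : R.
Let e := expi (2 * alpha).
Let A := sa_extension T up um alpha.

Let lB : linear_operator (op_adjoint T) := adj_linear dT.

Lemma sa_gen : A (up + e *: um, i *: up - (i * e) *: um).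
Proof. by exists 0, 0, 1; split; [exact: lin0|rewrite !add0r !scale1r]. Qed.

Lemma sa_ext : T `<=` A.
Proof. by move=> [f g] h; exists f, g, 0; split => //; rewrite !scale0r !addr0. Qed.

Lemma sa_gen_adj : op_adjoint T (up + e *: um, i *: up - (i * e) *: um).
Proof.
have := linP lB e hm hp; rewrite addrC [e *: _ + i *: _]addrC scalerA.
by rewrite mulrN mulrC scaleNr.
Qed.

Lemma sa_adj : A `<=` op_adjoint T.
Proof.
move=> _ [f [g [c [Tfg ->]]]]; apply: (linD lB); first exact: sT.
exact: (linZ lB c sa_gen_adj).
Qed.

Lemma sa_linear : linear_operator A.
Proof.
split; first exact: (sa_ext (lin0 lT)).
- move=> c _ _ _ _ [f [g [a [Tfg [-> ->]]]]] [f' [g' [a' [Tfg' [-> ->]]]]].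
  exists (c *: f + f'), (c *: g + g'), (c * a + a'); split; first exact: linP.
  by congr pair; vring.
- by move=> f g g' /sa_adj h /sa_adj h'; apply: lin_inj h h'.
Qed.

(** On the added vector the contributions of u_+ and u_- cancel, both having
    norm one and the coefficient of u_- having modulus one. *)
Lemma sa_sym : symmetric_op A.
Proof.
move=> _ [f [g [c [Tfg ->]]]] _ _ [f' [g' [c' [Tfg' [-> ->]]]]] /=.
set y := up + e *: um; set y' := i *: up - (i * e) *: um.
have Ty : op_adjoint T (y, y') := sa_gen_adj.
rewrite !innerDl !innerDr !innerZl !innerZr.
rewrite (symE sT Tfg Tfg') (adjE Ty Tfg') -(adjE' Ty Tfg).
suff -> : ⟨y', y⟩ = ⟨y, y'⟩ by [].
rewrite /y /y' !(innerDr, innerDl, innerNr, innerNl, innerZr, innerZl).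
rewrite !inner_self np nm expr1n !conjcM conjc_i (innerC up um).
have := expiJ (2 * alpha); rewrite -/e => ee.
set a := ⟨up, um⟩; rewrite -[1%:C]/(1 : R[i]).
ring: ee.
Qed.

Hypotheses (cT : seq_closed T) (dTi : deficiency_indices_11 T).

Lemma unit_neq0 u : nrm u = 1 -> u != 0.
Proof. by move=> h; apply/eqP => u0; move: h; rewrite u0 nrm0 => /eqP; rewrite eq_sym oner_eq0. Qed.

Lemma two_i_neq0 : 2 * i != 0.
Proof. by rewrite mulf_neq0 ?pnatr_eq0 //; apply/eqP => /(congr1 (@complex.Im R)) /= /eqP; rewrite oner_eq0. Qed.

(** The range of T + i misses only the direction u_+, which is reached from the
    added vector: A + i sends it to 2 i u_+. *)
Lemma sa_range_p h : exists f g, A (f, g) /\ h = g + i *: f.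
Proof.
have [f g Tfg|f [g [n [Tfg -> hn]]]] := @range_decomp _ _ T (- i) 1 lT cT ltr01 _ h.
  by rewrite mul1r; have [] := sym_nrm_shift sT Tfg.
have [c ->] : exists c, n = c *: up.
  apply: (one_dimensional_span (dTi.1) hp (unit_neq0 np)).
  by move: hn; rewrite conjcN conjc_i opprK.
have [_ hA _] := sa_linear.
exists ((c / (2 * i)) *: (up + e *: um) + f), ((c / (2 * i)) *: (i *: up - (i * e) *: um) + g).
split; first by apply: hA => //; [exact: sa_gen|exact: sa_ext].
have hc : c = c / (2 * i) * (2 * i) by rewrite divfK // two_i_neq0.
by rewrite {1}hc; vring.
Qed.

(** As for [sa_range_p], the missing direction now being u_-. *)
Lemma sa_range_m h : exists f g, A (f, g) /\ h = g - i *: f.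
Proof.
have [f g Tfg|f [g [n [Tfg -> hn]]]] := @range_decomp _ _ T i 1 lT cT ltr01 _ h.
  by rewrite mul1r; have [] := sym_nrm_shift sT Tfg.
have [c ->] : exists c, n = c *: um.
  apply: (one_dimensional_span (dTi.2) hm (unit_neq0 nm)).
  by move: hn; rewrite conjc_i.
have [_ hA _] := sa_linear.
have e0 : e != 0.
  by apply/eqP => e0; have := expiJ (2 * alpha); rewrite -/e e0 mulr0 => /eqP; rewrite eq_sym oner_eq0.
set a := c / (- (2 * i) * e).
exists (a *: (up + e *: um) + f), (a *: (i *: up - (i * e) *: um) + g).
split; first by apply: hA => //; [exact: sa_gen|exact: sa_ext].
have hc : c = a * (- (2 * i) * e) by rewrite divfK // mulf_neq0 // oppr_eq0 two_i_neq0.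
by rewrite {1}hc; vring.
Qed.

Lemma sa_selfadj : op_adjoint A = A.
Proof.
exact: selfadjoint_of_range sa_linear sa_sym sa_range_p sa_range_m.
Qed.

(** Since A - i is onto, subtracting a vector of the domain of A from [f] leaves
    an element of the kernel of the adjoint of T minus i, spanned by u_+.  So
    the maximal domain exceeds that of A by one dimension. *)
Lemma max_decomp f g : op_adjoint T (f, g) ->
  exists c, A (f - c *: up, g - (c * i) *: up).
Proof.
move=> Bfg; have [f1 [g1 [A1 e1]]] := sa_range_m (g - i *: f).
have B1 := sa_adj A1.
have Bd : op_adjoint T (f - f1, i *: (f - f1)).
  have := linB lB Bfg B1; congr (op_adjoint T (_, _)).
  have -> : g - g1 = (g - i *: f) - g1 + i *: f by vring.
  by rewrite e1; vring.
have [c hc] := one_dimensional_span (dTi.1) hp (unit_neq0 np) Bd.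
exists c; rewrite -hc subKr.
have -> : g - (c * i) *: up = g1; last by [].
rewrite mulrC -scalerA -hc.
have -> : g - i *: (f - f1) = (g - i *: f) + i *: f1 by vring.
by rewrite e1; vring.
Qed.

End sa.

End extensions.

(** * Resolvents and defect vectors *)

Section resolvent.
Variables (R : realType) (H : hilbertType R).
Implicit Types (A T B : set (H * H)) (f g h u v w : H) (z y : R[i]) (p q : H * H).
Local Notation i := ('i%C : R[i]).

(** Self-adjointness together with a lower bound; the half-plane Re z < c then
    consists of resolvent points. *)
Record selfadjoint_ge A (c : R) : Prop := SelfadjointGe {
  sg_lin : linear_operator A;
  sg_adj : op_adjoint A = A;
  sg_ge : forall f g, A (f, g) -> c * nrm f ^+ 2 <= Re ⟨f, g⟩ }.

Lemma sg_sym A c : selfadjoint_ge A c -> symmetric_op A.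
Proof. by move=> hA; rewrite /symmetric_op (sg_adj hA). Qed.

Lemma selfadjoint_ge_le A c c' : selfadjoint_ge A c -> c' <= c -> selfadjoint_ge A c'.
Proof.
move=> [h1 h2 h3] cc; split=> // f g /h3; apply: le_trans.
by rewrite ler_wpM2r // sqr_ge0.
Qed.

Section fix_A.
Variables (A : set (H * H)) (c : R) (hA : selfadjoint_ge A c).
Let lA := sg_lin hA.
Let sA := sg_sym hA.

Lemma shift_lower z f g : A (f, g) -> (c - Re z) * nrm f <= nrm (g - z *: f).
Proof.
move=> Afg; have h1 := sg_ge hA Afg.
have h2 := Re_inner_le f (g - z *: f).
have [->|f0] := eqVneq (nrm f) 0; first by rewrite mulr0 nrm_ge0.
have fp : 0 < nrm f by rewrite lt_neqAle eq_sym f0 nrm_ge0.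
rewrite -(ler_pM2l fp); apply: le_trans h2.
rewrite innerDr innerNr innerZr inner_self cReB cReM /= mulr0 subr0; lra.
Qed.

(** The range of A - z is closed by [shift_lower], and the same bound at the
    conjugate point shows that nothing is orthogonal to it. *)
Lemma resolvent_ex z u : Re z < c -> exists f, A (f, u + z *: f).
Proof.
move=> zc; have cA : seq_closed A by rewrite -(sg_adj hA); apply: adj_seq_closed.
have d0 : 0 < c - Re z by rewrite subr_gt0.
have [f [g [n [Afg -> hn]]]] := range_decomp lA cA d0 (@shift_lower z) u.
have n0 : n = 0.
  have := hn; rewrite (sg_adj hA) => /(@shift_lower z^*).
  rewrite cReJ subrr nrm0 pmulr_rle0 // => h.
  by apply: nrm_eq0; apply/eqP; rewrite eq_le h nrm_ge0.
by exists f; rewrite n0 addr0 subrK.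
Qed.

Lemma resolvent_inj z u f f' : Re z < c ->
  A (f, u + z *: f) -> A (f', u + z *: f') -> f = f'.
Proof.
move=> zc h h'; have := shift_lower z (linB lA h h').
have -> : u + z *: f - (u + z *: f') - z *: (f - f') = 0 by vring.
rewrite nrm0 pmulr_rle0 ?subr_gt0 // => h0.
by apply/eqP; rewrite -subr_eq0; apply/eqP/nrm_eq0/eqP; rewrite eq_le h0 nrm_ge0.
Qed.

Lemma op_inverse_shiftP z u f :
  op_inverse (op_shift A z) (u, f) <-> A (f, u + z *: f).
Proof.
split=> [[[f' g'] /op_subP h [<- <-]] //|h].
by exists (f, u) => //; apply/op_subP.
Qed.

Lemma resolventP z u : Re z < c ->
  A (op_resolvent A z u, u + z *: op_resolvent A z u).
Proof.
move=> zc; apply/op_inverse_shiftP; rewrite /op_resolvent /op_app.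
case: xgetP => [f -> //|none].
by have [f /op_inverse_shiftP hf] := resolvent_ex u zc; have := none f.
Qed.

Lemma resolventE z u f : Re z < c -> A (f, u + z *: f) -> op_resolvent A z u = f.
Proof. by move=> zc; apply: resolvent_inj zc (resolventP u zc). Qed.

Lemma resolvent_lin z a u v : Re z < c ->
  op_resolvent A z (a *: u + v) = a *: op_resolvent A z u + op_resolvent A z v.
Proof.
move=> zc; apply: resolventE => //.
have := linP lA a (resolventP u zc) (resolventP v zc).
by congr (A (_, _)); vring.
Qed.

Lemma resolventZ z a u : Re z < c -> op_resolvent A z (a *: u) = a *: op_resolvent A z u.
Proof.
move=> zc; apply: resolventE => //; have := linZ lA a (resolventP u zc).
by congr (A (_, _)); vring.
Qed.

Lemma resolvent_nrm z u : Re z < c -> (c - Re z) * nrm (op_resolvent A z u) <= nrm u.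
Proof.
by move=> zc; have := shift_lower z (resolventP u zc); rewrite addrK.
Qed.

Lemma resolvent_sym (x : R) u v : x < c ->
  ⟨op_resolvent A x%:C u, v⟩ = ⟨u, op_resolvent A x%:C v⟩.
Proof.
move=> xc; have := symE sA (@resolventP x%:C u xc) (@resolventP x%:C v xc).
rewrite !innerE conjc_real => e.
by rewrite -(addrK (x%:C * ⟨op_resolvent A x%:C u, op_resolvent A x%:C v⟩) ⟨_, v⟩) -e addrK.
Qed.

Lemma resolvent_ge0 (x : R) u : x < c -> 0 <= Re ⟨u, op_resolvent A x%:C u⟩.
Proof.
move=> xc; rewrite -resolvent_sym //; have := sg_ge hA (@resolventP x%:C u xc).
rewrite innerDr innerZr cReD inner_self cReM /= mulr0 subr0.
have : 0 <= (c - x) * nrm (op_resolvent A x%:C u) ^+ 2.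
  by rewrite mulr_ge0 ?sqr_ge0 // subr_ge0 ltW.
lra.
Qed.

Variable up : H.
(** The vector (A - i)(A - z)^-1 u_+, an eigenvector of the maximal operator for
    z which is congruent to u_+ modulo the domain of A.  It is locked so that
    rewriting with the linearity of the inner product does not open it. *)
Definition defect z : H := locked (up + (z - i) *: op_resolvent A z up).
Lemma defectE z : defect z = up + (z - i) *: op_resolvent A z up.
Proof. by rewrite /defect -lock. Qed.
Definition mfun z : R[i] := z + (1 + z ^+ 2) * ⟨up, op_resolvent A z up⟩.

Lemma defect_sub z : Re z < c -> A (defect z - up, z *: defect z - i *: up).
Proof.
move=> zc; have := linZ lA (z - i) (resolventP up zc).
by rewrite defectE; congr (A (_, _)); vring.
Qed.

Lemma defect_op_app z : Re z < c ->
  op_app (op_shift A i) (op_resolvent A z up) = defect z.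
Proof.
move=> zc; have hR := resolventP up zc.
have hs : op_shift A i (op_resolvent A z up, defect z).
  by apply/op_subP; rewrite /=; have := hR; rewrite defectE; congr (A (_, _)); vring.
rewrite /op_app; case: xgetP => [g _ /op_subP hg|none]; last by have := none _ hs.
by have /op_subP hs' := hs; apply: (addIr (i *: op_resolvent A z up)); apply: lin_inj hg hs'.
Qed.

Lemma defect_diff z y : Re z < c -> Re y < c ->
  defect z = defect y + (z - y) *: op_resolvent A z (defect y).
Proof.
move=> zc wc; apply/eqP; rewrite addrC -subr_eq eq_sym; apply/eqP.
rewrite -resolventZ //; apply: resolventE => //.
have := linB lA (defect_sub zc) (defect_sub wc).
by congr (A (_, _)); vring.
Qed.

Hypothesis np : nrm up = 1.

(** As p agrees with u_+ modulo the domain of the symmetric operator A, it can be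
    replaced by u_+ against the resolvent part of the defect vector.  This
    exhibits the m-function as a boundary value. *)
Lemma bdry_defect p z : Re z < c -> A (p.1 - up, p.2 - i *: up) ->
  bdry p (defect z, z *: defect z) = bdry p (up, i *: up) + i - mfun z.
Proof.
case: p => f g /= zc Ap.
have := symE sA Ap (resolventP up zc).
rewrite /bdry defectE /mfun /= !innerE inner_self np expr1n -[1%:C]/(1 : R[i]) conjc_i => e.
set r := op_resolvent A z up in e *.
have eg : ⟨g, r⟩ = ⟨g, r⟩ + - (- i * ⟨up, r⟩) - i * ⟨up, r⟩ by ring.
rewrite eg e; have ii := mulii R; ring: ii.
Qed.

End fix_A.
End resolvent.

(** * Donoghue functions and Friedrichs forms *)

Section mfunctions.
Variables (R : realType) (H : hilbertType R).
Implicit Types (A T B : set (H * H)) (f g h u v w : H) (z y : R[i]) (p q : H * H).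
Local Notation i := ('i%C : R[i]).

Section fix_A.
Variables (A : set (H * H)) (c : R) (hA : selfadjoint_ge A c) (up : H) (np : nrm up = 1).

(** Take for p in [bdry_defect] the defect vector at the conjugate of y: the
    boundary form becomes [(y - z) (u(conj y), u(z))], and the additive constant
    is found by setting z = y. *)
Lemma mfun_diff z y : Re z < c -> Re y < c ->
  mfun A up z - mfun A up y = (z - y) * ⟨defect A up y^*, defect A up z⟩.
Proof.
move=> zc yc; have yc' : Re y^* < c by rewrite cReJ.
pose p := (defect A up y^*, y^* *: defect A up y^*).
have hp := defect_sub hA up yc'.
have h1 := bdry_defect hA np (p := p) zc hp.
have h2 := bdry_defect hA np (p := p) yc hp.
move: h1 h2; rewrite {1 3}/bdry /= !innerE !conjcK subrr => h1 h2.
rewrite -[LHS]opprK opprB.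
have -> : mfun A up y - mfun A up z =
  (bdry p (up, i *: up) + i - mfun A up z) - (bdry p (up, i *: up) + i - mfun A up y) by ring.
by rewrite -h1 -h2; ring.
Qed.

Lemma mfun_real (x : R) : x < c -> Im (mfun A up x%:C) = 0.
Proof.
move=> xc; rewrite /mfun cImD /= add0r.
have -> : 1 + x%:C ^+ 2 = (1 + x ^+ 2)%:C by rewrite rmorphD rmorphXn.
rewrite cImZ; suff -> : Im ⟨up, op_resolvent A x%:C up⟩ = 0 by rewrite mulr0.
have := resolvent_sym hA up up xc; rewrite innerC.
by move/(congr1 (@complex.Im R)); rewrite cImJ; lra.
Qed.

Definition mreal (x : R) : R := Re (mfun A up x%:C).

Lemma mrealE (x : R) : x < c -> mfun A up x%:C = (mreal x)%:C.
Proof. by move=> xc; apply: Im0_real; apply: mfun_real. Qed.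

Lemma defect_diffR (x y : R) : x < c -> y < c ->
  defect A up y%:C =
    defect A up x%:C + (y - x)%:C *: op_resolvent A y%:C (defect A up x%:C).
Proof. by move=> xc yc; rewrite (defect_diff hA up (y := x%:C)) // rmorphB. Qed.

Lemma mreal_diff (x y : R) : x < c -> y < c ->
  mreal y - mreal x = (y - x) * Re ⟨defect A up x%:C, defect A up y%:C⟩.
Proof.
move=> xc yc; rewrite /mreal -cReB (mfun_diff (y := x%:C)) //.
by rewrite conjc_real -rmorphB cReZ.
Qed.

(** [u(y) = u(x) + (y - x) R(y) u(x)] and R(y) is nonnegative, so (u(x), u(y)) is
    at least |u(x)|^2. *)
Lemma mreal_growth (x y : R) : x < y -> y < c ->
  (y - x) * nrm (defect A up x%:C) ^+ 2 <= mreal y - mreal x.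
Proof.
move=> xy yc; have xc := lt_trans xy yc.
rewrite mreal_diff // ler_pM2l ?subr_gt0 // (defect_diffR xc yc) innerDr innerZr cReD cReZ nrm2 lerDl.
by rewrite mulr_ge0 ?subr_ge0 ?(ltW xy) // (resolvent_ge0 hA).
Qed.

Lemma mfun_vertical (x y : R) : x < c ->
  mfun A up (x +i* y) = (mreal x)%:C + (y%:C * i) * (nrm (defect A up x%:C) ^+ 2)%:C
    - (y ^+ 2)%:C * ⟨defect A up x%:C, op_resolvent A (x +i* y) (defect A up x%:C)⟩.
Proof.
move=> xc; have xyc : Re (x +i* y) < c by [].
have := mfun_diff (z := x +i* y) (y := x%:C) xyc xc.
rewrite mrealE // conjc_real => /eqP; rewrite subr_eq addrC => /eqP ->.
rewrite (defect_diff hA up (y := x%:C) xyc) //.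
have -> : x +i* y - x%:C = y%:C * i.
  by apply: complex_ext; rewrite ?cReB ?cImB ?cReZ ?cImZ /=; ring.
rewrite innerDr innerZr inner_self (_ : (y ^+ 2)%:C = - (y%:C * i) ^+ 2); first by ring.
by rewrite exprMn sqr_i rmorphXn mulrN1 opprK.
Qed.

(** If it vanished, u_+ would be an eigenvector of the symmetric operator A for
    the eigenvalue i. *)
Lemma defect_neq0 z : Re z < c -> defect A up z != 0.
Proof.
move=> zc; apply/eqP => d0; have := defect_sub hA up zc.
rewrite d0 scaler0 !sub0r => /(linN (sg_lin hA)); rewrite !opprK => hu.
have := symE (sg_sym hA) hu hu; rewrite innerZl innerZr conjc_i inner_self np expr1n.
by move/(congr1 (@complex.Im R)); rewrite /=; lra.
Qed.

End fix_A.

Section friedrichs.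
Variables (T : set (H * H)) (c : R).
Hypotheses (lT : linear_operator T) (sT : symmetric_op T).
Hypothesis (bT : forall f g, T (f, g) -> c * nrm f ^+ 2 <= Re ⟨f, g⟩).

Lemma form_cvgP (f g : nat -> H) :
  (⟨f nm.1 - f nm.2, g nm.1 - g nm.2⟩ : R[i]^o)
     @[nm --> filter_prod \oo \oo] --> (0 : R[i]^o) <->
  forall e : R, 0 < e -> exists N, forall n m, (N <= n)%N -> (N <= m)%N ->
    normc ⟨f n - f m, g n - g m⟩ < e.
Proof.
split=> [/cvgrPdist_lt h e e0|h].
  have [|[P Q] /= [[N _ hN] [N' _ hN']] hPQ] := h e%:C; first by rewrite ltcR.
  exists (maxn N N') => n m; rewrite !geq_max => /andP[nN nN'] /andP[mN mN'].
  have := hPQ (n, m) (conj (hN n nN) (hN' m mN')).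
  by rewrite /= sub0r normrN normcC ltcR.
apply/cvgrPdist_lt => e /gt0_realC[e0 ->]; have [N hN] := h _ e0.
exists ([set n | (N <= n)%N], [set n | (N <= n)%N]) => /=.
  by split; exists N.
by move=> [n m] /= [nN mN]; rewrite sub0r normrN normcC ltcR hN.
Qed.

Local Notation form f g := (Re ⟨f, g⟩ - c * nrm f ^+ 2).

(** Cauchy-Schwarz for the nonnegative form of T - c, in its arithmetic-mean
    version: expand the form at f + f' and f - f'. *)
Lemma form_cross f g f' g' : T (f, g) -> T (f', g') ->
  `|Re ⟨f, g'⟩ - c * Re ⟨f, f'⟩| <= (form f g + form f' g') / 2.
Proof.
move=> h h'; have hp := bT (linD lT h h'); have hm := bT (linB lT h h').
move: hp hm; rewrite nrm2D nrm2B !innerE !cReD !cReN.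
have := congr1 (@complex.Re R) (symE sT h h'); rewrite Re_innerC => ->.
by rewrite ler_norml; move=> hp hm; apply/andP; split; lra.
Qed.

Lemma mul_le_of_le_div (t B e : R) : 0 <= B -> 0 <= t -> t <= e / (B + 1) -> t * B <= e.
Proof.
move=> B0 t0 h; have Bp : 0 < B + 1 by rewrite ltr_wpDl.
by move: h; rewrite ler_pdivlMr // mulrDr mulr1 => h; lra.
Qed.

(** The domain of T is dense in that of the Friedrichs extension for the form
    norm.  For a form-Cauchy sequence [F n] with limit f, [(f - F N, g - G N)] is
    close to [(F m - F N, g - G N)]; the adjoint relation moves the operator
    over to [F m - F N], after which f may be replaced by [F k], and the result is
    small by [form_cross]. *)
Lemma friedrichs_approx f g (e : R) : friedrichs T (f, g) -> 0 < e ->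
  exists f' g', [/\ T (f', g'), nrm (f - f') < e & `|form (f - f') (g - g')| <= e].
Proof.
move=> [Bfg [F [G [hFG hF /form_cvgP hC]]]] e0.
have e4 : 0 < e / 4 by rewrite divr_gt0.
have [N1 hN1] := hC _ e4.
(* d is chosen so that |c| (2 d)^2 is at most e / 9: this absorbs the terms
   with c, which come from measuring the form of T - c instead of that of T *)
pose d := Num.min (Num.min 1 e) (e / 36 / (`|c| + 1)).
have d0 : 0 < d by rewrite !lt_min ltr01 e0 !divr_gt0 // ltr_wpDl.
have d1 : d <= 1 by rewrite !ge_min lexx.
have de : d <= e by rewrite !ge_min lexx orbT.
have dc : d * `|c| <= e / 36.
  have : d <= e / 36 / (`|c| + 1) by rewrite !ge_min lexx !orbT.
  have c1 : 0 < `|c| + 1 by rewrite ltr_wpDl.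
  by rewrite ler_pdivlMr // mulrDr mulr1 => h; lra.
have ddc : `|c| * d ^+ 2 <= e / 36.
  have c0 := normr_ge0 c; apply: le_trans dc.
  by rewrite expr2 mulrA [leRHS]mulrC ler_piMr // mulr_ge0 // ltW.
have [N2 hN2] := (cvg_seqP _ _).1 hF _ d0.
pose N := maxn N1 N2.
have h1 n m : (N <= n)%N -> (N <= m)%N -> normc ⟨F n - F m, G n - G m⟩ < e / 4.
  by rewrite !geq_max => /andP[? _] /andP[? _]; apply: hN1.
have h2 n : (N <= n)%N -> nrm (f - F n) < d.
  by rewrite geq_max => /andP[_ ?]; apply: hN2.
have h3 n m : (N <= n)%N -> (N <= m)%N -> nrm (F n - F m) <= 2 * d.
  move=> nN mN; have -> : F n - F m = (f - F m) - (f - F n) by vring.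
  by apply: (le_trans (nrmB _ _)); have := h2 _ nN; have := h2 _ mN; lra.
have e8 : 0 < e / 8 by rewrite divr_gt0.
have close (B : R) : 0 <= B -> exists m, (N <= m)%N /\ nrm (f - F m) * B <= e / 8.
  move=> B0; have eB : 0 < e / 8 / (B + 1) by rewrite divr_gt0 // ltr_wpDl.
  have [N3 hN3] := (cvg_seqP _ _).1 hF _ eB.
  exists (maxn N N3); split; first exact: leq_maxl.
  by apply: mul_le_of_le_div; rewrite ?nrm_ge0 // ltW // hN3 // leq_maxr.
have NN : (N <= N)%N by [].
have [m [mN hm]] := close _ (nrm_ge0 (g - G N)).
have [k [kN hk]] := close _ (nrm_ge0 (G m - G N)).
exists (F N), (G N); split=> //; first by apply: lt_le_trans (h2 N NN) de.
(* replace f by F m, move the operator, replace f by F k *)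
have A1 : Re ⟨f - F N, g - G N⟩ = Re ⟨f - F m, g - G N⟩ + Re ⟨F m - F N, g - G N⟩.
  by rewrite -cReD -innerDl; congr (Re ⟨_, _⟩); vring.
have A2 : ⟨F m - F N, g - G N⟩ = ⟨G m - G N, f - F N⟩.
  rewrite !(innerBr _ g) !(innerBr _ f).
  have TmN := linB lT (hFG m) (hFG N).
  by rewrite (adjE' Bfg TmN) (symE sT TmN (hFG N)).
have A3 : Re ⟨G m - G N, f - F N⟩ = Re ⟨G m - G N, f - F k⟩ + Re ⟨G m - G N, F k - F N⟩.
  by rewrite -cReD -innerDr; congr (Re ⟨_, _⟩); vring.
have := form_cross (linB lT (hFG k) (hFG N)) (linB lT (hFG m) (hFG N)).
have b1 := Re_inner_norm (f - F m) (g - G N).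
have b2 := Re_inner_norm (G m - G N) (f - F k).
have q1 := Re_le_normc ⟨F k - F N, G k - G N⟩; have q1' := h1 _ _ kN NN.
have q2 := Re_le_normc ⟨F m - F N, G m - G N⟩; have q2' := h1 _ _ mN NN.
have cn (x y : R) : 0 <= x <= 2 * d -> 0 <= y <= 2 * d -> `|c * (x * y)| <= e / 9.
  move=> /andP[x0 x1] /andP[y0 y1]; rewrite normrM (ger0_norm (mulr_ge0 x0 y0)).
  apply: (@le_trans _ _ (`|c| * ((2 * d) * (2 * d)))).
    by rewrite ler_wpM2l // ler_pM.
  have -> : `|c| * ((2 * d) * (2 * d)) = 4 * (`|c| * d ^+ 2) by ring.
  lra.
have kk : 0 <= nrm (F k - F N) <= 2 * d by rewrite nrm_ge0 h3.
have mm : 0 <= nrm (F m - F N) <= 2 * d by rewrite nrm_ge0 h3.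
have ff : 0 <= nrm (f - F N) <= 2 * d by rewrite nrm_ge0 /=; have := h2 _ NN; lra.
have c1 := cn _ _ kk kk; have c2 := cn _ _ mm mm; have c3 := cn _ _ ff ff.
have c4 : `|c * Re ⟨F k - F N, F m - F N⟩| <= e / 9.
  have c4 := cn _ _ kk mm; apply: le_trans c4; rewrite !normrM ler_wpM2l //.
  by rewrite -normrM (le_trans (Re_inner_norm _ _)) // ler_norm.
rewrite A1 A2 A3 [Re ⟨G m - G N, F k - F N⟩]Re_innerC; rewrite [nrm (G m - G N) * _]mulrC in b2.
move: b1 b2 hm hk q1 q1' q2 q2' c1 c2 c3 c4; rewrite -!expr2.
set t1 := Re ⟨f - F m, _⟩; set t2 := Re ⟨G m - G N, _⟩; set t3 := Re ⟨F k - F N, G m - G N⟩.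
set t4 := Re ⟨F k - F N, G k - _⟩; set t5 := Re ⟨F m - F N, G m - _⟩.
set c1 := c * _; set c2 := c * _; set c3 := c * _; set c4 := c * _.
set z1 := nrm _ * _; set z2 := nrm _ * _; set z3 := normc _; set z4 := normc _.
rewrite !ler_norml.
move=> /andP[? ?] /andP[? ?] ? ? /andP[? ?] ? /andP[? ?] ? /andP[? ?] /andP[? ?] /andP[? ?] /andP[? ?] /andP[? ?].
by apply/andP; split; lra.
Qed.

(** The form value at f is the limit of form values on the domain of T. *)
Lemma friedrichs_ge f g : friedrichs T (f, g) -> c * nrm f ^+ 2 <= Re ⟨f, g⟩.
Proof.
move=> h; rewrite -subr_ge0; apply/ler_addgt0Pr => e e0.
set k := nrm (g - c%:C *: f).
have k0 : 0 <= k := nrm_ge0 _.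
have d0 : 0 < e / (2 * k + 1) by rewrite divr_gt0 // ltr_wpDl // mulr_ge0.
have [f' [g' [T' h1 h2]]] := friedrichs_approx h d0.
have [Bfg _] := h.
have E : form f g = form f' g' + 2 * Re ⟨f - f', g - c%:C *: f⟩ - form (f - f') (g - g').
  have := congr1 (@complex.Re R) (adjE' Bfg T'); rewrite (Re_innerC g' f).
  by rewrite nrm2B !innerE !(cReD, cReN, cReZ) !nrm2 (Re_innerC f' f) => ->; ring.
rewrite E; have b := bT T'.
have := Re_inner_norm (f - f') (g - c%:C *: f); rewrite -/k => h3.
have h4 : nrm (f - f') * k <= e / (2 * k + 1) * k by rewrite ler_wpM2r // ltW.
have s0 : 0 < 2 * k + 1 by lra.
have de : e = e / (2 * k + 1) * (2 * k + 1) by rewrite divfK // gt_eqF.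
move: h2 h3; rewrite !ler_norml => /andP[? ?] /andP[? ?]; lra.
Qed.

End friedrichs.
End mfunctions.

(** * Divergence of the Donoghue function of the Friedrichs extension *)

Section divergence.
Variables (R : realType) (H : hilbertType R).
Implicit Types (f g h u v w : H).
Local Notation i := ('i%C : R[i]).

Section fix_T.
Variables (T : set (H * H)) (c : R) (up : H).
Hypotheses (lT : linear_operator T) (sT : symmetric_op T) (dT : dense (op_dom T)).
Hypothesis (hA : selfadjoint_ge (friedrichs T) c).
Hypothesis (TA : T `<=` friedrichs T).
Hypotheses (hp : op_adjoint T (up, i *: up)) (np : nrm up = 1).
Let A := friedrichs T.
Let lA := sg_lin hA.
Let lB : linear_operator (op_adjoint T) := adj_linear dT.

Section fix_x0.
Variables (x0 : R) (x0c : x0 < c).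

Let psi := defect A up x0%:C.
Let D (s : R) := defect A up (x0 - s)%:C.
Let N (s : R) := mreal A up x0 - mreal A up (x0 - s).
Local Notation form f g := (Re ⟨f, g⟩ - x0 * nrm f ^+ 2).

Let bA f g : A (f, g) -> x0 * nrm f ^+ 2 <= Re ⟨f, g⟩.
Proof. exact: sg_ge (selfadjoint_ge_le hA (ltW x0c)) f g. Qed.

Let xs_lt s : 0 < s -> x0 - s < c. Proof. by move=> s0; rewrite ltrBlDr ltr_wpDr ?(ltW s0). Qed.

Let fA s : 0 < s -> A (psi - D s, x0%:C *: (psi - D s) + s%:C *: D s).
Proof.
move=> s0; have h := linB lA (@defect_sub _ _ _ _ hA up x0%:C x0c)
  (@defect_sub _ _ _ _ hA up (x0 - s)%:C (xs_lt s0)).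
by move: h; congr (A (_, _)); rewrite /psi /D ?rmorphB; vring.
Qed.

Let NE s : 0 < s -> N s = s * Re ⟨D s, psi⟩.
Proof. by move=> s0; rewrite /N (mreal_diff hA np (xs_lt s0) x0c) opprB addrC subrK. Qed.

(** With [D s = psi - f_s], f_s = s R(x0 - s) psi, this bounds the form of A - x0 at
    f_r - f_s by N r - N s.  In spectral terms it is the inequality
    (b - a)^2 <= b - a for a = s/(t + s) <= b = r/(t + r) in [0,1], integrated
    against t; here it is derived from the positivity of resolvents. *)
Let N_mono s r : 0 < s -> s < r ->
  form (D s - D r) (x0%:C *: (D s - D r) + (r%:C *: D r - s%:C *: D s)) <= N r - N s.
Proof.
move=> s0 sr; have r0 := lt_trans s0 sr.
set Rs := op_resolvent A (x0 - s)%:C.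
have DsE : D s = D r + (r - s)%:C *: Rs (D r).
  by rewrite /D (defect_diffR hA up (xs_lt r0) (xs_lt s0)); congr (_ + _%:C *: _); ring.
have DsE' : D s = psi - s%:C *: Rs psi.
  rewrite /D (defect_diffR hA up x0c (xs_lt s0)) -/psi -scaleNr -rmorphN.
  by congr (_ + _%:C *: _); ring.
have sym u v : ⟨Rs u, v⟩ = ⟨u, Rs v⟩ by apply: (resolvent_sym hA); apply: xs_lt.
have pos u : 0 <= Re ⟨u, Rs u⟩ by apply: (resolvent_ge0 hA); apply: xs_lt.
have contr u : s * nrm (Rs u) <= nrm u.
  have := @resolvent_nrm _ _ _ _ hA (x0 - s)%:C u (xs_lt s0).
  apply: le_trans; rewrite -/Rs -[complex.Re _]/(x0 - s).
  by rewrite ler_wpM2r ?nrm_ge0 //; have := x0c; lra.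
rewrite !NE // innerDr innerZr inner_self -rmorphM cReD /=.
have -> : x0 * nrm (D s - D r) ^+ 2 + Re ⟨D s - D r, r%:C *: D r - s%:C *: D s⟩ - x0 * nrm (D s - D r) ^+ 2
  = Re ⟨D s - D r, r%:C *: D r - s%:C *: D s⟩ by ring.
rewrite -subr_ge0.
have -> : r * Re ⟨D r, psi⟩ - s * Re ⟨D s, psi⟩ = Re ⟨psi, r%:C *: D r - s%:C *: D s⟩.
  by rewrite !innerE cReD cReN !cReZ !(Re_innerC psi).
rewrite -cReB -innerBl.
have -> : psi - (D s - D r) = s%:C *: Rs psi + D r by rewrite DsE'; vring.
have -> : r%:C *: D r - s%:C *: D s = (r - s)%:C *: (D r - s%:C *: Rs (D r)).
  by rewrite DsE rmorphB; vring.
rewrite innerZr cReZ mulr_ge0 ?subr_ge0 ?(ltW sr) // innerDl cReD addr_ge0 //.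
  rewrite innerZl conjc_real cReZ mulr_ge0 ?(ltW s0) //.
  have -> : ⟨Rs psi, D r - s%:C *: Rs (D r)⟩ = ⟨D s, Rs (D r)⟩.
    by rewrite DsE' !innerE conjc_real sym.
  rewrite DsE innerDl innerZl conjc_real cReD cReZ nrm2 addr_ge0 //.
  by rewrite mulr_ge0 ?sqr_ge0 // subr_ge0 ltW.
rewrite innerDr innerNr innerZr cReD cReN cReZ nrm2.
have h1 := Re_inner_le (D r) (Rs (D r)); have h2 := contr (D r).
have h3 := nrm_ge0 (D r).
have h4 : nrm (D r) * (s * nrm (Rs (D r))) <= nrm (D r) * nrm (D r) by rewrite ler_wpM2l.
have h5 : s * Re ⟨D r, Rs (D r)⟩ <= s * (nrm (D r) * nrm (Rs (D r))) by rewrite ler_wpM2l // ltW.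
by rewrite expr2; lra.
Qed.

Let dA s r : 0 < s -> 0 < r ->
  A (D s - D r, x0%:C *: (D s - D r) + (r%:C *: D r - s%:C *: D s)).
Proof.
move=> s0 r0; have := linB lA (fA r0) (fA s0).
by congr (A (_, _)); vring.
Qed.

Let N_le s r : 0 < s -> s <= r -> N s <= N r.
Proof.
move=> s0; rewrite le_eqVlt => /predU1P[-> //|sr].
rewrite -subr_ge0; apply: le_trans (N_mono s0 sr).
by rewrite subr_ge0; apply: bA; apply: dA => //; apply: lt_trans sr.
Qed.

Let D_small s : 0 < s -> s * nrm (D s) ^+ 2 <= N s.
Proof.
move=> s0; rewrite NE // ler_pM2l //.
have := bA (fA s0); rewrite innerDr !innerZr inner_self cReD -rmorphM /= lerDl cReZ.
rewrite pmulr_rge0 // innerDl innerNl cReD cReN nrm2 subr_ge0 => h.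
by rewrite Re_innerC.
Qed.

(** A nonnegative quadratic form is convex. *)
Lemma form_sum3_le f g f1 g1 f2 g2 : A (f, g) -> A (f1, g1) -> A (f2, g2) ->
  form (f + f1 + f2) (g + g1 + g2) <= 3 * (form f g + form f1 g1 + form f2 g2).
Proof.
move=> h h1 h2; have sA := sg_sym hA.
have := form_cross lA sA bA h h1; have := form_cross lA sA bA h h2.
have := form_cross lA sA bA h1 h2.
rewrite !nrm2D !innerE !cReD.
have := congr1 (@complex.Re R) (symE sA h h1); rewrite Re_innerC => ->.
have := congr1 (@complex.Re R) (symE sA h h2); rewrite Re_innerC => ->.
have := congr1 (@complex.Re R) (symE sA h1 h2); rewrite Re_innerC => ->.
rewrite !ler_norml => /andP[? ?] /andP[? ?] /andP[? ?]; lra.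
Qed.

(** Were m bounded below at -oo, N would be bounded and increasing.  Then f_s
    would converge to psi = u(x0) and be form-Cauchy by [N_mono], putting psi
    into the form domain, hence into the domain of the Friedrichs extension, as
    an eigenvector for x0, which lies below the lower bound. *)
Lemma mreal_unbounded_below (K : R) : exists2 x, x < x0 & mreal A up x < K.
Proof.
apply: contrapT => hK.
have hB s : 0 < s -> N s <= mreal A up x0 - K.
  move=> s0; rewrite /N lerB // leNgt; apply/negP => h; apply: hK.
  by exists (x0 - s) => //; lra.
pose B := mreal A up x0 - K.
have B0 : 0 <= B by apply: le_trans (hB _ ltr01); apply: le_trans (D_small ltr01); rewrite mul1r sqr_ge0.
pose s (n : nat) : R := n.+1%:R.
have s0 n : 0 < s n by [].
have s_le n m : (n <= m)%N -> s n <= s m by move=> nm; rewrite ler_nat ltnS.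
have N_cauchy (e : R) : 0 < e -> exists n0, forall n m, (n0 <= n)%N -> (n0 <= m)%N ->
    `|N (s n) - N (s m)| < e.
  move=> e0; pose S := range (fun n => N (s n)).
  have hS : has_sup S.
    split; first by exists (N (s 0%N)); exists 0%N.
    by exists B => _ [n _ <-]; apply: hB.
  have [_ [n0 _ <-] h] := sup_adherent e0 hS.
  have le_sup n : N (s n) <= sup S by apply: (sup_upper_bound hS); exists n.
  exists n0 => n m /s_le nn /s_le mm.
  have h1 := N_le (s0 _) nn; have h2 := N_le (s0 _) mm.
  by have h3 := le_sup n; have h4 := le_sup m; rewrite ltr_norml; apply/andP; split; lra.
have [iv [iv0 ivc]] := positive_null_sequence R.
have appr n : exists p : H * H, [/\ T p, nrm (psi - D (s n) - p.1) < iv n &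
    `|form (psi - D (s n) - p.1) (x0%:C *: (psi - D (s n)) + (s n)%:C *: D (s n) - p.2)| <= iv n].
  have bT f g : T (f, g) -> x0 * nrm f ^+ 2 <= Re ⟨f, g⟩ by move=> /TA; apply: bA.
  have [f' [g' [? ? ?]]] := friedrichs_approx lT sT bT (fA (s0 n)) (iv0 n).
  by exists (f', g').
have [FG hFG] := @choice _ _ _ appr.
have Dto0 (e : R) : 0 < e -> exists n0, forall n, (n0 <= n)%N -> nrm (D (s n)) < e.
  move=> e0; have e1 : 0 < e ^+ 2 / (B + 1) by rewrite divr_gt0 ?exprn_gt0 // ltr_wpDl.
  have [n0 _ hn0] := @near_infty_natSinv_lt R (PosNum e1).
  exists n0 => n /hn0 /= h; rewrite -(@ltr_pXn2r _ 2) ?nnegrE ?nrm_ge0 ?(ltW e0) //.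
  have := le_trans (D_small (s0 n)) (hB _ (s0 n)); rewrite -/B => h1.
  move: h; rewrite ltr_pdivlMr ?ltr_wpDl // -/(s n) => h.
  have hs : s n * (s n)^-1 = 1 by rewrite divff // gt_eqF.
  rewrite -(ltr_pM2l (s0 n)); apply: (le_lt_trans h1).
  apply: (@lt_trans _ _ (B + 1)); first by lra.
  by have := h; rewrite -(ltr_pM2l (s0 n)) mulrA hs mul1r.
have small (e : R) : 0 < e -> exists n0, forall n, (n0 <= n)%N ->
    nrm (psi - (FG n).1) < e.
  move=> e0; have e2 : 0 < e / 2 by rewrite divr_gt0.
  have [n1 h1] := Dto0 _ e2; have [n2 h2] := ivc _ e2.
  exists (maxn n1 n2) => n; rewrite geq_max => /andP[/h1 k1 /h2 k2].
  have -> : psi - (FG n).1 = (psi - D (s n) - (FG n).1) + D (s n) by vring.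
  by apply: (le_lt_trans (nrmD _ _)); have [_ k3 _] := hFG n; lra.
have psi_form : form_domain T psi.
  exists (fun n => (FG n).1), (fun n => (FG n).2); split.
  - by move=> n; have [h _ _] := hFG n; rewrite -surjective_pairing.
  - by apply/cvg_seqP.
  apply/(form_cvgP (fun n => (FG n).1) (fun n => (FG n).2)) => e e0 /=.
  have e12 : 0 < e / 18 by rewrite divr_gt0.
  pose e' := Num.min 1 (e / 16 / (`|x0| + 1)).
  have e'0 : 0 < e' by rewrite lt_min ltr01 !divr_gt0 // ltr_wpDl.
  have [n1 h1] := ivc _ e12; have [n2 h2] := N_cauchy _ e12; have [n3 h3] := small _ e'0.
  exists (maxn n1 (maxn n2 n3)) => n m.
  rewrite !geq_max => /and3P[n1n n2n n3n] /and3P[n1m n2m n3m].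
  set f := (FG n).1 - (FG m).1; set g := (FG n).2 - (FG m).2.
  have [Tn _ qn] := hFG n; have [Tm _ qm] := hFG m.
  have Tnm : T (f, g) by apply: linB => //; rewrite -surjective_pairing.
  have fe : nrm f ^+ 2 * `|x0| <= e / 4.
    have fe : nrm f <= 2 * e'.
      have -> : f = (psi - (FG m).1) - (psi - (FG n).1) by rewrite /f; vring.
      by apply: (le_trans (nrmB _ _)); have := h3 _ n3n; have := h3 _ n3m; lra.
    have f0 := nrm_ge0 f.
    have e'1 : e' <= 1 by rewrite ge_min lexx.
    have ex : e' * `|x0| <= e / 16.
      have : e' <= e / 16 / (`|x0| + 1) by rewrite ge_min lexx orbT.
      by rewrite ler_pdivlMr ?ltr_wpDl // mulrDr mulr1; lra.
    have f2 : nrm f ^+ 2 <= 4 * e' by rewrite expr2; nra.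
    apply: (le_trans (ler_wpM2r (normr_ge0 x0) f2)); lra.
  have An := linB lA (TA Tn : A ((FG n).1, (FG n).2)) (fA (s0 n)).
  have Am := linB lA (fA (s0 m)) (TA Tm : A ((FG m).1, (FG m).2)).
  have Dnm := dA (s0 m) (s0 n).
  have formN f0 g0 : form (- f0) (- g0) = form f0 g0.
    by rewrite nrmN innerNr innerNl opprK.
  have qnm : form (D (s m) - D (s n)) (x0%:C *: (D (s m) - D (s n))
        + ((s n)%:C *: D (s n) - (s m)%:C *: D (s m))) <= e / 18.
    apply: (@le_trans _ _ `|N (s n) - N (s m)|); last by apply/ltW/h2.
    case: (ltgtP (s n) (s m)) => [nm|mn|->].
    - rewrite distrC; apply: le_trans (ler_norm _); apply: le_trans (N_mono (s0 n) nm).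
      rewrite -[X in _ <= X]formN le_eqVlt; apply/orP; left; apply/eqP.
      have -> : - (D (s n) - D (s m)) = D (s m) - D (s n) by vring.
      by congr (complex.Re (inner _ _) - _); vring.
    - by apply: le_trans (ler_norm _); apply: N_mono.
    - by rewrite !subrr scaler0 addr0 inner0r nrm0 /= expr0n /= mulr0 subrr.
  have h1n := h1 _ n1n; have h1m := h1 _ n1m.
  have {}qn := le_trans (ler_norm _) qn; have {}qm := le_trans (ler_norm _) qm.
  rewrite -formN (opprB (psi - D (s n))) (opprB (_ *: _ + _)) in qn.
  have key := form_sum3_le An Dnm Am.
  have fE : (FG n).1 - (psi - D (s n)) + (D (s m) - D (s n)) + (psi - D (s m) - (FG m).1) = f.
    by rewrite /f; vring.
  have gE : (FG n).2 - (x0%:C *: (psi - D (s n)) + (s n)%:C *: D (s n)) +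
      (x0%:C *: (D (s m) - D (s n)) + ((s n)%:C *: D (s n) - (s m)%:C *: D (s m))) +
      (x0%:C *: (psi - D (s m)) + (s m)%:C *: D (s m) - (FG m).2) = g.
    by rewrite /g; vring.
  rewrite fE gE in key; clearbody f g.
  have f0 := bA (TA Tnm).
  have im0 : Im ⟨f, g⟩ = 0.
    by have := congr1 (@complex.Im R) (symE sT Tnm Tnm); rewrite (innerC f g) cImJ; lra.
  apply: (@le_lt_trans _ _ (3 / 4 * e)); last by lra.
  apply: normc_le => //; first by rewrite mulr_ge0 // ltW.
  have xx : `|x0 * nrm f ^+ 2| <= e / 4.
    by rewrite normrM (ger0_norm (sqr_ge0 _)) mulrC.
  rewrite !ler_norml in xx *; move/andP: xx => [xx1 xx2].
  by apply/andP; split; lra.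
have Bpsi : op_adjoint T (psi, x0%:C *: psi).
  have h := (@defect_sub _ _ _ _ hA up x0%:C x0c).1.
  by have := linD lB h hp; rewrite -/psi !subrK.
have Apsi : A (psi, x0%:C *: psi) by split.
have := sg_ge hA Apsi; rewrite innerZr inner_self -rmorphM /= => h.
have p0 : nrm psi = 0.
  apply/eqP; rewrite -sqrf_eq0 eq_le sqr_ge0 andbT.
  have : (c - x0) * nrm psi ^+ 2 <= 0 by lra.
  by rewrite pmulr_rle0 // subr_gt0.
have := @defect_neq0 _ _ _ _ hA up np x0%:C x0c.
by rewrite -/psi (nrm_eq0 p0) eqxx.
Qed.

End fix_x0.
End fix_T.
End divergence.

(** * Bounded symmetric perturbations *)

Section perturbation.
Variables (R : realType) (H : hilbertType R).
Implicit Types (f g h u v w : H).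
Local Notation i := ('i%C : R[i]).

Lemma expiD (a b : R) : expi (a + b) = expi a * expi b.
Proof. by apply: complex_ext; rewrite ?cReM ?cImM /= ?cosD ?sinD //; ring. Qed.

Lemma continuous_linear_bounded (V : {linear H -> H}) : continuous V ->
  exists2 K : R, 0 <= K & forall u, nrm (V u) <= K * nrm u.
Proof.
move=> /(_ 0)/cvg_nrmP/(_ 1 ltr01)/nbhs_ballP[d /= /gt0_realC[d0 dE] hd].
exists (2 / Re d) => [|u]; first by rewrite divr_ge0 // ltW.
have [u0|u0] := eqVneq (nrm u) 0.
  by rewrite (nrm_eq0 u0) linear0 nrm0 mulr0.
have up : 0 < nrm u by rewrite lt_neqAle eq_sym u0 nrm_ge0.
(* rescale u to length d / 2, inside the ball provided by continuity *)
pose t : R := Re d / 2 / nrm u.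
have t0 : 0 < t by rewrite !divr_gt0.
have : nrm (V 0 - V (t%:C *: u)) < 1.
  apply: hd; rewrite -ball_normE /ball_ /= sub0r normrN nrmE dE ltcR nrmZ normcR gtr0_norm //.
  rewrite /t divfK //; have := d0; lra.
rewrite linear0 sub0r nrmN linearZ nrmZ normcR (gtr0_norm t0) /t => h.
have -> : 2 / Re d * nrm u = (Re d / 2 / nrm u)^-1 by rewrite !invf_div mulrC mulrA [_ * 2]mulrC.
by rewrite -[leRHS]mulr1 -ler_pdivrMl ?invr_gt0 // invrK ltW.
Qed.

Lemma sym_of_graph (V : H -> H) : op_adjoint (op_graph V) = op_graph V ->
  forall u v, ⟨V u, v⟩ = ⟨u, V v⟩.
Proof.
move=> hV u v; have : op_adjoint (op_graph V) (u, V u) by rewrite hV.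
by move=> /(_ v (V v)); apply.
Qed.

Section sub.
Variables (T : set (H * H)) (V : {linear H -> H}).
Hypotheses (lT : linear_operator T) (sT : symmetric_op T) (dT : dense (op_dom T)).
Hypothesis sV : forall u v, ⟨V u, v⟩ = ⟨u, V v⟩.
Let T0 := op_sub T V.

Lemma sub_linear : linear_operator T0.
Proof.
split.
- by apply/op_subP; rewrite linear0 addr0; apply: lin0.
- move=> a f g f' g' /op_subP h /op_subP h'; apply/op_subP.
  by have := linP lT a h h'; congr (T (_, _)); rewrite linearP; vring.
- by move=> f g g' /op_subP h /op_subP h'; apply: (addIr (V f)); apply: lin_inj h h'.
Qed.

Lemma adj_subP f g : op_adjoint T0 (f, g) <-> op_adjoint T (f, g + V f).
Proof.
split=> h f' g'.
  move=> h'; have /h /= : T0 (f', g' - V f') by apply/op_subP; rewrite subrK.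
  by rewrite innerBr innerDl => ->; rewrite sV subrK.
by move=> /op_subP /h /=; rewrite innerDl innerDr sV => /addIr.
Qed.

Lemma sub_sym : symmetric_op T0.
Proof. by move=> [f g] /op_subP /sT h; apply/adj_subP. Qed.

Lemma sub_dom : op_dom T0 = op_dom T.
Proof.
apply/seteqP; split=> f [g h]; first by exists (g + V f); apply/op_subP.
by exists (g - V f); apply/op_subP; rewrite subrK.
Qed.

Hypothesis bV : exists2 K : R, 0 <= K & forall u, nrm (V u) <= K * nrm u.

(** Adding a bounded operator changes the form at f by O(|f|^2), which tends to 0
    on the differences of a convergent sequence. *)
Lemma form_domain_incl (S S' : set (H * H)) (e : R) :
  (forall f g, S (f, g) -> S' (f, g + e%:C *: V f)) ->
  form_domain S `<=` form_domain S'.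
Proof.
have [K K0 hK] := bV.
move=> hS f [F [G [hFG hF /form_cvgP hC]]].
exists F, (fun n => G n + e%:C *: V (F n)); split => //; first by move=> n; apply: hS.
apply/(form_cvgP F (fun n => G n + e%:C *: V (F n))) => d d0 /=.
have d2 : 0 < d / 2 by rewrite divr_gt0.
have [N1 h1] := hC _ d2.
pose L := `|e| * K.
have L0 : 0 <= L by rewrite mulr_ge0.
pose b := Num.min 1 (d / 16 / (L + 1)).
have b0 : 0 < b by rewrite lt_min ltr01 !divr_gt0 // ltr_wpDl.
have [N2 h2] := (cvg_seqP _ _).1 hF _ b0.
exists (maxn N1 N2) => n m; rewrite !geq_max => /andP[n1 n2] /andP[m1 m2].
have -> : G n + e%:C *: V (F n) - (G m + e%:C *: V (F m)) =
    (G n - G m) + e%:C *: V (F n - F m) by rewrite linearB; vring.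
rewrite innerDr; apply: (le_lt_trans (le_normcD _ _)).
have hn : nrm (F n - F m) <= 2 * b.
  have -> : F n - F m = (f - F m) - (f - F n) by vring.
  by apply: (le_trans (nrmB _ _)); have := h2 _ n2; have := h2 _ m2; lra.
have hq : normc ⟨F n - F m, e%:C *: V (F n - F m)⟩ <= L * nrm (F n - F m) ^+ 2.
  apply: (le_trans (cauchy_schwarz _ _)); rewrite nrmZ normcR.
  rewrite expr2 mulrCA /L -[leRHS]mulrA ler_wpM2l // mulrCA ler_wpM2l ?nrm_ge0 //.
have hb : nrm (F n - F m) ^+ 2 <= 4 * b.
  have n0 := nrm_ge0 (F n - F m).
  have b1 : b <= 1 by rewrite ge_min lexx.
  by move: n0 hn b0 b1; rewrite expr2; clear; move: (nrm _) b => x b; nra.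
have bL : b * L <= d / 16.
  apply: mul_le_of_le_div => //; first exact: ltW.
  by rewrite ge_min lexx orbT.
have hL : L * nrm (F n - F m) ^+ 2 <= L * (4 * b) by rewrite ler_wpM2l.
have := h1 _ _ n1 m1; move: hq hL bL d0; clear.
move: (normc _) (normc _) (nrm _) L b => x y z L b *; lra.
Qed.

Lemma friedrichs_subP f g : friedrichs T0 (f, g) <-> friedrichs T (f, g + V f).
Proof.
split=> -[h1 h2]; split=> /=; try exact/adj_subP.
- apply: (@form_domain_incl T0 T 1) h2 => a b /op_subP.
  by rewrite scale1r.
- apply: (@form_domain_incl T T0 (-1)) h2 => a b h.
  by apply/op_subP; rewrite rmorphN scaleN1r subrK.
Qed.

End sub.

Section extension_vector.
Variables (T : set (H * H)) (up um : H) (alpha beta : R).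
Hypotheses (lT : linear_operator T) (np : nrm up = 1).

(** The vector a (u_+ + e^(2 i beta) u_-) is congruent to u_+ modulo the extension
    with parameter alpha exactly for a = (1 + i cot (beta - alpha)) / 2, and the
    value of the boundary form is then a direct computation. *)
Lemma extension_vector : sin (beta - alpha) != 0 ->
  exists v v', [/\ sa_extension T up um beta (v, v'),
    sa_extension T up um alpha (v - up, v' - i *: up) &
    bdry (v, v') (up, i *: up) = - (cot (beta - alpha))%:C - i].
Proof.
have bE : expi (2 * beta) = expi (2 * alpha) * expi (2 * (beta - alpha)).
  by rewrite -expiD; congr expi; ring.
move: (beta - alpha) bE => d bE s0.
(* the coefficient solving a e^(2 i d) = a - 1 *)
pose a : R[i] := 2^-1 +i* (cot d / 2).
have aE : a * expi (2 * d) = a - 1.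
  rewrite (_ : 2 * d = d + d) ?expiD; last by ring.
  have cs := cos2Dsin2 d.
  have s2 : sin d * sin d = 1 - cos d * cos d by rewrite -!expr2 -cs addrC addKr.
  rewrite /a; apply: complex_ext; rewrite ?cReB ?cImB ?cReM ?cImM /= ?cReM ?cImM /= /cot.
    transitivity (2^-1 * (cos d * cos d - sin d * sin d) - cos d * cos d); first by field.
    by rewrite s2; field.
  transitivity ((sin d * sin d + cos d * cos d) * cos d / sin d / 2); first by field.
  by rewrite s2; field.
exists (a *: (up + expi (2 * beta) *: um)),
  (a *: (i *: up - (i * expi (2 * beta)) *: um)); split.
- by exists 0, 0, a; split; [exact: lin0|rewrite !add0r].
- exists 0, 0, (a - 1); split; first exact: lin0.
  rewrite !add0r; congr pair; apply: inner_ext => w; rewrite ?innerE bE.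
    ring: aE.
  ring: aE.
- rewrite /bdry /= !innerE inner_self np expr1n -[1%:C]/(1 : R[i]) conjcM conjc_i.
  rewrite [LHS](_ : _ = - (2 * i) * a^*); last by ring.
  by rewrite /a; apply: complex_ext; rewrite ?cReB ?cImB ?cReM ?cImM ?cReN ?cImN ?cReJ ?cImJ ?cReM ?cImM /=; field.
Qed.

End extension_vector.
End perturbation.

(** * The relation between the two Donoghue functions *)

Section krein.
Variables (R : realType) (H : hilbertType R).
Implicit Types (f g h u v w : H).
Local Notation i := ('i%C : R[i]).

Lemma bdryD (p q r : H * H) : bdry p (q.1 + r.1, q.2 + r.2) = bdry p q + bdry p r.
Proof. by rewrite /bdry /= !innerDr; ring. Qed.

Lemma bdryDl (p q r : H * H) : bdry (q.1 + r.1, q.2 + r.2) p = bdry q p + bdry r p.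
Proof. by rewrite /bdry /= !innerDl; ring. Qed.

Lemma bdryZ (a : R[i]) (p q : H * H) : bdry p (a *: q.1, a *: q.2) = a * bdry p q.
Proof. by rewrite /bdry /= !innerZr; ring. Qed.

Lemma bdryZl (a : R[i]) (p q : H * H) : bdry (a *: q.1, a *: q.2) p = a^* * bdry q p.
Proof. by rewrite /bdry /= !innerZl; ring. Qed.

(** On its domain A acts as the maximal operator, which maps u_+ to i u_+; but a
    symmetric operator does not have the eigenvalue i. *)
Lemma unit_vector_notin (A : set (H * H)) (T : set (H * H)) up :
  dense (op_dom T) -> A `<=` op_adjoint T -> symmetric_op A ->
  op_adjoint T (up, i *: up) -> nrm up = 1 -> forall y, ~ A (up, y).
Proof.
move=> dT AT sA hp np y Ay.
have yE : y = i *: up := lin_inj (adj_linear dT) (AT _ Ay) hp.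
rewrite yE in Ay; have := symE sA Ay Ay; rewrite !innerE conjc_i inner_self np expr1n.
by move/(congr1 (@complex.Im R)) => /=; lra.
Qed.

Variables (T : set (H * H)) (V : {linear H -> H}).
Hypotheses (lT : linear_operator T) (sT : symmetric_op T) (dT : dense (op_dom T)).
Hypotheses (cT : seq_closed T) (dTi : deficiency_indices_11 T).
Hypothesis sV : forall u v, ⟨V u, v⟩ = ⟨u, V v⟩.
Let T0 := op_sub T V.
Variables (up um up0 um0 : H).
Hypotheses (hp : op_adjoint T (up, i *: up)) (hm : op_adjoint T (um, - i *: um)).
Hypotheses (np : nrm up = 1) (nm : nrm um = 1).
Hypotheses (hp0 : op_adjoint T0 (up0, i *: up0)) (hm0 : op_adjoint T0 (um0, - i *: um0)).
Hypotheses (np0 : nrm up0 = 1) (nm0 : nrm um0 = 1).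
Variables (alpha beta alpha0 beta0 : R).
Let A := sa_extension T up um alpha.
Let A0 := sa_extension T0 up0 um0 alpha0.
Hypothesis AA0 : forall f g, A0 (f, g) <-> A (f, g + V f).
Variable c : R.
Hypotheses (hA : selfadjoint_ge A c) (hA0 : selfadjoint_ge A0 c).
Hypothesis dom_beta :
  op_dom (sa_extension T up um beta) = op_dom (sa_extension T0 up0 um0 beta0).
Hypotheses (sb : sin (beta - alpha) != 0) (sb0 : beta0 != alpha0 -> sin (beta0 - alpha0) != 0).

Let lT0 : linear_operator T0 := sub_linear V lT.
Let dT0 : dense (op_dom T0). Proof. by rewrite (sub_dom T V). Qed.
Let lA := sg_lin hA.
Let sA := sg_sym hA.
Let AT : A `<=` op_adjoint T := sa_adj sT dT hp hm (alpha := alpha).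

Let M x := mreal A up x + cot (beta - alpha).
Let M0 x := mreal A0 up0 x + cot (beta0 - alpha0).
Let u x := defect A up x%:C.
Let u0 x := defect A0 up0 x%:C.

(** Let k be such that u0_+ = k u_+ modulo the Friedrichs domain.  The vectors
    [k u(x)] and [u0(x) - R V u0(x)] are eigenvectors of the maximal operator for x
    and agree modulo that domain, so they are equal.  Evaluating the boundary
    form of v0, the vector of the extension for beta congruent to u0_+, on this
    vector in two ways gives the first relation, with kappa = |k|^2. *)
Lemma krein_relation : exists2 kappa : R, 0 < kappa & forall x, x < c ->
  let r := op_resolvent A x%:C (V (u0 x)) in
  kappa * M x = M0 x - Re ⟨u0 x, V (u0 x)⟩ + Re ⟨V (u0 x), r⟩ /\
  kappa * nrm (u x) ^+ 2 = nrm (u0 x - r) ^+ 2.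
Proof.
have [v [v' [Bv Av bv]]] := extension_vector um lT np sb.
(* beta0 = alpha0 would put v, hence u_+, into the Friedrichs domain *)
have sin0 : sin (beta0 - alpha0) != 0.
  apply: sb0; apply/eqP => b0a0.
  have [y A0y] : op_dom A0 v.
    have : op_dom (sa_extension T up um beta) v by exists v'.
    by rewrite dom_beta b0a0.
  have := linB lA ((AA0 v y).1 A0y) Av; rewrite subKr.
  exact: unit_vector_notin dT AT sA hp np _.
have [v0 [v0' [Bv0 Av0 bv0]]] := extension_vector um0 lT0 np0 sin0.
have hp0' := (adj_subP T sV _ _).1 hp0.
have [k Ak] := max_decomp lT sT dT hp hm np nm alpha cT dTi hp0'.
rewrite -/A in Av Ak; rewrite -/A0 in Av0.
have k0 : k != 0.
  apply/eqP => k0; move: Ak; rewrite k0 mul0r !scale0r !subr0 => /AA0.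
  exact: unit_vector_notin dT0 (sa_adj (sub_sym sT sV) dT0 hp0 hm0 (alpha := alpha0))
    (sg_sym hA0) hp0 np0 _.
have kn : 0 < normc k ^+ 2.
  rewrite exprn_gt0 // lt_neqAle normc_ge0 andbT eq_sym; apply/eqP.
  by move/ComplexField.Normc.eq0_normc/eqP; apply/negP.
have Bv0' : sa_extension T up um beta (v0, v0' + V v0).
  have [y By] : op_dom (sa_extension T up um beta) v0 by rewrite dom_beta; exists v0'.
  have h1 := sa_adj sT dT hp hm By.
  have h2 := (adj_subP T sV _ _).1 (sa_adj (sub_sym sT sV) dT0 hp0 hm0 Bv0).
  by rewrite -(lin_inj (adj_linear dT) h1 h2).
have lB := sa_linear lT sT dT hp hm beta.
have sB := sa_sym sT dT hp hm np nm (alpha := beta).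
have Av0T := (AA0 _ _).1 Av0.
exists (normc k ^+ 2) => // x xc r.
have Au := @defect_sub _ _ _ _ hA up x%:C xc; rewrite -/(u x) in Au.
have Au0 := (AA0 _ _).1 (@defect_sub _ _ _ _ hA0 up0 x%:C xc); rewrite -/(u0 x) in Au0.
have Ar := @resolventP _ _ _ _ hA x%:C (V (u0 x)) xc; rewrite -/r in Ar.
(* both sides are eigenvectors of the maximal operator for x, and they agree
   modulo the domain of A, where x is a resolvent point *)
have uE : k *: u x = u0 x - r.
  apply/eqP; rewrite eq_sym subr_eq addrC -subr_eq eq_sym; apply/eqP.
  apply: (resolventE hA) => //.
  have := linB lA (linD lA Au0 Ak) (linZ lA k Au).
  by congr (A (_, _)); rewrite ?linearB; vring.
split; last by rewrite -uE nrmZ exprMn.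
have MxE : bdry (v, v') (u x, x%:C *: u x) = - (M x)%:C.
  have := bdry_defect hA np (p := (v, v')) (z := x%:C) xc Av.
  by rewrite -/(u x) bv (mrealE hA) // => ->; rewrite /M rmorphD; ring.
have M0xE : bdry (v0, v0') (u0 x, x%:C *: u0 x) = - (M0 x)%:C.
  have := bdry_defect hA0 np0 (p := (v0, v0')) (z := x%:C) xc Av0.
  by rewrite -/(u0 x) bv0 (mrealE hA0) // => ->; rewrite /M0 rmorphD; ring.
(* v0 - k v lies in the domain of A and in that of the extension for beta,
   so it is annihilated by the boundary form against u(x) *)
pose d1 := v0 - k *: v; pose d2 := v0' + V v0 - k *: v'.
have Ad : A (d1, d2).
  have := linB lA (linD lA Av0T Ak) (linZ lA k Av).
  by congr (A (_, _)); rewrite /d1 /d2 ?linearB; vring.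
have Bd : sa_extension T up um beta (d1, d2) := linB lB Bv0' (linZ lB k Bv).
have bd : bdry (d1, d2) (u x, x%:C *: u x) = 0.
  have -> : (u x, x%:C *: u x) = ((u x - v) + v, (x%:C *: u x - v') + v').
    by rewrite !subrK.
  rewrite (bdryD _ (_, _) (_, _)) (bdry_sym sB Bd Bv) addr0.
  apply: (bdry_sym sA) => //; have := linB lA Au Av.
  by congr (A (_, _)); vring.
(* the boundary form on v0, evaluated first through d1 and v, then through
   the splitting u0 - r *)
have side1 : bdry (v0, v0' + V v0) (k *: u x, k *: (x%:C *: u x)) =
    - ((normc k ^+ 2)%:C * (M x)%:C).
  rewrite (bdryZ _ _ (_, _)).
  have -> : (v0, v0' + V v0) = (d1 + k *: v, d2 + k *: v') by rewrite !subrK.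
  rewrite (bdryDl _ (_, _) (_, _)) bd add0r (bdryZl _ _ (_, _)) MxE mulrA mulrN.
  by congr (- (_ * _)); apply: complex_ext; rewrite ?sqr_normc_ReIm ?cReM ?cImM cReJ cImJ /=; ring.
have side2 : bdry (v0, v0' + V v0) (k *: u x, k *: (x%:C *: u x)) =
    - (M0 x)%:C - (⟨V (u0 x), r⟩ - ⟨u0 x, V (u0 x)⟩).
  have -> : (k *: u x, k *: (x%:C *: u x)) = (u0 x + (- 1) *: r,
      (x%:C *: u0 x + V (u0 x)) + (- 1) *: (V (u0 x) + x%:C *: r)).
    by congr pair; rewrite ?[k *: (_ *: _)]scalerA ?[k * _]mulrC -?scalerA uE; vring.
  rewrite (bdryD _ (_, _) (_, _)) (bdryZ _ _ (_, _)) mulN1r; congr (_ - _).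
    by rewrite -M0xE /bdry /= !innerE sV; ring.
  have -> : (v0, v0' + V v0) = ((v0 - u0 x) + u0 x,
     (v0' + V v0 - (x%:C *: u0 x + V (u0 x))) + (x%:C *: u0 x + V (u0 x))).
    by rewrite !subrK.
  rewrite (bdryDl _ (_, _) (_, _)) (bdry_sym (A := A)) //; last first.
    by have := linB lA Av0T Au0; congr (A (_, _)); rewrite ?linearB; vring.
  by rewrite add0r /bdry /= !innerE conjc_real; ring.
move: side1; rewrite side2 => /(congr1 (@complex.Re R)).
by rewrite cReB !cReN cReB cReZ /= => h; lra.
Qed.

End krein.

(** * Poisson kernel and argument *)

Section poisson.
Variable R : realType.
Implicit Types (x y l : R) (eta : R -> R).
Local Notation mu := (@lebesgue_measure R).

Definition poisson_ker x y l : R := y / ((l - x) ^+ 2 + y ^+ 2).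

Lemma poisson_den x y l : 0 < y -> 0 < (l - x) ^+ 2 + y ^+ 2.
Proof. by move=> y0; rewrite ltr_wpDl ?sqr_ge0 // exprn_gt0. Qed.

Lemma poisson_ge0 x y l : 0 < y -> 0 <= poisson_ker x y l.
Proof. by move=> y0; rewrite divr_ge0 // ltW // poisson_den. Qed.

Lemma continuous_poisson x y : 0 < y -> continuous (poisson_ker x y).
Proof.
move=> y0 l; apply: cvgM; first exact: cvg_cst.
apply: cvgV; first by rewrite gt_eqF // poisson_den.
apply: cvgD; last exact: cvg_cst.
by apply: (cvg_comp (fun l => l - x) (fun t => t ^+ 2)); [apply: cvgB; [exact: cvg_id|exact: cvg_cst]|exact: exprn_continuous].
Qed.

Lemma measurable_poisson x y : 0 < y -> measurable_fun [set: R] (poisson_ker x y).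
Proof. by move=> y0; apply: continuous_measurable_fun; apply: continuous_poisson. Qed.

Lemma integral_oneDsqrV : (\int[mu]_t (oneDsqr t)^-1%:E = pi%:E)%E.
Proof.
rewrite (@ge0_symfun_integralT _ (fun t => (oneDsqr t)^-1)).
- rewrite -set_itvcy integral0y_oneDsqr -EFinM; congr EFin; by field.
- by move=> t; rewrite invr_ge0 (le_trans ler01) // oneDsqr_ge1.
- exact: continuous_oneDsqrV.
- by move=> t; rewrite /= /oneDsqr sqrrN.
Qed.

(** Substitute t = (l - x) / y. *)
Lemma integral_poisson x y : 0 < y -> (\int[mu]_l (poisson_ker x y l)%:E = pi%:E)%E.
Proof.
move=> y0; rewrite -integral_oneDsqrV.
have dF (l : R) : is_derive l 1 (fun l => (l - x) / y) y^-1.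
  by apply: is_derive_eq; rewrite scaler0 add0r subr0 /GRing.scale /= mulr1.
have dFE : derive1 (fun l => (l - x) / y) = cst y^-1.
  by apply/funext => l; rewrite derive1E; have [_ ->] := dF l.
rewrite [RHS](@increasing_ge0_integration_by_substitutionT _ (fun l => (l - x) / y) (fun t => (oneDsqr t)^-1)).
- apply: eq_integral => l _; congr EFin; rewrite dFE /poisson_ker /oneDsqr /=.
  rewrite [in RHS]/GRing.mul /=.
  have := poisson_den x l y0 => d0; rewrite [RHS](_ : _ = (1 + ((l - x) / y) ^+ 2)^-1 * y^-1) //.
  field; rewrite !gt_eqF //=; last by rewrite addrC.
- by move=> a b ab; rewrite ltr_pM2r ?invr_gt0 // ltrD2r.
- by rewrite dFE; exact: cst_continuous.
- by rewrite dFE; exact: is_cvg_cst.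
- by rewrite dFE; exact: is_cvg_cst.
- by move=> l; have [] := dF l.
- apply: gt0_cvgMlNy; first by rewrite invr_gt0.
  by under eq_fun do rewrite addrC; exact: cvg_addrl_Ny.
- apply: gt0_cvgMly; first by rewrite invr_gt0.
  by under eq_fun do rewrite addrC; exact: cvg_addrl.
- exact: continuous_oneDsqrV.
- by move=> t; rewrite invr_ge0 (le_trans ler01) // oneDsqr_ge1.
Qed.

Lemma integrable_poisson x y : 0 < y -> mu.-integrable [set: R] (fun l => (poisson_ker x y l)%:E).
Proof.
move=> y0; apply/integrableP; split; first by apply/measurable_EFinP; apply: measurable_poisson.
under eq_integral => l _ do rewrite abse_EFin ger0_norm ?poisson_ge0 //.
by rewrite integral_poisson // ltry.
Qed.

(** [cln] reads the argument off an arccosine, which is singular at the negative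
    axis; the arctangent is regular there. *)
Lemma pi_sub_arg (w : R[i]) : Re w < 0 -> pi - Im (cln w) = atan (`|Im w| / `|Re w|).
Proof.
case: w => a b a0; rewrite /cln normc_def /=; rewrite /= in a0.
set r := Num.sqrt _.
have an : 0 < `|a| by rewrite normr_gt0 lt_eqF.
have r0 : 0 < r by rewrite sqrtr_gt0 ltr_pwDl ?sqr_ge0 // exprn_even_gt0 //= lt_eqF.
have ra : `|a| <= r.
  rewrite -(@ler_pXn2r _ 2) ?nnegrE ?(ltW r0) // sqr_sqrtr ?addr_ge0 ?sqr_ge0 //.
  by rewrite real_normK ?num_real // lerDl sqr_ge0.
have cosE : cos (atan (`|b| / `|a|)) = `|a| / r.
  rewrite cos_atan -[RHS]invf_div; congr _^-1.
  have -> : 1 + (`|b| / `|a|) ^+ 2 = (a ^+ 2 + b ^+ 2) / `|a| ^+ 2.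
    by rewrite exprMn exprVn !real_normK ?num_real //; field; rewrite lt_eqF.
  by rewrite sqrtrM ?addr_ge0 ?sqr_ge0 // sqrtrV ?sqr_ge0 // sqrtr_sqr normr_id.
have -> : a / r = - (`|a| / r) by rewrite ltr0_norm // mulNr opprK.
rewrite acosN; last first.
  rewrite (le_trans _ (divr_ge0 (normr_ge0 _) (ltW r0))) ?lerN10 //=.
  by rewrite ler_pdivrMr // mul1r.
rewrite opprB addrCA subrr addr0 -cosE cosK // in_itv /=.
have t0 : 0 <= `|b| / `|a| by rewrite divr_ge0.
rewrite -{1}(@atan0 R) le_atan //= (le_trans (ltW (atan_ltpi2 _))) //.
by rewrite ler_pdivrMr // ler_peMr ?pi_ge0 // ler1n.
Qed.

Lemma atan_le (t : R) : 0 <= t -> atan t <= t.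
Proof.
rewrite le_eqVlt => /predU1P[<-|t0]; first by rewrite atan0.
have catan : {within `[0, t], continuous (@atan R)}.
  by apply: continuous_subspaceT => x; exact: continuous_atan.
have [x _] := MVT t0 (fun x _ => is_derive1_atan x) catan.
rewrite atan0 !subr0 => ->; rewrite ler_piMl ?(ltW t0) // invf_le1 ?lerDl ?sqr_ge0 //.
by rewrite ltr_wpDr ?sqr_ge0.
Qed.

Lemma atan_ge (t : R) : 0 <= t -> t / (1 + t ^+ 2) <= atan t.
Proof.
rewrite le_eqVlt => /predU1P[<-|t0]; first by rewrite atan0 mul0r.
have catan : {within `[0, t], continuous (@atan R)}.
  by apply: continuous_subspaceT => x; exact: continuous_atan.
have [x /itvP xt] := MVT t0 (fun x _ => is_derive1_atan x) catan.
rewrite atan0 !subr0 => ->; rewrite mulrC ler_wpM2r ?(ltW t0) //.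
rewrite lef_pV2 ?posrE ?ltr_wpDr ?sqr_ge0 // lerD2l ler_sqr ?nnegrE ?xt ?(ltW t0) //.
Qed.

End poisson.

(** * Exponential representations near the negative axis *)

Section inversion.
Variable R : realType.
Implicit Types (x y l : R) (eta g : R -> R).
Local Notation mu := (@lebesgue_measure R).

Lemma integrable_poissonM x y g : 0 < y -> measurable_fun [set: R] g ->
  (forall l, `|g l| <= 1) ->
  mu.-integrable [set: R] (fun l => (poisson_ker x y l * g l)%:E).
Proof.
move=> y0 mg g1; apply: le_integrable (integrable_poisson x y0) => //.
  by apply/measurable_EFinP; apply: measurable_funM => //; apply: measurable_poisson.
move=> l _; rewrite lee_fin normrM ler_piMr // normr_ge0.
Qed.

Lemma normr01 (t : R) : 0 <= t <= 1 -> `|t| <= 1.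
Proof. by move=> /andP[t0 t1]; rewrite ger0_norm. Qed.

Lemma herglotz_angle (M : R[i] -> R[i]) eta x y : exp_herglotz M eta -> 0 < y ->
  Im (cln (M (x +i* y))) = \int[mu]_l (poisson_ker x y l * eta l).
Proof.
move=> [_ _ [c hc]] y0; rewrite (hc (x +i* y) y0) cImD /= add0r.
apply: eq_Rintegral => l _.
rewrite mulr0 add0r; congr (_ * _).
by rewrite subr0 /poisson_ker sub0r mulNr opprK sqrrN.
Qed.

(** The Poisson kernel has mass pi. *)
Lemma herglotz_coangle (M : R[i] -> R[i]) eta x y : exp_herglotz M eta -> 0 < y ->
  pi - Im (cln (M (x +i* y))) = \int[mu]_l (poisson_ker x y l * (1 - eta l)).
Proof.
move=> hM y0; rewrite (herglotz_angle x hM y0); have [meta eta01 _] := hM.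
have -> : pi = \int[mu]_l poisson_ker x y l by rewrite /Rintegral integral_poisson.
rewrite -RintegralB //; first by apply: eq_Rintegral => l _; ring.
- exact: integrable_poisson.
- by apply: integrable_poissonM => // l; apply: normr01.
Qed.

Section eta_one.
Variables (g : R -> R) (K : R).
Hypotheses (mg : measurable_fun [set: R] g) (g01 : forall l, 0 <= g l <= 1).
Hypothesis hg : forall x y, x < K -> 0 < y -> y < 2^-1 ->
  \int[mu]_l (poisson_ker x y l * g l) <= 4 * y.

Let mEg (D : set R) : measurable_fun D (fun l => (g l)%:E).
Proof. by apply/measurable_EFinP; apply: measurable_funTS. Qed.

Let g0 l : (0 <= (g l)%:E)%E. Proof. by rewrite lee_fin; case/andP: (g01 l). Qed.

(** On [a, a + d) the Poisson kernel with centre a and height d is at least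
    1 / (2 d), and its integral against g is at most 4 d. *)
Lemma small_itv_integral a d : a < K -> 0 < d -> d < 2^-1 ->
  (\int[mu]_(l in `[a, (a + d)%R[) (g l)%:E <= (8 * d ^+ 2)%:E)%E.
Proof.
move=> aK d0 d1.
have mpg : measurable_fun [set: R] (fun l => (poisson_ker a d l * g l)%:E).
  by apply/measurable_EFinP; apply: measurable_funM => //; apply: measurable_poisson.
have pg0 l : (0 <= (poisson_ker a d l * g l)%:E)%E.
  by rewrite lee_fin mulr_ge0 ?poisson_ge0 //; case/andP: (g01 l).
have int : mu.-integrable [set: R] (fun l => (poisson_ker a d l * g l)%:E).
  by apply: integrable_poissonM => // l; apply: normr01.
apply: (@le_trans _ _ (\int[mu]_(l in `[a, (a + d)%R[) ((2 * d)%:E * (poisson_ker a d l * g l)%:E))%E).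
  apply: ge0_le_integral => //.
  - exact: mEg.
  - by apply: measurable_funeM; apply: measurable_funTS.
  move=> l /=; rewrite in_itv /= => /andP[al lad].
  rewrite -EFinM lee_fin mulrA ler_peMl //; first by case/andP: (g01 l).
  rewrite /poisson_ker mulrA ler_pdivlMr ?poisson_den // mul1r.
  have : (l - a) ^+ 2 <= d ^+ 2 by rewrite ler_sqr ?nnegrE ?subr_ge0 ?(ltW d0) //; lra.
  by rewrite -mulrA -expr2; lra.
have dd0 : (0 <= (2 * d)%:E)%E by rewrite lee_fin mulr_ge0 // ltW.
have mpgI : measurable_fun `[a, a + d[%classic (fun l => (poisson_ker a d l * g l)%:E).
  exact: measurable_funTS.
rewrite ge0_integralZl //.
have -> : 8 * d ^+ 2 = 2 * d * (4 * d) by ring.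
rewrite (EFinM (2 * d)) lee_pmul2l ?lte_fin ?mulr_gt0 //.
apply: (@le_trans _ _ (\int[mu]_l (poisson_ker a d l * g l)%:E)%E).
  by apply: ge0_subset_integral.
by rewrite -[leLHS]fineK ?integrable_fin_num // lee_fin; apply: hg.
Qed.

Lemma itv_integral_bound a d (n : nat) : a + n%:R * d <= K -> 0 < d -> d < 2^-1 ->
  (\int[mu]_(l in `[a, (a + n%:R * d)%R[) (g l)%:E <= (n%:R * (8 * d ^+ 2))%:E)%E.
Proof.
move=> + d0 d1; elim: n => [|n IH] hK.
  by rewrite !mul0r addr0 set_itvco0 integral_set0.
have nS : n.+1%:R * d = n%:R * d + d by rewrite -natr1; ring.
have nd : 0 <= n%:R * d by rewrite mulr_ge0 // ltW.
have -> : `[a, a + n.+1%:R * d[%classic =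
    `[a, a + n%:R * d[%classic `|` `[a + n%:R * d, a + n%:R * d + d[%classic.
  by rewrite nS addrA -itv_bndbnd_setU // bnd_simp; lra.
rewrite ge0_integral_setU //; [|exact: mEg|]; last first.
  apply/disj_setPLR => l /=; rewrite !in_itv /= => /andP[_ h] /andP[h' _].
  by have := lt_le_trans h h'; rewrite ltxx.
have -> : n.+1%:R * (8 * d ^+ 2) = n%:R * (8 * d ^+ 2) + 8 * d ^+ 2 by rewrite -natr1; ring.
rewrite EFinD leeD // ?IH //; first by move: hK; rewrite nS; lra.
by apply: small_itv_integral => //; move: hK; rewrite nS; lra.
Qed.

(** Cut the interval of length L into n pieces; each contributes O((L/n)^2) by
    [small_itv_integral], so the total is O(1/n). *)
Lemma itv_integral0 (N : nat) : (\int[mu]_(l in `[(K - N.+1%:R)%R, K[) (g l)%:E = 0)%E.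
Proof.
apply/eqP; rewrite eq_le integral_ge0 ?andbT; last by move=> l _.
apply/lee_addgt0Pr => e e0; rewrite add0e.
pose L : R := N.+1%:R.
have L0 : 0 < L by [].
have e1 : 0 < Num.min (2^-1 / L) (e / (8 * L ^+ 2)).
  by rewrite lt_min !divr_gt0 // mulr_gt0 // exprn_gt0.
have [n0 _ hn0] := @near_infty_natSinv_lt R (PosNum e1).
have := hn0 n0 (leqnn _); rewrite /= lt_min => /andP[h1 h2].
set d := L / n0.+1%:R.
have d0 : 0 < d by rewrite divr_gt0.
have n0d : n0.+1%:R * d = L by rewrite mulrCA divff ?mulr1 // pnatr_eq0.
have := @itv_integral_bound (K - L) d n0.+1; rewrite n0d subrK => /(_ (lexx _) d0).
have d1 : d < 2^-1 by move: h1; rewrite ltr_pdivlMr // mulrC.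
move=> /(_ d1) /le_trans; apply; rewrite lee_fin.
have -> : n0.+1%:R * (8 * d ^+ 2) = (n0.+1%:R * d) * (8 * d) by ring.
rewrite n0d; move: h2; rewrite ltr_pdivlMr ?mulr_gt0 ?exprn_gt0 // => /ltW.
by rewrite /d; apply: le_trans; rewrite le_eqVlt; apply/orP; left; apply/eqP; ring.
Qed.

Lemma ae0_of_poisson_le : \forall l \ae mu, l < K -> g l = 0.
Proof.
have h N : mu.-negligible [set l | ~ (l \in `[K - N.+1%:R, K[%R -> g l = 0)].
  have mI : measurable (`[K - N.+1%:R, K[%classic : set R) by [].
  have := (@ae_eq_integral_abs _ _ R mu _ mI (fun l => (g l)%:E) (@mEg _)).1.
  have -> : (\int[mu]_(x in `[(K - N.+1%:R)%R, K[) `|(g x)%:E| = 0)%E.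
    by rewrite -[RHS](itv_integral0 N); apply: eq_integral => l _; rewrite gee0_abs.
  move=> /(_ erefl); apply: negligibleS => l /= hl hl'; apply: hl => lN.
  by have := hl' lN => -[].
apply: (negligibleS _ (negligible_bigcup h)) => l /= hl.
have lK : l < K by apply: contrapT => lK; apply: hl => /lK.
exists (Num.trunc (K - l)) => //= hl'; apply: hl => _; apply: hl'.
rewrite in_itv /= lK andbT lerBlDr -lerBlDl ltW //.
by have /andP[_] := trunc_itv (ltW (eq_ind_r (fun b => is_true b) lK (subr_gt0 l K))).
Qed.

End eta_one.
End inversion.

(** * The integral of the difference of the exponents *)

Section difference.
Variable R : realType.
Implicit Types (x y l : R) (eta g : R -> R).
Local Notation mu := (@lebesgue_measure R).

Lemma ae_imp (P Q : R -> Prop) : (forall l, P l -> Q l) ->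
  (\forall l \ae mu, P l) -> \forall l \ae mu, Q l.
Proof. by move=> PQ; apply: negligibleS => l /= nQ p; apply: nQ; apply: PQ. Qed.

Lemma ae_imp2 (P Q S : R -> Prop) : (forall l, P l -> Q l -> S l) ->
  (\forall l \ae mu, P l) -> (\forall l \ae mu, Q l) -> \forall l \ae mu, S l.
Proof.
move=> PQS hP hQ; apply: negligibleS (negligibleU hP hQ) => l /= nS.
have [p|] := pselect (P l); last by left.
by right => q; apply: nS; apply: PQS.
Qed.

(** What the inversion needs to know about M near the negative axis: [m] are its
    boundary values, of negative sign, and [P] plays the role of their
    derivative. *)
Definition neg_axis (M : R[i] -> R[i]) (m P : R -> R) (K : R) :=
  forall x, x < K -> [/\ m x < 0, 0 <= P x, P x <= - m x &
    forall y, 0 < y -> `|Re (M (x +i* y)) - m x| <= y ^+ 2 * P x /\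
                       `|Im (M (x +i* y)) - y * P x| <= y ^+ 2 * P x].

Section axis.
Variables (M : R[i] -> R[i]) (m P : R -> R) (K : R).
Hypothesis hM : neg_axis M m P K.

Lemma neg_axis_Re x y : x < K -> 0 < y -> y < 2^-1 ->
  Re (M (x +i* y)) < 0 /\ - m x / 2 <= `|Re (M (x +i* y))|.
Proof.
move=> /hM[m0 P0 Pm h] y0 y1; have [] := h _ y0; rewrite !ler_norml => /andP[h1 h2] _.
have yP : y ^+ 2 * P x <= - m x / 4.
  have y2 : y ^+ 2 <= 4^-1 by rewrite expr2; nra.
  apply: (@le_trans _ _ (4^-1 * P x)); first by rewrite ler_wpM2r.
  lra.
have a0 : Re (M (x +i* y)) < 0 by lra.
by split => //; rewrite ltr0_norm //; lra.
Qed.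

Lemma neg_axis_coangle x y : x < K -> 0 < y -> y < 2^-1 ->
  pi - Im (cln (M (x +i* y))) <= 4 * y.
Proof.
move=> xK y0 y1; have [a0 ha] := neg_axis_Re xK y0 y1.
have [m0 P0 Pm h] := hM xK; have [_] := h _ y0.
rewrite (pi_sub_arg a0) => hb; apply: le_trans (atan_le (divr_ge0 _ _)) _ => //.
rewrite ler_pdivrMr ?normr_gt0 ?lt_eqF //.
have yP : `|Im (M (x +i* y))| <= 2 * y * P x.
  move: hb; rewrite !ler_norml => /andP[h1 h2].
  have : y ^+ 2 * P x <= y * P x by rewrite ler_wpM2r // expr2 ler_piMr ?ltW //; lra.
  have : 0 <= y * P x by rewrite mulr_ge0 // ltW.
  by move=> ? ?; apply/andP; split; lra.
apply: (le_trans yP); apply: (@le_trans _ _ (4 * y * (- m x / 2))).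
  have -> : 4 * y * (- m x / 2) = 2 * y * (- m x) by field.
  by rewrite ler_wpM2l // mulr_ge0 // ltW.
by rewrite ler_wpM2l // mulr_ge0 // ltW.
Qed.

(** [pi - arg M = atan (|Im M| / |Re M|)], where Im M / y tends to P and Re M to
    m; and atan t lies between t / (1 + t^2) and t. *)
Lemma neg_axis_cvg x : x < K ->
  (pi - Im (cln (M (x +i* y)))) / y @[y --> 0^'+] --> P x / - m x.
Proof.
move=> xK; have [m0 P0 Pm h] := hM xK.
pose t y := `|Im (M (x +i* y))| / `|Re (M (x +i* y))|.
have h1 : Im (M (x +i* y)) / y @[y --> 0^'+] --> P x.
  apply/cvgrPdist_le => e e0; near=> y.
  have y0 : 0 < y by near: y; exact: nbhs_right_gt.
  have [_ hb] := h _ y0.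
  have -> : P x - Im (M (x +i* y)) / y = - ((Im (M (x +i* y)) - y * P x) / y).
    by field; rewrite gt_eqF.
  rewrite normrN normrM normfV (gtr0_norm y0) ler_pdivrMr //; apply: (le_trans hb).
  rewrite expr2 -mulrA [leRHS]mulrC ler_wpM2l ?(ltW y0) //.
  apply: mul_le_of_le_div => //; rewrite ?(ltW y0) //.
  by apply: ltW; near: y; apply: nbhs_right_lt; rewrite divr_gt0 // ltr_wpDl.
have h2 : Re (M (x +i* y)) @[y --> 0^'+] --> m x.
  apply/cvgrPdist_le => e e0; near=> y.
  have y0 : 0 < y by near: y; exact: nbhs_right_gt.
  have y1 : y < 1 by near: y; apply: nbhs_right_lt.
  have [ha _] := h _ y0.
  rewrite distrC; apply: (le_trans ha).
  apply: (@le_trans _ _ (y * P x)).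
    by rewrite ler_wpM2r // expr2 ler_piMr ?ltW.
  apply: mul_le_of_le_div => //; rewrite ?(ltW y0) //.
  by apply: ltW; near: y; apply: nbhs_right_lt; rewrite divr_gt0 // ltr_wpDl.
have h3 : t y / y @[y --> 0^'+] --> P x / - m x.
  have m0' : `|m x| != 0 by rewrite normr_eq0 lt_eqF.
  have h6 : `|Im (M (x +i* y)) / y| / `|Re (M (x +i* y))| @[y --> 0^'+] --> P x / - m x.
    rewrite -(ger0_norm P0) -(ltr0_norm m0); apply: cvgM; first exact: cvg_norm.
    by apply: cvgV => //; exact: cvg_norm.
  apply: cvg_trans h6; apply: near_eq_cvg; near=> y.
  have y0 : 0 < y by near: y; exact: nbhs_right_gt.
  by rewrite /t /= normrM normfV (gtr0_norm y0) mulrAC.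
have h4 : t y @[y --> 0^'+] --> 0.
  have h6 : (t y / y) * y @[y --> 0^'+] --> (P x / - m x) * 0.
    by apply: cvgM => //; apply: cvg_at_right_filter; exact: cvg_id.
  rewrite mulr0 in h6; apply: cvg_trans h6; apply: near_eq_cvg; near=> y.
  have y0 : 0 < y by near: y; exact: nbhs_right_gt.
  by rewrite /= divfK // gt_eqF.
have h5 : (t y / y) / (1 + t y ^+ 2) @[y --> 0^'+] --> P x / - m x.
  rewrite -[X in _ --> X]mulr1; apply: cvgM => //.
  rewrite -[X in _ --> X]invr1; apply: cvgV; first exact: oner_neq0.
  rewrite -[X in _ --> X]addr0; apply: cvgD; first exact: cvg_cst.
  have h7 : t y * t y @[y --> 0^'+] --> (0 * 0 : R) by exact: (cvgM h4 h4).
  rewrite mulr0 in h7; apply: cvg_trans h7; apply: near_eq_cvg.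
  by near=> y; rewrite expr2.
apply: (squeeze_cvgr _ h5 h3); near=> y.
have y0 : 0 < y by near: y; exact: nbhs_right_gt.
have y1 : y < 2^-1 by near: y; apply: nbhs_right_lt.
have [a0 _] := neg_axis_Re xK y0 y1.
rewrite (pi_sub_arg a0) -/(t y).
have t0 : 0 <= t y by rewrite divr_ge0.
rewrite mulrAC ler_wpM2r ?invr_ge0 ?(ltW y0) ?atan_ge //=.
by rewrite ler_wpM2r ?invr_ge0 ?(ltW y0) // atan_le.
Unshelve. all: by end_near. Qed.

(** The Poisson integral of 1 - eta is pi - arg M, which is at most 4 y. *)
Lemma neg_axis_eta1 eta : exp_herglotz M eta -> \forall l \ae mu, l < K -> eta l = 1.
Proof.
move=> hE; have [meta eta01 _] := hE.
have : \forall l \ae mu, l < K -> 1 - eta l = 0.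
  apply: ae0_of_poisson_le.
  - by apply: measurable_funB => //; exact: measurable_cst.
  - by move=> l; have /andP[e0 e1] := eta01 l; apply/andP; split; lra.
  - move=> x y xK y0 y1; rewrite -(herglotz_coangle x hE y0).
    exact: neg_axis_coangle.
by apply: ae_imp => l h /h h'; lra.
Qed.

End axis.

Section kernel.
Variables (zeta : R -> R) (K : R).
Hypotheses (mz : measurable_fun [set: R] zeta) (z1 : forall l, `|zeta l| <= 1).
Hypothesis z0 : \forall l \ae mu, l < K -> zeta l = 0.

(** Continuous away from the pole, which is a single point. *)
Lemma measurable_inv_sqr x : measurable_fun [set: R] (fun l => (l - x) ^- 2).
Proof.
have m1 : measurable [set x] by exact: measurable_set1.
rewrite -(setUv [set x]); apply/measurable_funU => //; first exact: measurableC.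
split; first exact: measurable_fun_set1.
apply: open_continuous_measurable_fun; first by rewrite openC; apply: accessible_closed_set1; exact: hausdorff_accessible.
move=> l; rewrite inE /= => lx; apply: cvgV.
  by rewrite expf_neq0 // subr_eq0; apply/eqP.
by apply: (cvg_comp (fun l => l - x) (fun t => t ^+ 2)); [apply: cvgB; [exact: cvg_id|exact: cvg_cst]|exact: exprn_continuous].
Qed.

(** A representative of [zeta] vanishing at every point below K, so that the
    kernels can be bounded pointwise. *)
Let zeta_cut_fun l : R := \1_(`[K, +oo[%classic) l * zeta l.

Let measurable_cut : measurable_fun [set: R] zeta_cut_fun.
Proof. by apply: measurable_funM => //; exact: measurable_indic. Qed.

(** Where the cut function does not vanish, |l - x| is at least 1. *)
Let cut_bound x y l : x < K - 1 -> `|((l - x) ^+ 2 + y ^+ 2)^-1 * zeta_cut_fun l| <= `|2 * poisson_ker x 1 l|.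
Proof.
move=> xK; rewrite normrM [leRHS]ger0_norm; last by rewrite mulr_ge0 // poisson_ge0.
rewrite /zeta_cut_fun indicE mem_setE in_itv /= andbT.
case: (leP K l) => lK; last by rewrite mul0r normr0 mulr0 mulr_ge0 // poisson_ge0.
rewrite mul1r -[leRHS]mulr1 ler_pM // ger0_norm ?invr_ge0 ?addr_ge0 ?sqr_ge0 //.
have d1 : 1 <= (l - x) ^+ 2 by rewrite -(expr1n _ 2) ler_sqr ?nnegrE //; lra.
have yy := sqr_ge0 y.
rewrite /poisson_ker expr1n mul1r -[2]invrK -invfM lef_pV2 ?posrE; last 2 first.
- by rewrite ltr_pwDl // (lt_le_trans ltr01).
- by rewrite mulr_gt0 ?invr_gt0 // ltr_wpDl // sqr_ge0.
lra.
Qed.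

Let mker x y : measurable_fun [set: R] (fun l => ((l - x) ^+ 2 + y ^+ 2)^-1 : R).
Proof.
have [->|y0] := eqVneq y 0.
  by under eq_fun do rewrite expr0n addr0; apply: measurable_inv_sqr.
have yp : 0 < `|y| by rewrite normr_gt0.
have -> : (fun l => ((l - x) ^+ 2 + y ^+ 2)^-1) = (fun l => `|y|^-1 * poisson_ker x `|y| l).
  by apply: funext => l; rewrite /poisson_ker mulrA mulVf ?gt_eqF // mul1r real_normK ?num_real.
by apply: measurable_funM => //; apply: measurable_poisson.
Qed.

Let cut_int x y : x < K - 1 ->
  mu.-integrable [set: R] (fun l => (((l - x) ^+ 2 + y ^+ 2)^-1 * zeta_cut_fun l)%:E).
Proof.
move=> xK.
have i1 : mu.-integrable [set: R] (fun l => (2 * poisson_ker x 1 l)%:E).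
  by under eq_fun do rewrite EFinM; apply: integrableZl => //; exact: integrable_poisson.
apply: le_integrable i1 => //.
  by apply/measurable_EFinP; apply: measurable_funM => //; exact: mker.
by move=> l _; rewrite !abse_EFin lee_fin cut_bound.
Qed.

Let zeta_ae_cut : \forall l \ae mu, zeta l = zeta_cut_fun l.
Proof.
apply: ae_imp z0 => l h; rewrite /zeta_cut_fun indicE mem_setE in_itv /= andbT.
by case: (leP K l) => lK; rewrite ?mul1r // mul0r h.
Qed.

Lemma integrable_kernelM x y : x < K - 1 ->
  mu.-integrable [set: R] (fun l => (((l - x) ^+ 2 + y ^+ 2)^-1 * zeta l)%:E).
Proof.
move=> xK; have /integrableP[mc ic] := cut_int y xK.
apply/integrableP; split.
  by apply/measurable_EFinP; apply: measurable_funM => //; exact: mker.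
apply: le_lt_trans ic; rewrite le_eqVlt; apply/orP; left; apply/eqP.
apply: ae_eq_integral => //.
- by apply: measurableT_comp => //; apply/measurable_EFinP; apply: measurable_funM => //; exact: mker.
- by apply: measurableT_comp.
- by apply: ae_imp zeta_ae_cut => l /= ->.
Qed.

(** The relative difference of the kernels 1/((l - x)^2 + y^2) and 1/(l - x)^2 is
    y^2 / ((l - x)^2 + y^2), which is at most y^2 where |l - x| >= 1. *)
Lemma poisson_approx x y : x < K - 1 -> 0 < y ->
  `|(\int[mu]_l (poisson_ker x y l * zeta l)) / y - \int[mu]_l ((l - x) ^- 2 * zeta l)|
    <= y ^+ 2 * (2 * pi).
Proof.
move=> xK y0.
have iy : mu.-integrable [set: R] (fun l => (poisson_ker x y l * zeta l)%:E).
  exact: integrable_poissonM.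
have i0 : mu.-integrable [set: R] (fun l => ((l - x) ^- 2 * zeta l)%:E).
  by have := integrable_kernelM 0 xK; under eq_fun do rewrite expr0n addr0.
rewrite mulrC -RintegralZl //.
have iz : mu.-integrable [set: R] (fun l => (y^-1 * (poisson_ker x y l * zeta l))%:E).
  by under eq_fun do rewrite EFinM; apply: integrableZl.
rewrite -RintegralB //.
have ib : mu.-integrable [set: R] (fun l => (y ^+ 2 * (2 * poisson_ker x 1 l))%:E).
  under eq_fun do rewrite mulrA EFinM; apply: integrableZl => //; exact: integrable_poisson.
have id : mu.-integrable [set: R]
    (fun l => (y^-1 * (poisson_ker x y l * zeta l) - (l - x) ^- 2 * zeta l)%:E).
  by under eq_fun do rewrite EFinB; apply: integrableB.
have -> : \int[mu]_l (y^-1 * (poisson_ker x y l * zeta l) - (l - x) ^- 2 * zeta l) =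
    \int[mu]_l (y^-1 * (poisson_ker x y l * zeta_cut_fun l) - (l - x) ^- 2 * zeta_cut_fun l).
  congr fine; apply: ae_eq_integral => //.
  - by apply/measurable_EFinP; apply: measurable_funB; apply: measurable_funM => //;
      [apply: measurable_funM => //; apply: measurable_poisson|apply: measurable_inv_sqr].
  - by apply/measurable_EFinP; apply: measurable_funB; apply: measurable_funM => //;
      [apply: measurable_funM => //; apply: measurable_poisson|apply: measurable_inv_sqr].
  - by apply: ae_imp zeta_ae_cut => l /= ->.
have bound l : `|y^-1 * (poisson_ker x y l * zeta_cut_fun l) - (l - x) ^- 2 * zeta_cut_fun l| <=
    y ^+ 2 * (2 * poisson_ker x 1 l).
  have := cut_bound 0 l xK; rewrite expr0n addr0 => hb.
  rewrite [X in _ <= X](ger0_norm) in hb; last by rewrite mulr_ge0 // poisson_ge0.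
  have [->|cl] := eqVneq (zeta_cut_fun l) 0.
    by rewrite !mulr0 subrr normr0 mulr_ge0 ?sqr_ge0 // mulr_ge0 // poisson_ge0.
  have d1 : 1 <= (l - x) ^+ 2.
    move: cl; rewrite /zeta_cut_fun indicE mem_setE in_itv /= andbT.
    case: (leP K l) => lK; last by rewrite mul0r eqxx.
    by move=> _; rewrite -(expr1n _ 2) ler_sqr ?nnegrE //; lra.
  have d0 : (l - x) ^+ 2 != 0 by rewrite gt_eqF // (lt_le_trans ltr01).
  have dy : 1 <= (l - x) ^+ 2 + y ^+ 2 by rewrite (le_trans d1) // lerDl sqr_ge0.
  have dy0 : (l - x) ^+ 2 + y ^+ 2 != 0 by rewrite gt_eqF // (lt_le_trans ltr01).
  have -> : y^-1 * (poisson_ker x y l * zeta_cut_fun l) - (l - x) ^- 2 * zeta_cut_fun l =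
      - (y ^+ 2 / ((l - x) ^+ 2 + y ^+ 2)) * ((l - x) ^- 2 * zeta_cut_fun l).
    rewrite /poisson_ker; move: ((l - x) ^+ 2) d0 dy0 => D d0 dy0.
    by field; rewrite dy0 d0 gt_eqF.
  rewrite normrM normrN ler_pM // ger0_norm ?divr_ge0 ?sqr_ge0 ?(le_trans ler01) //.
  by rewrite ler_pdivrMr ?(lt_le_trans ltr01) // ler_peMr // sqr_ge0.
have mc : measurable_fun [set: R]
    (fun l => (y^-1 * (poisson_ker x y l * zeta_cut_fun l) - (l - x) ^- 2 * zeta_cut_fun l)%:E).
  by apply/measurable_EFinP; apply: measurable_funB; apply: measurable_funM => //;
    [apply: measurable_funM => //; apply: measurable_poisson|apply: measurable_inv_sqr].
have ic : mu.-integrable [set: R]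
    (fun l => (y^-1 * (poisson_ker x y l * zeta_cut_fun l) - (l - x) ^- 2 * zeta_cut_fun l)%:E).
  apply: le_integrable ib => // l _; rewrite !abse_EFin lee_fin (le_trans (bound l)) //.
  exact: ler_norm.
apply: (le_trans (le_normr_Rintegral _ ic)) => //.
have -> : y ^+ 2 * (2 * pi) = \int[mu]_l (y ^+ 2 * (2 * poisson_ker x 1 l)).
  have i1 : mu.-integrable [set: R] (fun l => (2 * poisson_ker x 1 l)%:E).
    by under eq_fun do rewrite EFinM; apply: integrableZl => //; exact: integrable_poisson.
  rewrite RintegralZl //.
  rewrite RintegralZl //; last exact: integrable_poisson.
  by rewrite /Rintegral integral_poisson.
apply: le_Rintegral => //.
apply: le_integrable ic => //.
  by apply/measurable_EFinP; apply: measurableT_comp => //; apply/measurable_EFinP.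
by move=> l _; rewrite !abse_EFin normr_id.
Qed.

End kernel.

(** By [neg_axis_eta1] the difference of the exponents vanishes near x, so the
    Poisson integrals divided by y converge to the integral of the
    difference against (l - x)^-2, while
    [neg_axis_cvg] gives their limit in terms of M and M0. *)
Lemma herglotz_difference (M M0 : R[i] -> R[i]) (m m0 P P0 : R -> R) (K : R) eta eta0 x :
  neg_axis M m P K -> neg_axis M0 m0 P0 K ->
  exp_herglotz M eta -> exp_herglotz M0 eta0 -> x < K - 1 ->
  mu.-integrable [set: R] (fun l => ((l - x) ^- 2 * (eta l - eta0 l))%:E) /\
  \int[mu]_l ((l - x) ^- 2 * (eta l - eta0 l)) = P x / m x - P0 x / m0 x.
Proof.
move=> hM hM0 hE hE0 xK.
have [meta e01 _] := hE; have [meta0 e001 _] := hE0.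
pose zeta l := eta l - eta0 l.
have mz : measurable_fun [set: R] zeta by apply: measurable_funB.
have z1 l : `|zeta l| <= 1.
  have /andP[? ?] := e01 l; have /andP[? ?] := e001 l.
  by rewrite ler_norml /zeta; apply/andP; split; lra.
have z0 : \forall l \ae mu, l < K -> zeta l = 0.
  apply: ae_imp2 (neg_axis_eta1 hM hE) (neg_axis_eta1 hM0 hE0) => l h h0 lK.
  by rewrite /zeta h // h0 // subrr.
split; first by have := integrable_kernelM mz z1 z0 0 xK; under eq_fun do rewrite expr0n addr0.
have xK' : x < K by lra.
set J := \int[mu]_l _.
pose F y := (pi - Im (cln (M0 (x +i* y)))) / y - (pi - Im (cln (M (x +i* y)))) / y.
have FJ : F y @[y --> 0^'+] --> J.
  apply/cvgrPdist_le => e e0; near=> y.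
  have y0 : 0 < y by near: y; exact: nbhs_right_gt.
  have y1 : y < 1 by near: y; apply: nbhs_right_lt.
  have -> : F y = (\int[mu]_l (poisson_ker x y l * zeta l)) / y.
    have -> : \int[mu]_l (poisson_ker x y l * zeta l) =
        Im (cln (M (x +i* y))) - Im (cln (M0 (x +i* y))).
      rewrite (herglotz_angle x hE y0) (herglotz_angle x hE0 y0) -RintegralB //.
      - by apply: eq_Rintegral => l _; rewrite /zeta mulrBr.
      - by apply: integrable_poissonM => // l; apply: normr01.
      - by apply: integrable_poissonM => // l; apply: normr01.
    by rewrite /F -mulrBl; congr (_ / _); ring.
  rewrite distrC; apply: le_trans (poisson_approx mz z1 z0 xK y0) _.
  apply: (@le_trans _ _ (y * (2 * pi))).
    by rewrite ler_wpM2r ?mulr_ge0 ?pi_ge0 // expr2 ler_piMr ?ltW.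
  apply: mul_le_of_le_div; rewrite ?mulr_ge0 ?pi_ge0 ?(ltW y0) //.
  by apply: ltW; near: y; apply: nbhs_right_lt; rewrite divr_gt0 // ltr_wpDl // mulr_ge0 ?pi_ge0.
have FL : F y @[y --> 0^'+] --> P0 x / - m0 x - P x / - m x.
  by apply: cvgB; apply: neg_axis_cvg; eassumption.
have -> : J = P0 x / - m0 x - P x / - m x by apply: cvg_unique FJ FL.
by rewrite !invrN; ring.
Unshelve. all: by end_near. Qed.
End difference.

(** * Expansion of the difference of logarithmic derivatives *)

Section asymptotics.
Variable R : realType.

(** For M0 = - n, M = - n - q + e and squared norms P and P - q' + r of the two
    defect vectors.  Dividing everything by n leaves p = P/n and q/n of order
    1/D, e/n and q'/n of order 1/D^2, and r/n of order 1/D^3; the products of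
    p and q/n cancel against the derivative of q / M0. *)
Lemma log_derivative_expansion (D n P q e q' r L : R) :
  0 < n -> 0 <= P -> 1 <= D -> 0 <= L -> 2 * (L + L ^+ 2) <= D ->
  D * P <= n -> `|q| <= L * P -> `|e| * D <= L ^+ 2 * P ->
  `|q'| * D <= 2 * L * P -> `|r| * D ^+ 2 <= 3 * L ^+ 2 * P ->
  `|(P - q' + r) / (- n - q + e) - P / - n + (q' * - n - q * P) / (- n) ^+ 2|
     * D ^+ 3 <= 14 * L ^+ 2 + 6 * L ^+ 3 /\
  `|(q' * - n - q * P) / (- n) ^+ 2| * D ^+ 2 <= 3 * L.
Proof.
move=> n0 P0 D1 L0 LD hP hq he hq' hr.
have D0 : 0 < D by lra.
pose p := P / n; pose a := q / n; pose b := e / n; pose s := q' / n; pose rho := r / n.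
have nE : n != 0 by rewrite gt_eqF.
have p0 : 0 <= p by rewrite divr_ge0 // ltW.
have pD : p * D <= 1 by rewrite /p mulrAC ler_pdivrMr // mul1r mulrC.
have nn (x : R) : `|x / n| = `|x| / n by rewrite normrM normfV (gtr0_norm n0).
have aD : `|a| * D <= L.
  rewrite nn mulrAC ler_pdivrMr //; apply: (@le_trans _ _ (L * P * D)).
    by rewrite ler_wpM2r // ltW.
  by rewrite -mulrA ler_wpM2l // mulrC.
have bD : `|b| * D ^+ 2 <= L ^+ 2.
  rewrite nn mulrAC ler_pdivrMr // expr2 mulrA; apply: (@le_trans _ _ (L ^+ 2 * P * D)).
    by rewrite ler_wpM2r // ltW.
  by rewrite -mulrA ler_wpM2l ?sqr_ge0 // mulrC.
have sD : `|s| * D ^+ 2 <= 2 * L.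
  rewrite nn mulrAC ler_pdivrMr // expr2 mulrA; apply: (@le_trans _ _ (2 * L * P * D)).
    by rewrite ler_wpM2r // ltW.
  by rewrite -[_ * D]mulrA ler_wpM2l ?mulr_ge0 // mulrC.
have rD : `|rho| * D ^+ 3 <= 3 * L ^+ 2.
  rewrite nn mulrAC ler_pdivrMr // exprSr mulrA; apply: (@le_trans _ _ (3 * L ^+ 2 * P * D)).
    by rewrite ler_wpM2r // ltW.
  by rewrite -[_ * D]mulrA ler_wpM2l ?mulr_ge0 ?sqr_ge0 // mulrC.
have a1 : `|a| <= L / D by rewrite ler_pdivlMr.
have b1 : `|b| * D <= L ^+ 2.
  by apply: le_trans (bD); rewrite ler_wpM2l // expr2 ler_peMr // ltW.
have abD : `|a - b| * D <= L + L ^+ 2.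
  apply: (@le_trans _ _ ((`|a| + `|b|) * D)); first by rewrite ler_wpM2r ?ler_normB // ltW.
  rewrite mulrDl; exact: lerD.
have ab2 : `|a - b| <= 2^-1.
  rewrite -(ler_pM2r D0); apply: (le_trans abD); lra.
have den : 2^-1 <= 1 + a - b by move: ab2; rewrite ler_norml => /andP[? ?]; lra.
have den0 : 1 + a - b != 0 by rewrite gt_eqF //; lra.
have Q'E : (q' * - n - q * P) / (- n) ^+ 2 = - (s + a * p).
  by rewrite /s /a /p; field.
have saD : `|s + a * p| * D ^+ 2 <= 3 * L.
  apply: (@le_trans _ _ ((`|s| + `|a| * p) * D ^+ 2)).
    rewrite ler_wpM2r ?sqr_ge0 //; apply: (le_trans (ler_normD _ _)).
    by rewrite (normrM a p) (ger0_norm p0).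
  rewrite mulrDl.
  have : `|a| * p * D ^+ 2 <= L * 1.
    rewrite (_ : `|a| * p * D ^+ 2 = (`|a| * D) * (p * D)); last by ring.
    by rewrite ler_pM // mulr_ge0 // ltW.
  by move=> ?; lra.
split; last by rewrite Q'E normrN.
have -> : (P - q' + r) / (- n - q + e) - P / - n + (q' * - n - q * P) / (- n) ^+ 2 =
   (- rho - b * p - (a - b) * (s + a * p)) / (1 + a - b).
  have dn : - n - q + e != 0.
    have -> : - n - q + e = - n * (1 + a - b) by rewrite /a /b; field.
    by rewrite mulf_neq0 // oppr_eq0.
  rewrite /rho /a /b /p /s in den0 *; field; apply/and3P; split => //.
  by move: dn; rewrite -oppr_eq0 !opprD !opprK.
rewrite normrM normfV (ger0_norm (le_trans _ den)) ?invr_ge0 //.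
rewrite mulrAC ler_pdivrMr ?(lt_le_trans _ den) ?invr_gt0 //.
set N := _ - _ - _.
have NE : `|N| * D ^+ 3 <= 7 * L ^+ 2 + 3 * L ^+ 3.
  apply: (@le_trans _ _ ((`|rho| + `|b| * p + `|a - b| * `|s + a * p|) * D ^+ 3)).
    rewrite ler_wpM2r ?exprn_ge0 ?(ltW D0) //; apply: (le_trans (ler_normB _ _)).
    rewrite (normrM (a - b)) lerD2r; apply: (le_trans (ler_normB _ _)).
    by rewrite normrN (normrM b p) (ger0_norm p0).
  rewrite [leLHS]mulrDl [X in X + _ <= _]mulrDl.
  have h1 : `|b| * p * D ^+ 3 <= L ^+ 2 * 1.
    rewrite (_ : `|b| * p * D ^+ 3 = (`|b| * D ^+ 2) * (p * D)); last by ring.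
    by rewrite ler_pM // mulr_ge0 ?sqr_ge0 // ltW.
  have h2 : `|a - b| * `|s + a * p| * D ^+ 3 <= (L + L ^+ 2) * (3 * L).
    rewrite (_ : _ * D ^+ 3 = (`|a - b| * D) * (`|s + a * p| * D ^+ 2)); last by ring.
    by rewrite ler_pM // mulr_ge0 ?sqr_ge0 // ltW.
  have -> : 7 * L ^+ 2 + 3 * L ^+ 3 = 3 * L ^+ 2 + L ^+ 2 * 1 + (L + L ^+ 2) * (3 * L) by ring.
  by rewrite !lerD.
have C0 : 0 <= 7 * L ^+ 2 + 3 * L ^+ 3 by rewrite addr_ge0 // mulr_ge0 // ?exprn_ge0.
by apply: (le_trans NE); nra.
Qed.

Lemma is_derive_quad (f : R -> R) (x d C e : R) : 0 < e ->
  (forall h, `|h| < e -> `|f (x + h) - f x - h * d| <= C * h ^+ 2) ->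
  is_derive x 1 f d.
Proof.
move=> e0 hf.
have lim : h^-1 *: (f (h *: 1 + x) - f x) @[h --> 0^'] --> d.
  apply/cvgrPdist_le => eps eps0; near=> h.
  have h0 : h != 0 by near: h; exact: nbhs_dnbhs_neq.
  have he : `|h| < e by near: h; apply: dnbhs0_lt.
  have hC : `|h| < eps / (`|C| + 1).
    by near: h; apply: dnbhs0_lt; rewrite divr_gt0 // ltr_wpDl.
  have hn : 0 < `|h| by rewrite normr_gt0.
  rewrite distrC /GRing.scale /= mulr1 [h + x]addrC.
  have -> : h^-1 * (f (x + h) - f x) - d = h^-1 * (f (x + h) - f x - h * d) by field.
  rewrite normrM normfV ler_pdivrMl //; apply: (le_trans (hf h he)).
  apply: (@le_trans _ _ (`|C| * `|h| ^+ 2)).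
    by rewrite real_normK ?num_real // ler_wpM2r ?sqr_ge0 // ler_norm.
  rewrite expr2 mulrCA ler_wpM2l // mulrC.
  by apply: mul_le_of_le_div => //; exact: ltW.
apply: DeriveDef; first by apply/cvg_ex; exists d.
exact: cvg_lim lim.
Unshelve. all: by end_near. Qed.

End asymptotics.

(** * Estimates for the defect vectors *)

Section defect_estimates.
Variables (R : realType) (H : hilbertType R).
Implicit Types (u v w : H).
Local Notation i := ('i%C : R[i]).

(** With x1 a point where m + k is already negative, [mreal_growth] yields
    (x1 - x) P(x) <= - (m(x) + k) to the left of x1; one unit further to the left
    this also bounds P itself. *)
Lemma mfun_neg_axis (A : set (H * H)) (c : R) up (k : R) :
  selfadjoint_ge A c -> nrm up = 1 ->
  (forall B : R, exists2 x, x < c - 1 & mreal A up x < B) ->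
  exists K, K <= c - 1 /\ forall K', K' <= K ->
    neg_axis (fun z => mfun A up z + k%:C) (fun x => mreal A up x + k)
       (fun x => nrm (defect A up x%:C) ^+ 2) K' /\
    forall x, x < K' -> (K' - x) * nrm (defect A up x%:C) ^+ 2 <= - (mreal A up x + k).
Proof.
move=> hA np hunb; have [x1 x1c hx1] := hunb (- k).
exists (x1 - 1); split=> [|K' K'x1]; first by lra.
have grow x : x < K' -> (x1 - x) * nrm (defect A up x%:C) ^+ 2 <= - (mreal A up x + k).
  move=> xK; have xx1 : x < x1 by lra.
  have x1c' : x1 < c by lra.
  have := mreal_growth hA np xx1 x1c'; lra.
split; last first.
  move=> x xK; apply: le_trans (grow x xK); rewrite ler_wpM2r ?sqr_ge0 //; lra.
move=> x xK; have xx1 : x < x1 by lra.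
have xc : x < c by lra.
have P0 : 0 <= nrm (defect A up x%:C) ^+ 2 by rewrite sqr_ge0.
have h1 : nrm (defect A up x%:C) ^+ 2 <= - (mreal A up x + k).
  apply: le_trans (grow x xK); rewrite ler_peMl //; lra.
split=> //.
  have x1c' : x1 < c by lra.
  have := mreal_growth hA np xx1 x1c'.
  have : 0 <= (x1 - x) * nrm (defect A up x%:C) ^+ 2 by rewrite mulr_ge0 //; lra.
  lra.
move=> y y0; rewrite (mfun_vertical hA np y xc).
set w := ⟨_, _⟩.
have wb : normc w <= nrm (defect A up x%:C) ^+ 2.
  apply: (le_trans (cauchy_schwarz _ _)); rewrite expr2 ler_wpM2l ?nrm_ge0 //.
  have := @resolvent_nrm _ _ _ _ hA (x +i* y) (defect A up x%:C) xc.
  apply: le_trans; rewrite ler_peMl ?nrm_ge0 //= ; lra.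
have y2 : 0 <= y ^+ 2 by rewrite sqr_ge0.
have Rw := le_trans (Re_le_normc w) wb.
have Iw : `|Im w| <= nrm (defect A up x%:C) ^+ 2.
  apply: le_trans wb; rewrite -(@ler_pXn2r _ 2) ?nnegrE ?normc_ge0 ?normr_ge0 // sqr_normc_ReIm.
  by rewrite real_normK ?num_real // lerDr sqr_ge0.
move: (mreal A up x) => a; rewrite !(cReD, cImD) !(cReN, cImN) !(cReZ, cImZ) !(cReM, cImM) /=.
split.
  rewrite (_ : _ - _ = - (y ^+ 2 * Re w)); last by ring.
  by rewrite normrN normrM (ger0_norm y2) ler_wpM2l.
rewrite (_ : _ - y * _ = - (y ^+ 2 * Im w)); last by ring.
by rewrite normrN normrM (ger0_norm y2) ler_wpM2l.
Qed.

Section derivatives.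
Variables (A : set (H * H)) (c : R) (up : H) (V : {linear H -> H}) (L : R).
Hypotheses (hA : selfadjoint_ge A c) (np : nrm up = 1).
Hypothesis sV : forall u v, ⟨V u, v⟩ = ⟨u, V v⟩.
Hypotheses (L0 : 0 <= L) (hL : forall u, nrm (V u) <= L * nrm u).
Variables (x : R) (xc : x < c).
Let u := defect A up x%:C.

Let k := 2 / (c - x).
Let k0 : 0 < k. Proof. by rewrite divr_gt0 // subr_gt0. Qed.

Let near_nrm (h : R) v : `|h| < (c - x) / 2 ->
  x + h < c /\ nrm (op_resolvent A (x + h)%:C v) <= k * nrm v.
Proof.
rewrite ltr_norml => /andP[h1 h2].
have xh : x + h < c by move: xc; lra.
split=> //; have := @resolvent_nrm _ _ _ _ hA (x + h)%:C v xh.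
rewrite -[complex.Re _]/(x + h) => hr.
rewrite /k -ler_pdivrMl ?divr_gt0 ?subr_gt0 // invf_div.
apply: le_trans hr; rewrite ler_wpM2r ?nrm_ge0 //; lra.
Qed.

Let e0 : 0 < (c - x) / 2. Proof. by rewrite divr_gt0 // subr_gt0. Qed.

Lemma is_derive_mreal : is_derive x 1 (mreal A up) (nrm u ^+ 2).
Proof.
apply: (@is_derive_quad _ _ _ _ (k * nrm u ^+ 2) _ e0) => h hh.
have [xh hr] := near_nrm u hh.
rewrite (mreal_diff hA np xc xh) (defect_diffR hA up xc xh) -/u.
rewrite innerDr innerZr cReD cReZ nrm2.
have -> : x + h - x = h by ring.
set t := Re _.
have ht : `|t| <= k * nrm u ^+ 2.
  apply: (le_trans (Re_inner_norm _ _)).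
  by rewrite expr2 mulrCA ler_wpM2l ?nrm_ge0.
rewrite (_ : _ - _ = h ^+ 2 * t); last by ring.
by rewrite normrM (ger0_norm (sqr_ge0 h)) [leRHS]mulrC ler_wpM2l ?sqr_ge0.
Qed.

Lemma is_derive_form : is_derive x 1
  (fun y => Re ⟨defect A up y%:C, V (defect A up y%:C)⟩)
  (2 * Re ⟨u, V (op_resolvent A x%:C u)⟩).
Proof.
apply: (@is_derive_quad _ _ _ _ (3 * L * k ^+ 2 * nrm u ^+ 2) _ e0) => h hh.
have [xh hr] := near_nrm u hh.
rewrite (defect_diffR hA up xc xh) -/u.
have -> : x + h - x = h by ring.
set r := op_resolvent A (x + h)%:C u in hr *; set r0 := op_resolvent A x%:C u.
have rE : r = r0 + h%:C *: op_resolvent A (x + h)%:C r0.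
  apply: (resolventE hA) => //.
  have h1 := @resolventP _ _ _ _ hA x%:C u xc.
  have h2 := linZ (sg_lin hA) h%:C (@resolventP _ _ _ _ hA (x + h)%:C r0 xh).
  have := linD (sg_lin hA) h1 h2; congr (A (_, _)); rewrite rmorphD; vring.
have [_ hr0] := @near_nrm 0 u ltac:(by rewrite normr0).
have [_ hr1] := near_nrm r0 hh.
set r1 := op_resolvent A (x + h)%:C r0 in rE hr1.
rewrite addr0 -/r0 in hr0.
have E : Re ⟨u + h%:C *: r, V (u + h%:C *: r)⟩ - Re ⟨u, V u⟩ - h * (2 * Re ⟨u, V r0⟩) =
   h ^+ 2 * (2 * Re ⟨u, V r1⟩ + Re ⟨r, V r⟩).
  have s1 : Re ⟨r, V u⟩ = Re ⟨u, V r⟩ by rewrite -sV Re_innerC.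
  rewrite linearD linearZ /= !innerE !conjc_real !(cReD, cReZ) s1.
  have -> : Re ⟨u, V r⟩ = Re ⟨u, V r0⟩ + h * Re ⟨u, V r1⟩.
    by rewrite {1}rE linearD linearZ /= innerDr innerZr cReD cReZ.
  ring.
rewrite E normrM (ger0_norm (sqr_ge0 h)) [leRHS]mulrC ler_wpM2l ?sqr_ge0 //.
apply: (le_trans (ler_normD _ _)); rewrite normrM (@ger0_norm _ 2) //.
have b1 : `|Re ⟨u, V r1⟩| <= L * k ^+ 2 * nrm u ^+ 2.
  apply: (le_trans (Re_inner_norm _ _)).
  rewrite [leRHS](_ : _ = nrm u * (L * (k * (k * nrm u)))); last by ring.
  rewrite ler_wpM2l ?nrm_ge0 // (le_trans (hL _)) // ler_wpM2l // (le_trans hr1) //.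
  by rewrite ler_wpM2l // ltW.
have b2 : `|Re ⟨r, V r⟩| <= L * k ^+ 2 * nrm u ^+ 2.
  apply: (le_trans (Re_inner_norm _ _)).
  rewrite [leRHS](_ : _ = (k * nrm u) * (L * (k * nrm u))); last by ring.
  by rewrite ler_pM ?nrm_ge0 // (le_trans (hL _)) // ler_wpM2l.
lra.
Qed.

End derivatives.

Section remainder.
Variables (A A0 : set (H * H)) (c : R) (V : {linear H -> H}) (L : R).
Hypotheses (hA : selfadjoint_ge A c) (hA0 : selfadjoint_ge A0 c).
Hypothesis AA0 : forall f g, A0 (f, g) <-> A (f, g + V f).
Hypothesis sV : forall u v, ⟨V u, v⟩ = ⟨u, V v⟩.
Hypotheses (L0 : 0 <= L) (hL : forall u, nrm (V u) <= L * nrm u).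
Variables (x D : R) (D0 : 0 < D) (xD : x + D <= c) (u : H).
Let xc : x < c. Proof. by move: D0 xD; lra. Qed.

Let r := op_resolvent A x%:C (V u).
Let r0 := op_resolvent A0 x%:C u.

Let res_le (B : set (H * H)) v : selfadjoint_ge B c -> D * nrm (op_resolvent B x%:C v) <= nrm v.
Proof.
move=> hB; have := @resolvent_nrm _ _ _ _ hB x%:C v xc.
by apply: le_trans; rewrite ler_wpM2r ?nrm_ge0 // -[complex.Re _]/x; move: xD; lra.
Qed.

(** Every resolvent contributes a factor 1/D and every V a factor L.  In the last
    bound the terms of first order in V cancel up to the difference of R and R0,
    which the second resolvent identity turns into R V R0. *)
Lemma perturbation_bounds :
  let P := nrm u ^+ 2 in
  [/\ `|Re ⟨u, V u⟩| <= L * P, `|Re ⟨V u, r⟩| * D <= L ^+ 2 * P,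
      `|2 * Re ⟨u, V r0⟩| * D <= 2 * L * P &
      `|nrm (u - r) ^+ 2 - P + 2 * Re ⟨u, V r0⟩| * D ^+ 2 <= 3 * L ^+ 2 * P].
Proof.
have D0' := ltW D0.
have un := nrm_ge0 u.
have rn : D * nrm r <= L * nrm u by apply: le_trans (res_le _ hA) _.
have r0n : D * nrm r0 <= nrm u by apply: res_le.
have b1 : `|Re ⟨u, V u⟩| <= L * nrm u ^+ 2.
  apply: (le_trans (Re_inner_norm _ _)).
  by rewrite expr2 mulrCA ler_wpM2l.
have b2 : `|Re ⟨V u, r⟩| * D <= L ^+ 2 * nrm u ^+ 2.
  apply: (@le_trans _ _ (nrm (V u) * nrm r * D)).
    by rewrite ler_wpM2r // Re_inner_norm.
  rewrite -mulrA [_ * D]mulrC [leRHS](_ : _ = (L * nrm u) * (L * nrm u)); last by ring.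
  by rewrite ler_pM ?nrm_ge0 // mulr_ge0 ?nrm_ge0.
have b3 : `|Re ⟨u, V r0⟩| * D <= L * nrm u ^+ 2.
  apply: (@le_trans _ _ (nrm u * nrm (V r0) * D)).
    by rewrite ler_wpM2r // Re_inner_norm.
  rewrite expr2 mulrCA -mulrA ler_wpM2l //.
  apply: (@le_trans _ _ (L * nrm r0 * D)); first by rewrite ler_wpM2r.
  by rewrite -mulrA ler_wpM2l // mulrC.
split=> //; first by rewrite normrM (@ger0_norm _ 2) //; lra.
(* second resolvent identity: R0 u = R u + R V R0 u *)
pose s := op_resolvent A x%:C u; pose t := op_resolvent A x%:C (V r0).
have r0E : r0 = s + t.
  have h : A (r0, (1 *: u + V r0) + x%:C *: r0).
    have := (AA0 _ _).1 (@resolventP _ _ _ _ hA0 x%:C u xc); rewrite -/r0.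
    by congr (A (_, _)); vring.
  have := @resolventE _ _ _ _ hA x%:C _ _ xc h.
  by rewrite (resolvent_lin hA) // scale1r => <-.
have tn : nrm t * D ^+ 2 <= L * nrm u.
  rewrite expr2 mulrA [nrm t * D]mulrC.
  apply: (@le_trans _ _ (nrm (V r0) * D)); first by rewrite ler_wpM2r // res_le.
  apply: (@le_trans _ _ (L * nrm r0 * D)); first by rewrite ler_wpM2r.
  by rewrite -mulrA ler_wpM2l // mulrC.
have E : nrm (u - r) ^+ 2 - nrm u ^+ 2 + 2 * Re ⟨u, V r0⟩ = 2 * Re ⟨u, V t⟩ + nrm r ^+ 2.
  rewrite nrm2B r0E linearD innerDr cReD.
  have -> : Re ⟨u, r⟩ = Re ⟨u, V s⟩.
    by rewrite /r -(resolvent_sym hA) // -/s Re_innerC sV.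
  ring.
rewrite E.
apply: (@le_trans _ _ ((2 * `|Re ⟨u, V t⟩| + nrm r ^+ 2) * D ^+ 2)).
  rewrite ler_wpM2r ?sqr_ge0 //; apply: (le_trans (ler_normD _ _)).
  by rewrite normrM (@ger0_norm _ 2) // (ger0_norm (sqr_ge0 _)).
have c1 : `|Re ⟨u, V t⟩| * D ^+ 2 <= L ^+ 2 * nrm u ^+ 2.
  apply: (@le_trans _ _ (nrm u * nrm (V t) * D ^+ 2)).
    by rewrite ler_wpM2r ?sqr_ge0 // Re_inner_norm.
  rewrite [leRHS](_ : _ = nrm u * (L * (L * nrm u))); last by ring.
  rewrite -mulrA ler_wpM2l //.
  apply: (@le_trans _ _ (L * nrm t * D ^+ 2)); first by rewrite ler_wpM2r ?sqr_ge0.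
  by rewrite -mulrA ler_wpM2l.
have c2 : nrm r ^+ 2 * D ^+ 2 <= L ^+ 2 * nrm u ^+ 2.
  rewrite -!exprMn ler_sqr ?nnegrE ?mulr_ge0 ?nrm_ge0 //.
  by rewrite mulrC.
by rewrite mulrDl -mulrA; lra.
Qed.

End remainder.
End defect_estimates.

(** * Proof of the theorem *)

Section limsup.
Variable R : realType.

Lemma limf_esup_bounded (f : R -> \bar R) (B : R) :
  (\forall z \near -oo, ((- B)%:E <= f z <= B%:E)%E) ->
  exists s : R, limf_esup f -oo = s%:E.
Proof.
move=> fB; have up : (limf_esup f (-oo)%R <= B%:E)%E.
  apply: (@le_trans _ _ (ereal_sup (f @` [set z | ((- B)%:E <= f z <= B%:E)%E]))).
    by apply: ereal_inf_lbound; exists [set z | ((- B)%:E <= f z <= B%:E)%E].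
  by apply: ge_ereal_sup => _ [z /= /andP[_ h] <-].
have lo : ((- B)%:E <= limf_esup f (-oo)%R)%E.
  apply: le_ereal_inf_tmp => _ [W FW <-].
  have [z [/= /andP[h _] Wz]] := filter_ex (filterI fB FW).
  by apply: (le_trans h); apply: ereal_sup_ubound; exists z.
by move: up lo; case: limf_esup => // s _ _; exists s.
Qed.

End limsup.

Section complex_derivative.
Variable R : realType.

Lemma is_cderive_real (F : R -> R[i]) (f : R -> R) (x d c : R) : x < c ->
  (forall y, y < c -> F y = (f y)%:C) -> is_derive x 1 f d ->
  cderivable F x /\ cderive1 F x = d%:C.
Proof.
move=> xc FE df.
have nE : {near x, f =1 complex.Re (R:=R) \o F}.
  have : \forall y \near x, y < c by apply: lt_nbhsl.
  by apply: filterS => y yc /=; rewrite FE.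
have n0 : {near x, cst 0 =1 complex.Im (R:=R) \o F}.
  have : \forall y \near x, y < c by apply: lt_nbhsl.
  by apply: filterS => y yc /=; rewrite FE.
have d1 : is_derive x 1 (complex.Re (R:=R) \o F) d.
  exact: near_eq_is_derive nE df.
have d2 : is_derive x 1 (complex.Im (R:=R) \o F) 0.
  exact: near_eq_is_derive n0 (is_derive_cst (0 : R) x 1).
split; first by split; [case: d1|case: d2].
by rewrite /cderive1 !derive1E; case: d1 => _ ->; case: d2 => _ ->.
Qed.

End complex_derivative.

Section decay.
Variables (R : realType) (K : R).

Lemma far_left (L c x : R) : 0 <= L -> K <= c - 1 -> x < K - 1 - 2 * (L + L ^+ 2) ->
  [/\ x < K - 1, x < K, x < c, 1 <= K - x & 2 * (L + L ^+ 2) <= K - x].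
Proof. by move=> L0 Kc xX; have := sqr_ge0 L => L2; split; lra. Qed.

(** Far to the left of K the distance to K is comparable with |z|. *)
Lemma half_dist z : z < - 2 * `|K| - 1 -> [/\ z < 0, - z / 2 <= K - z & 1 <= K - z].
Proof.
by have := normr_ge0 K; have := ler_norm (- K); rewrite normrN => k1 k2 k3; split; lra.
Qed.

Lemma cubic_decay (C s z e : R) : 0 < e ->
  z < - 2 * `|K| - 1 -> z < - (8 * C / e) - 1 ->
  `|s| * (K - z) ^+ 3 <= C -> `|s| <= e * `|z| ^- 2.
Proof.
move=> e0 z1 z2 h; have [zn hD _] := half_dist z1.
rewrite ler_pdivlMr ?exprn_gt0 ?normr_gt0 ?lt_eqF //.
have h8 : `|s| * (- z / 2) ^+ 3 <= C.
  apply: le_trans h; rewrite ler_wpM2l // lerXn2r // nnegrE; lra.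
have z3 : C * 8 <= e * - z by rewrite mulrC -ler_pdivrMl // mulrC; lra.
rewrite (ltr0_norm zn) sqrrN -(@ler_pM2r _ (- z)) ?oppr_gt0 //.
apply: le_trans z3; move: h8.
rewrite (_ : `|s| * (- z / 2) ^+ 3 = `|s| * z ^+ 2 * - z / 8); last by field.
lra.
Qed.

Lemma quadratic_bound (C1 C2 s t z : R) : z < - 2 * `|K| - 1 ->
  `|s + t| * (K - z) ^+ 3 <= C1 -> `|t| * (K - z) ^+ 2 <= C2 ->
  `|z ^+ 2 * s| <= 4 * (C1 + C2).
Proof.
move=> z1 h1 h2; have [zn hD D1] := half_dist z1.
rewrite normrM (ger0_norm (sqr_ge0 z)).
have h3 : `|s| <= `|s + t| + `|t| by rewrite -{1}(addrK t s); apply: ler_normB.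
have h4 : z ^+ 2 <= 4 * (K - z) ^+ 2.
  have -> : 4 * (K - z) ^+ 2 = (2 * (K - z)) ^+ 2 by ring.
  by rewrite -(sqrrN z) ler_sqr ?nnegrE; lra.
have h5 : `|s + t| * (K - z) ^+ 2 <= C1.
  by apply: le_trans h1; rewrite ler_wpM2l // exprS ler_peMl ?sqr_ge0.
apply: (@le_trans _ _ (4 * (K - z) ^+ 2 * (`|s + t| + `|t|))).
  by apply: ler_pM => //; apply: sqr_ge0.
by rewrite -mulrA ler_wpM2l // mulrDr; apply: lerD; rewrite mulrC.
Qed.

End decay.

Lemma sin_diff_neq0 (R : realType) (a b : R) :
  0 <= a < pi -> 0 <= b < pi -> a != b -> sin (a - b) != 0.
Proof.
move=> /andP[a0 a1] /andP[b0 b1] ab.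
wlog ba : a b a0 a1 b0 b1 ab / b < a.
  move=> h; move: (ab); rewrite neq_lt => /orP[lt|lt]; last exact: h.
  by rewrite -opprB sinN oppr_eq0; apply: h => //; rewrite eq_sym.
by rewrite gt_eqF // sin_gt0_pi // subr_gt0 ba /= ltrBlDr ltr_wpDr.
Qed.

Theorem theorem4p11 (R : realType) (H : hilbertType R)
  (T : set (H * H)) (V : {linear H -> H})
  (up um up0 um0 : H)
  (alphaF alphaF0 beta beta0 : R) (eta eta0 : R -> R) :
  let T0 := op_sub T V in
  let m := donoghue_m T up um alphaF in
  let m0 := donoghue_m T0 up0 um0 alphaF0 in
  let HF0 := sa_extension T0 up0 um0 alphaF0 in
  let u0 (z : R) : H :=
    op_app (op_shift HF0 'i%C) (op_resolvent HF0 z%:C up0) in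
  let Q (z : R) : R[i] :=
    ⟨u0 z, V (u0 z)⟩ / (m0 z%:C + (cot (beta0 - alphaF0))%:C) in
  separable H ->
  linear_operator T -> closed T -> symmetric_op T -> dense (op_dom T) ->
  deficiency_indices_11 T ->
  continuous V -> op_adjoint (op_graph V) = op_graph V ->
  bounded_below T0 ->
  op_adjoint T (up, 'i%C *: up) -> op_adjoint T (um, - 'i%C *: um) ->
  `|up| = 1 -> `|um| = 1 ->
  op_adjoint T0 (up0, 'i%C *: up0) -> op_adjoint T0 (um0, - 'i%C *: um0) ->
  `|up0| = 1 -> `|um0| = 1 ->
  0 <= alphaF < pi -> sa_extension T up um alphaF = friedrichs T ->
  0 <= alphaF0 < pi -> HF0 = friedrichs T0 ->
  0 <= beta < pi -> 0 <= beta0 < pi -> beta != alphaF ->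
  op_dom (sa_extension T up um beta) = op_dom (sa_extension T0 up0 um0 beta0) ->
  exp_herglotz (fun z => m z + (cot (beta - alphaF))%:C) eta ->
  exp_herglotz (fun z => m0 z + (cot (beta0 - alphaF0))%:C) eta0 ->
  [/\ \forall z \near -oo,
        lebesgue_measure.-integrable [set: R]
          (fun l => ((l - z) ^- 2 * (eta l - eta0 l))%:E)
        /\ cderivable Q z,
      (fun z => (\int[lebesgue_measure]_l
                   ((l - z) ^- 2 * (eta l - eta0 l)))%:C : R[i]^o)
        = (fun z => - cderive1 Q z)
          +o_ (ninfty_nbhs R) (fun z => (`|z| ^- 2)%:C : R[i]^o)
    & exists s : R,
        limf_esup (fun z : R => \int[lebesgue_measure]_l
            (z ^+ 2 * (l - z) ^- 2 * (eta l - eta0 l))%:E)%E -oo = s%:E].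

Proof.
move=> T0 m m0 HF0 u0 Q _ lT clT sT dT dTi cV gV [c0 bT0] hp hm np' nm' hp0 hm0 np0' nm0'.
move=> aF HFE aF0 HF0E bb bb0 ba dom hE hE0.
have cT := closed_seq_closed clT.
have np := nrm1 np'; have nm := nrm1 nm'; have np0 := nrm1 np0'; have nm0 := nrm1 nm0'.
have sV := sym_of_graph gV.
have bV := continuous_linear_bounded cV; have [L L0 hL] := bV.
have sT0 : symmetric_op T0 := sub_sym sT sV.
have lT0 : linear_operator T0 := sub_linear V lT.
have dT0 : dense (op_dom T0) by rewrite (sub_dom T V).
have bT0R f g : T0 (f, g) -> c0 * nrm f ^+ 2 <= complex.Re ⟨f, g⟩.
  move=> /bT0; rewrite nrmE -rmorphXn -rmorphM lecE => /andP[_].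
  by [].
pose c := c0 - L.
have bT f g : T (f, g) -> c * nrm f ^+ 2 <= complex.Re ⟨f, g⟩.
  move=> h; have h0 : T0 (f, g - V f) by apply/op_subP; rewrite subrK.
  have := bT0R _ _ h0; rewrite innerDr innerNr cReD cReN.
  have := Re_inner_norm f (V f); have := hL f; have := nrm_ge0 f.
  move=> h1 h2 h3 h4.
  have h5 : nrm f * nrm (V f) <= L * nrm f ^+ 2 by rewrite expr2 mulrCA ler_wpM2l.
  move: h3; rewrite ler_norml => /andP[h3 _]; rewrite /c; lra.
set A := sa_extension T up um alphaF in HFE.
have hA : selfadjoint_ge A c.
  split; first exact: sa_linear.
  - exact: sa_selfadj.
  - by move=> f g; rewrite HFE; apply: friedrichs_ge.
have AA0 f g : HF0 (f, g) <-> A (f, g + V f).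
  by rewrite HF0E HFE; apply: friedrichs_subP.
have HF0sub : HF0 = op_sub A V.
  apply/seteqP; split=> -[f g]; first by move=> /AA0 h; apply/op_subP.
  by move=> /op_subP h; apply/AA0.
have hA0 : selfadjoint_ge HF0 c.
  split; first exact: sa_linear.
  - apply/seteqP; split=> -[f g].
      rewrite HF0sub => /(adj_subP _ sV); rewrite (sg_adj hA) => h.
      exact/op_subP.
    rewrite {1}HF0sub => /op_subP h; rewrite HF0sub; apply/(adj_subP _ sV).
    by rewrite (sg_adj hA).
  - move=> f g; rewrite HF0E => h; apply: (@le_trans _ _ (c0 * nrm f ^+ 2)).
      by rewrite ler_wpM2r ?sqr_ge0 // /c; lra.
    exact: friedrichs_ge lT0 sT0 bT0R _ _ h.
have sb := sin_diff_neq0 bb aF ba.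
have sb0 : beta0 != alphaF0 -> sin (beta0 - alphaF0) != 0 by apply: sin_diff_neq0.
have c1 : c - 1 < c by lra.
have unb (B : R) : exists2 x, x < c - 1 & mreal A up x < B.
  have := @mreal_unbounded_below _ _ T c up lT sT dT; rewrite -HFE => h.
  exact: h hA (@sa_ext _ _ T up um alphaF) hp np _ c1 B.
have unb0 (B : R) : exists2 x, x < c - 1 & mreal HF0 up0 x < B.
  have := @mreal_unbounded_below _ _ T0 c up0 lT0 sT0 dT0; rewrite -HF0E => h.
  exact: h hA0 (@sa_ext _ _ T0 up0 um0 alphaF0) hp0 np0 _ c1 B.
have [K1 [K1c hK1]] := mfun_neg_axis (cot (beta - alphaF)) hA np unb.
have [K2 [K2c hK2]] := mfun_neg_axis (cot (beta0 - alphaF0)) hA0 np0 unb0.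
(* below K both M and M0 are negative and under control *)
pose K := Num.min K1 K2.
have KK1 : K <= K1 by rewrite ge_min lexx.
have KK2 : K <= K2 by rewrite ge_min lexx orbT.
have Kc : K <= c - 1 by apply: le_trans KK1 K1c.
have Kltc : K < c by rewrite (le_lt_trans Kc) // ltrBlDr ltrDl.
have [ax _] := hK1 _ KK1; have [ax0 gr0] := hK2 _ KK2.
have [kap kap0 hkap] := krein_relation lT sT dT cT dTi sV hp hm np nm hp0 hm0 np0 AA0 hA hA0 dom sb sb0.
clearbody K.
pose M0 x := mreal HF0 up0 x + cot (beta0 - alphaF0).
pose q x := complex.Re ⟨defect HF0 up0 x%:C, V (defect HF0 up0 x%:C)⟩.
pose P x := nrm (defect HF0 up0 x%:C) ^+ 2.
pose q' x := 2 * complex.Re ⟨defect HF0 up0 x%:C, V (op_resolvent HF0 x%:C (defect HF0 up0 x%:C))⟩.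
pose Q' x := (q' x * M0 x - q x * P x) / M0 x ^+ 2.
pose I x := \int[lebesgue_measure]_l ((l - x) ^- 2 * (eta l - eta0 l)).
have QE x : x < c -> Q x = (q x / M0 x)%:C.
  move=> xc; rewrite rmorphM fmorphV /Q /u0 (defect_op_app hA0) //; congr (_ / _).
    by apply: Im0_real; have := congr1 (@complex.Im R) (sV (defect HF0 up0 x%:C) (defect HF0 up0 x%:C));
      rewrite innerC cImJ; lra.
  by rewrite -[m0 _]/(mfun HF0 up0 x%:C) (mrealE hA0) // rmorphD.
have dQ x : x < K -> cderivable Q x /\ cderive1 Q x = (Q' x)%:C.
  move=> xK; have xc : x < c := lt_trans xK Kltc.
  apply: (is_cderive_real xc QE).
  have M0n : M0 x != 0 by have [h _ _ _] := ax0 _ xK; rewrite lt_eqF.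
  have dM0 : is_derive x 1 M0 (P x).
    by have h := is_derive_mreal hA0 np0 xc; apply: is_derive_eq; rewrite addr0.
  have dq := is_derive_form up0 hA0 sV L0 hL xc.
  have h := is_deriveM dq (is_deriveV M0n dM0).
  apply: (is_derive_eq h); rewrite /Q' /GRing.scale /= -/(q x) -/(q' x).
  by field.
(* to the left of X the perturbation q - e is at most half of M0 in size *)
pose X := K - 1 - 2 * (L + L ^+ 2).
have key x : x < X -> [/\ lebesgue_measure.-integrable [set: R]
      (fun l => ((l - x) ^- 2 * (eta l - eta0 l))%:E),
    `|I x + Q' x| * (K - x) ^+ 3 <= 14 * L ^+ 2 + 6 * L ^+ 3 &
    `|Q' x| * (K - x) ^+ 2 <= 3 * L].
  move=> /(far_left L0 Kc)[xK1 xK xc D1 LD].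
  have [int Ix] := herglotz_difference ax ax0 hE hE0 xK1.
  have D0 : 0 < K - x by rewrite subr_gt0.
  have xD : x + (K - x) <= c by rewrite addrC subrK ltW.
  have [hq he hq' hr] := perturbation_bounds hA hA0 AA0 sV L0 hL D0 xD (defect HF0 up0 x%:C).
  have [hk1 hk2] := hkap _ xc.
  have [M0x P0 _ _] := ax0 _ xK.
  have n0 : 0 < - M0 x by rewrite oppr_gt0.
  have [h1 h2] := log_derivative_expansion n0 P0 D1 L0 LD (gr0 _ xK) hq he hq' hr.
  rewrite opprK -/(P x) -/(q x) -/(q' x) -/(Q' x) in h1 h2.
  split=> //; apply: le_trans h1; rewrite le_eqVlt; apply/orP; left; apply/eqP.
  congr (`|_ + _| * _); rewrite /I Ix; congr (_ - _).
  have [Mx _ _ _] := ax _ xK.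
  rewrite [X in _ = X / _](_ : _ = kap * nrm (defect A up x%:C) ^+ 2); last by rewrite hk2; ring.
  rewrite -[M0 x - q x + _]hk1; field.
  by rewrite (gt_eqF kap0) (lt_eqF Mx).
have near_X (Y : R) : \forall x \near -oo, x < Y by apply: nbhs_ninfty_lt; exact: num_real.
pose C1 := 14 * L ^+ 2 + 6 * L ^+ 3.
rewrite -/C1 in key; clearbody C1.
split.
- near=> z; have zX : z < X by near: z.
  have [h _ _] := key _ zX; have [_ zK _ _ _] := far_left L0 Kc zX.
  by split => //; case: (dQ _ zK).
- apply/eqaddoP => eps /gt0_realC[e0 ->]; near=> z.
  have zX : z < X by near: z.
  have [_ h _] := key _ zX; have [_ zK _ _ _] := far_left L0 Kc zX.
  have [_ dE] := dQ _ zK.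
  rewrite !fctE dE opprK -rmorphD !normcC !normcR -rmorphM lecR.
  rewrite (@ger0_norm _ (`|z| ^- 2)) ?invr_ge0 ?sqr_ge0 //.
  by apply: cubic_decay h => //; near: z.
- apply: (@limf_esup_bounded _ _ (4 * (C1 + 3 * L))).
  near=> z.
  have zX : z < X by near: z.
  have z1 : z < - 2 * `|K| - 1 by near: z.
  have [int h1 h2] := key _ zX.
  have -> : (\int[lebesgue_measure]_l (z ^+ 2 * (l - z) ^- 2 * (eta l - eta0 l))%:E = (z ^+ 2 * I z)%:E)%E.
    rewrite /I -RintegralZl // /Rintegral fineK.
      by apply: eq_integral => l _; rewrite mulrA.
    apply: integrable_fin_num => //; under eq_fun do rewrite EFinM.
    exact: integrableZl.
  by rewrite !lee_fin -ler_norml; apply: quadratic_bound h1 h2.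
Unshelve. all: by end_near.
Qed.
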